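(* Let $n\ge 1$. Let $\mathrm{Afr}_n$ be the algebra of formal noncommutative associative power series in $\omega_1,\dots,\omega_n$ with real coefficients, and let $\delta:\mathrm{Afr}_n\to \mathrm{Afr}_n\otimes \mathrm{Afr}_n$ be the continuous unital algebra homomorphism with $\delta(\omega_j)=\omega_j\otimes 1+1\otimes \omega_j+\omega_j\otimes\omega_j$ for $j=1,\dots,n$. Then: (a) The group $\mathrm{Fr}_n^\circ$ (under multiplication in $\mathrm{Afr}_n$) of all elements $g\in \mathrm{Afr}_n$ with constant term $1$ satisfying $\delta(g)=g\otimes g$ is isomorphic to the free Lie group $\mathrm{Fr}_n=\varprojlim_k \mathrm{Fr}_n(k)$. (b) Let $F_n\subset \mathrm{Fr}_n^\circ$ be the free group generated by $1+\omega_1,\dots,1+\omega_n$. The closure $\mathcal F_n$ of $F_n$ in $\mathrm{Fr}_n^\circ$ (this closure being the pronilpotent completion $\varprojlim_k F_n/F_n^{(k)}$ of $F_n$, realized inside $\mathrm{Fr}_n^\circ$) is the subgroup consisting of all elements of $\mathrm{Fr}_n^\circ$ that are formal series with integer coefficients.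
   Context: Monomials are $\omega^\alpha=\omega_{\alpha_1}\cdots\omega_{\alpha_k}$ for finite sequences $\alpha=(\alpha_1,\dots,\alpha_k)$, $k\ge 0$, $1\le \alpha_j\le n$. Elements of $\mathrm{Afr}_n$ are formal series $\sum_\alpha c_\alpha\omega^\alpha$ with $c_\alpha\in\mathbb R$; $\mathrm{Afr}_n$ carries the topology of coefficient-wise convergence (the product topology, each coefficient ranging in $\mathbb R$ with its usual topology), and $\mathrm{Fr}_n^\circ$ carries the induced topology. $\mathrm{Afr}_n\otimes \mathrm{Afr}_n$ denotes the algebra of formal series $\sum_{\alpha,\beta}h_{\alpha,\beta}\,\omega^\alpha\otimes\omega^\beta$, $h_{\alpha,\beta}\in\mathbb R$, with product determined by $(\omega^\alpha\otimes\omega^\beta)(\omega^{\alpha'}\otimes\omega^{\beta'})=\omega^\alpha\omega^{\alpha'}\otimes\omega^\beta\omega^{\beta'}$. By a theorem of Magnus, the elements $1+\omega_1,\dots,1+\omega_n$ freely generate a free group under multiplication, so $F_n$ is identified with the group they generate. $F_n^{(k)}$ denotes the lower central series of $F_n$, indexed so that $F_n^{(0)}=F_n$, $F_n^{(k+1)}=[F_n,F_n^{(k)}]$; the pronilpotent completion is the inverse limit of the discrete nilpotent groups $F_n/F_n^{(k)}$ under the natural surjections. $\mathfrak{fr}_n(k)$ is the real nilpotent Lie algebra with generators $x_1,\dots,x_n$ and relations $[x_{i_1},[x_{i_2},\dots,[x_{i_k},x_{i_{k+1}}]\dots]]=0$ for all index tuples; $\mathrm{Fr}_n(k)$ is the connected,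 simply connected nilpotent Lie group with Lie algebra $\mathfrak{fr}_n(k)$ (the Malcev completion of $F_n/F_n^{(k)}$), and $\mathrm{Fr}_n:=\varprojlim_k\mathrm{Fr}_n(k)$ along the natural projections. *)

(* Defs.v *)
From HB Require Import structures.
From mathcomp Require Import all_boot all_order all_algebra generic_quotient.
From mathcomp Require Import all_classical all_reals all_analysis.

Set Implicit Arguments.
Unset Strict Implicit.
Unset Printing Implicit Defensive.

Import Order.TTheory GRing.Theory Num.Theory.
Import numFieldNormedType.Exports.

Local Open Scope classical_set_scope.
Local Open Scope ring_scope.

(* The series with coefficients in A: the coefficient of the monomial
   w_{a1} ... w_{ak} is [f [:: a1; ...; ak]], with indices in 'I_n. *)
Definition ncseries (A : Type) (n : nat) : Type := seq 'I_n -> A.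

HB.instance Definition _ (A : zmodType) n :=
  GRing.Zmodule.copy (ncseries A n) (seq 'I_n -> A).
HB.instance Definition _ (A : topologicalType) n :=
  Topological.copy (ncseries A n) {ptws (seq 'I_n) -> A}.

Section NcSeriesRing.
Variables (A : nzRingType) (n : nat).
Implicit Types (f g h : ncseries A n) (w : seq 'I_n) (a : A).

Definition ncconst a : ncseries A n := fun w => if w is [::] then a else 0.

Definition ncmul f g : ncseries A n :=
  fun w => \sum_(i < (size w).+1) f (take i w) * g (drop i w).

Lemma ncmul_nil f g : ncmul f g [::] = f [::] * g [::].
Proof. by rewrite /ncmul big_ord1. Qed.

Lemma ncmul_cons f g j w :
  ncmul f g (j :: w) = f [::] * g (j :: w) + ncmul (f \o cons j) g w.
Proof. by rewrite /ncmul big_ord_recl. Qed.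

Lemma ncaddE f g w : (f + g) w = f w + g w. Proof. by []. Qed.

Lemma ncmulDl : left_distributive ncmul +%R.
Proof.
move=> f g h; apply/funext => w; rewrite ncaddE /ncmul -big_split.
by apply: eq_bigr => i _; rewrite mulrDl.
Qed.

Lemma ncmulDr : right_distributive ncmul +%R.
Proof.
move=> f g h; apply/funext => w; rewrite ncaddE /ncmul -big_split.
by apply: eq_bigr => i _; rewrite mulrDr.
Qed.

Lemma ncmul_scalel a f g w : ncmul (fun u => a * f u) g w = a * ncmul f g w.
Proof. by rewrite /ncmul mulr_sumr; apply: eq_bigr => i _; rewrite mulrA. Qed.

Lemma ncmulA : associative ncmul.
Proof.
move=> f g h; apply/funext => w; elim: w f g h => [|j w IH] f g h.
  by rewrite !ncmul_nil mulrA.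
rewrite !(ncmul_cons _ _ j w) ncmul_nil.
have -> : ncmul f g \o cons j =
    (fun u => f [::] * (g \o cons j) u) + ncmul (f \o cons j) g.
  by apply/funext => u; rewrite /= ncmul_cons.
by rewrite ncmulDl ncaddE ncmul_scalel mulrDr -IH mulrA addrA.
Qed.

Lemma ncmul1l : left_id (ncconst 1) ncmul.
Proof.
move=> f; apply/funext => -[|j w]; first by rewrite ncmul_nil mul1r.
rewrite ncmul_cons mul1r /ncmul big1 ?addr0// => i _.
by rewrite /= mul0r.
Qed.

Lemma ncmul1r : right_id (ncconst 1) ncmul.
Proof.
move=> f; apply/funext => w; elim: w f => [|j w IH] f.
  by rewrite ncmul_nil mulr1.
by rewrite ncmul_cons IH /= mulr0 add0r.
Qed.

Lemma ncconst1_neq0 : ncconst 1 != 0.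
Proof. by apply/eqP => /(congr1 (fun f => f [::])) /eqP; rewrite oner_eq0. Qed.

HB.instance Definition _ := GRing.Zmodule_isNzRing.Build (ncseries A n)
  ncmulA ncmul1l ncmul1r ncmulDl ncmulDr ncconst1_neq0.

End NcSeriesRing.

Arguments ncconst {A n}.

Definition ncvar (A : nzRingType) n (j : 'I_n) : ncseries A n :=
  fun w => (w == [:: j])%:R.

Arguments ncvar A {n}.

Notation afr R n := (ncseries R n).

(* Afr (x) Afr, realized as the series over Afr: [h alpha beta] is the
   coefficient of w^alpha (x) w^beta. *)
Notation afr2 R n := (ncseries (ncseries R n) n).

Definition tens (R : realType) n (f g : afr R n) : afr2 R n :=
  fun alpha beta => f alpha * g beta.

(* The last but one clause is R-linearity: c * f is the product of f by the
   constant series c. *)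
Record is_coproduct (R : realType) n (delta : afr R n -> afr2 R n) : Prop :=
  IsCoproduct {
    coproduct_continuous : continuous delta;
    coproductD : {morph delta : f g / f + g};
    coproductM : {morph delta : f g / f * g};
    coproduct1 : delta 1 = 1;
    coproductZ : forall (c : R) (f : afr R n),
      delta (ncconst c * f) = ncconst (ncconst c) * delta f;
    coproduct_var : forall j : 'I_n, delta (ncvar R j) =
      tens (ncvar R j) 1 + tens 1 (ncvar R j) + tens (ncvar R j) (ncvar R j) }.

Record series1 (R : realType) n :=
  Series1 { series1_val :> afr R n; _ : series1_val [::] == 1 }.

HB.instance Definition _ R n := [isSub for @series1_val R n].
HB.instance Definition _ R n := [Choice of series1 R n by <:].
HB.instance Definition _ R n :=
  Topological.copy (series1 R n) (initial_topology (@series1_val R n)).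

Section Series1Group.
Variables (R : realType) (n : nat).
Implicit Types (f g u : afr R n) (x y z : series1 R n).

Lemma series1_nil x : val x [::] = 1.
Proof. by apply/eqP; exact: valP x. Qed.

Lemma ncmulE f g w : (f * g) w = ncmul f g w. Proof. by []. Qed.

Lemma ncsubE f g w : (f - g) w = f w - g w. Proof. by []. Qed.

Lemma ncexp_small u k w : u [::] = 0 -> (size w < k)%N -> (u ^+ k) w = 0.
Proof.
move=> u0; elim: k w => // k IH w wk.
rewrite exprS ncmulE /ncmul big1// => -[[|i] ilt] _ /=.
  by rewrite take0 u0 mul0r.
rewrite IH ?mulr0// size_drop; move: ilt wk; case: (size w) => // m _.
by rewrite subSS !ltnS => mk; rewrite (leq_ltn_trans (leq_subr _ _)).
Qed.

(* 1 / f = sum_k (1 - f)^k; only k <= |w| contributes to the coefficient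
   of w. *)
Definition ncinv f : afr R n :=
  fun w => (\sum_(k < (size w).+1) (1 - f) ^+ k) w.

Lemma ncsumE I (s : seq I) (F : I -> afr R n) w :
  (\sum_(i <- s) F i) w = \sum_(i <- s) F i w.
Proof. by elim/big_rec2: _ => // i a b _ <-. Qed.

Lemma ncinvE f w N : f [::] = 1 -> (size w <= N)%N ->
  ncinv f w = (\sum_(k < N.+1) (1 - f) ^+ k) w.
Proof.
move=> f1 wN; rewrite /ncinv !ncsumE.
rewrite -[LHS](big_mkord xpredT (fun k => ((1 - f) ^+ k) w)).
rewrite -[RHS](big_mkord xpredT (fun k => ((1 - f) ^+ k) w)).
rewrite [RHS](big_cat_nat (n := (size w).+1))//=.
rewrite [X in _ = _ + X]big_nat [X in _ = _ + X]big1 ?addr0// => k /andP[wk _].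
apply: ncexp_small => //.
by rewrite ncsubE f1 subrr.
Qed.

Lemma ncmulfV f : f [::] = 1 -> f * ncinv f = 1.
Proof.
move=> f1; apply/funext => w.
pose S := \sum_(k < (size w).+1) (1 - f) ^+ k.
have -> : (f * ncinv f) w = (f * S) w.
  apply: eq_bigr => i _; congr (_ * _).
  by apply: ncinvE => //; rewrite size_drop leq_subr.
have -> : f * S = 1 - (1 - f) ^+ (size w).+1.
  rewrite -[RHS]opprB subrX1 -mulNr; congr (_ * _).
  by rewrite opprB opprB addrC subrK.
by rewrite ncsubE [X in _ - X]ncexp_small ?subr0// ncsubE f1 subrr.
Qed.

Lemma ncinv_nil f : f [::] = 1 -> ncinv f [::] = 1.
Proof. by move=> f1; rewrite /ncinv /= big_ord1 expr0. Qed.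

Fact series1_mul_subproof x y : (val x * val y) [::] == 1.
Proof. by rewrite ncmulE ncmul_nil !series1_nil mulr1. Qed.
Definition series1_mul x y := Series1 (series1_mul_subproof x y).

Fact series1_one_subproof : (1 : afr R n) [::] == 1.
Proof. by []. Qed.
Definition series1_one := Series1 series1_one_subproof.

Fact series1_inv_subproof x : ncinv (val x) [::] == 1.
Proof. by rewrite ncinv_nil// series1_nil. Qed.
Definition series1_inv x := Series1 (series1_inv_subproof x).

Fact series1_mulA : associative series1_mul.
Proof. by move=> x y z; apply/val_inj; rewrite /= mulrA. Qed.

Fact series1_mul1 : left_id series1_one series1_mul.
Proof. by move=> x; apply/val_inj; rewrite /= mul1r. Qed.

Fact series1_mulr1 : right_id series1_one series1_mul.
Proof. by move=> x; apply/val_inj; rewrite /= mulr1. Qed.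

Fact series1_mulV : right_inverse series1_one series1_inv series1_mul.
Proof. by move=> x; apply/val_inj; rewrite /= ncmulfV// series1_nil. Qed.

Fact series1_mulVl : left_inverse series1_one series1_inv series1_mul.
Proof.
move=> x; have := series1_mulV (series1_inv x).
set y := series1_inv x; set z := series1_inv y => yz.
suff -> : x = z by [].
by rewrite -[LHS]series1_mulr1 -yz series1_mulA series1_mulV series1_mul1.
Qed.

HB.instance Definition _ := isGroup.Build (series1 R n)
  series1_mulA series1_mul1 series1_mulr1 series1_mulVl series1_mulV.

End Series1Group.

Fact magnus_gen_subproof (R : realType) n (j : 'I_n) :
  (1 + ncvar R j) [::] == 1.
Proof. by rewrite ncaddE addr0. Qed.

Definition magnus_gen (R : realType) n (j : 'I_n) : series1 R n :=
  Series1 (magnus_gen_subproof R j).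

Section Groups.
Variable G : groupType.
Implicit Types (A B H K : set G) (x y : G).
Local Open Scope group_scope.

Definition is_subgroup H : Prop :=
  [/\ H 1, forall x y, H x -> H y -> H (x * y) & forall x, H x -> H x^-1].

Definition generated A : set G := smallest is_subgroup A.

Definition commutator_subgroup A B : set G :=
  generated [set [~ a, b] | a in A & b in B].

(* Indexed from lower_central H 0 = H. *)
Definition lower_central H (k : nat) : set G :=
  iter k (commutator_subgroup H) H.

Definition nilpotent : Prop := exists k, lower_central [set: G] k = [set 1].

Definition left_coset x K : set G := [set x * y | y in K].

Definition set_prod A B : set G := [set a * b | a in A & b in B].

(* An element of the inverse limit of the discrete groups H / H^(k) is a
   sequence c of cosets c k of H^(k) in H; the natural surjection from
   H / H^(k.+1) to H / H^(k) maps c k.+1 to c k iff c k.+1 is included in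
   c k. *)
Definition pronilpotent_completion H :
    set {ptws nat -> discrete_topology (set G)} :=
  [set c | (forall k, exists2 x, H x & c k = left_coset x (lower_central H k))
         /\ (forall k, c k.+1 `<=` c k)].

Definition completion_mul (c d : {ptws nat -> discrete_topology (set G)}) :
    {ptws nat -> discrete_topology (set G)} :=
  fun k => set_prod (c k) (d k).

Definition to_completion H x : {ptws nat -> discrete_topology (set G)} :=
  fun k => left_coset x (lower_central H k).

End Groups.

(* f restricts to an isomorphism of topological groups from A, with product mT,
   onto B, with product mU, both with the subspace topology; its values outside A
   are irrelevant. *)
Definition topgroup_iso (T U : topologicalType) (mT : T -> T -> T)
    (mU : U -> U -> U) (A : set T) (B : set U) (f : T -> U) : Prop :=
  [/\ set_bij A B f,
      forall x y, A x -> A y -> f (mT x y) = mU (f x) (f y),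
      {within A, continuous f} &
      exists g : U -> T, (forall x, A x -> g (f x) = x) /\
        {within B, continuous g}].

HB.mixin Record isTopologicalGroup G of Group G & Topological G := {
  mulg_continuous : continuous (fun z : G * G => (z.1 * z.2)%g);
  invg_continuous : continuous (fun x : G => x^-1%g)
}.

#[short(type="topologicalGroupType")]
HB.structure Definition TopologicalGroup :=
  {G of Group G & Topological G & isTopologicalGroup G}.

(* Simple connectedness of a connected group: loops at 1 are contractible. *)
Definition simply_connected (R : realType) (G : topologicalGroupType) : Prop :=
  let I := `[0 : R, 1]%classic in
  forall gamma : R -> G,
    {within I, continuous gamma} -> gamma 0 = 1%g -> gamma 1 = 1%g ->
  exists h : R * R -> G,
    [/\ {within I `*` I, continuous h},
        forall t, I t -> h (0, t) = gamma t,
        forall t, I t -> h (1, t) = 1%g &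
        forall s, I s -> h (s, 0) = 1%g /\ h (s, 1) = 1%g].

Section Smooth.
Variables (R : realType) (V W : normedModType R).

(* For finite-dimensional V and an open set A, the usual class C^k on A. *)
Fixpoint class_C (k : nat) (A : set V) (f : V -> W) : Prop :=
  if k is k'.+1 then
    forall v : V, (forall x, A x -> derivable f x v) /\ class_C k' A ('D_v f)
  else forall x, A x -> {for x, continuous f}.

Definition smooth_near (x : V) (f : V -> W) : Prop :=
  exists A : set V, [/\ open A, A x & forall k, class_C k A f].

End Smooth.

HB.mixin Record isLieAlgebra (R : pzRingType) L of GRing.Lmodule R L := {
  lie : L -> L -> L;
  lieDl : forall a b c, lie (a + b) c = lie a c + lie b c;
  lieDr : forall a b c, lie a (b + c) = lie a b + lie a c;
  lieZl : forall (r : R) a b, lie (r *: a) b = r *: lie a b;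
  lieZr : forall (r : R) a b, lie a (r *: b) = r *: lie a b;
  liexx : forall a, lie a a = 0;
  lie_jacobi : forall a b c,
    lie a (lie b c) + lie b (lie c a) + lie c (lie a b) = 0
}.

#[short(type="lieAlgType")]
HB.structure Definition LieAlgebra (R : pzRingType) :=
  {L of GRing.Lmodule R L & isLieAlgebra R L}.

Lemma lier0 (R : pzRingType) (L : lieAlgType R) (a : L) : lie a 0 = 0.
Proof. by apply: (addIr (lie a 0)); rewrite -lieDr !add0r. Qed.

(* The Lie algebra fr_n(k) given by generators and relations: formal
   expressions modulo the congruence generated by the axioms of Lie algebras and
   the vanishing of the brackets [x_i1, [x_i2, ..., [x_ik, x_i(k+1)] ...]]. *)
Inductive lie_term (K : Type) (n : nat) : Type :=
| LtZero
| LtGen of 'I_n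
| LtAdd of lie_term K n & lie_term K n
| LtOpp of lie_term K n
| LtScale of K & lie_term K n
| LtLie of lie_term K n & lie_term K n.

Arguments LtZero {K n}.
Arguments LtGen {K n}.

HB.instance Definition _ (K : Type) n := gen_eqMixin (lie_term K n).
HB.instance Definition _ (K : Type) n := gen_choiceMixin (lie_term K n).

Section FreeNilpotent.
Variables (R : realType) (n : nat).
Local Notation T := (lie_term R n).

Fixpoint right_bracket (i : 'I_n) (s : seq 'I_n) : T :=
  if s is j :: s' then LtLie (LtGen i) (right_bracket j s') else LtGen i.

Section Quotient.
Variable k : nat.

Inductive lie_cong : T -> T -> Prop :=
| lc_refl a : lie_cong a a
| lc_sym a b : lie_cong a b -> lie_cong b a
| lc_trans a b c : lie_cong a b -> lie_cong b c -> lie_cong a c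
| lc_add a a' b b' :
    lie_cong a a' -> lie_cong b b' -> lie_cong (LtAdd a b) (LtAdd a' b')
| lc_opp a a' : lie_cong a a' -> lie_cong (LtOpp a) (LtOpp a')
| lc_scale r a a' : lie_cong a a' -> lie_cong (LtScale r a) (LtScale r a')
| lc_lie a a' b b' :
    lie_cong a a' -> lie_cong b b' -> lie_cong (LtLie a b) (LtLie a' b')
| lc_addA a b c : lie_cong (LtAdd a (LtAdd b c)) (LtAdd (LtAdd a b) c)
| lc_addC a b : lie_cong (LtAdd a b) (LtAdd b a)
| lc_add0 a : lie_cong (LtAdd LtZero a) a
| lc_addN a : lie_cong (LtAdd (LtOpp a) a) LtZero
| lc_scaleA r s a : lie_cong (LtScale r (LtScale s a)) (LtScale (r * s) a)
| lc_scale1 a : lie_cong (LtScale 1 a) a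
| lc_scaleDr r a b :
    lie_cong (LtScale r (LtAdd a b)) (LtAdd (LtScale r a) (LtScale r b))
| lc_scaleDl r s a :
    lie_cong (LtScale (r + s) a) (LtAdd (LtScale r a) (LtScale s a))
| lc_lieDl a b c :
    lie_cong (LtLie (LtAdd a b) c) (LtAdd (LtLie a c) (LtLie b c))
| lc_lieDr a b c :
    lie_cong (LtLie a (LtAdd b c)) (LtAdd (LtLie a b) (LtLie a c))
| lc_lieZl r a b : lie_cong (LtLie (LtScale r a) b) (LtScale r (LtLie a b))
| lc_lieZr r a b : lie_cong (LtLie a (LtScale r b)) (LtScale r (LtLie a b))
| lc_liexx a : lie_cong (LtLie a a) LtZero
| lc_jacobi a b c :
    lie_cong (LtAdd (LtAdd (LtLie a (LtLie b c)) (LtLie b (LtLie c a)))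
                    (LtLie c (LtLie a b))) LtZero
| lc_nilp i (s : seq 'I_n) : size s = k -> lie_cong (right_bracket i s) LtZero.

Definition lie_congb (a b : T) : bool := `[< lie_cong a b >].

Fact lie_congb_refl : reflexive lie_congb.
Proof. by move=> a; apply/asboolP; exact: lc_refl. Qed.

Fact lie_congb_sym : symmetric lie_congb.
Proof. by move=> a b; apply/asboolP/asboolP; exact: lc_sym. Qed.

Fact lie_congb_trans : transitive lie_congb.
Proof. by move=> b a c /asboolP ab /asboolP bc; apply/asboolP/lc_trans/bc. Qed.

Canonical lie_congb_equiv :=
  EquivRel lie_congb lie_congb_refl lie_congb_sym lie_congb_trans.

Definition fr : Type := {eq_quot lie_congb}%qT.

HB.instance Definition _ := Choice.on fr.
HB.instance Definition _ := EqQuotient.on fr.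

Local Open Scope quotient_scope.

Lemma fr_eqP (a b : T) : lie_cong a b <-> \pi_fr a = \pi_fr b.
Proof.
split=> [ab|/eqmodP/asboolP//].
by apply/eqmodP/asboolP.
Qed.

Lemma fr_reprK (a : T) : lie_cong (repr (\pi_fr a)) a.
Proof. by apply/fr_eqP; rewrite reprK. Qed.

Definition fr_zero : fr := \pi_fr LtZero.
Definition fr_gen (i : 'I_n) : fr := \pi_fr (LtGen i).
Definition fr_add (a b : fr) : fr := \pi_fr (LtAdd (repr a) (repr b)).
Definition fr_opp (a : fr) : fr := \pi_fr (LtOpp (repr a)).
Definition fr_scale (r : R) (a : fr) : fr := \pi_fr (LtScale r (repr a)).
Definition fr_lie (a b : fr) : fr := \pi_fr (LtLie (repr a) (repr b)).

Lemma fr_addE a b : fr_add (\pi a) (\pi b) = \pi_fr (LtAdd a b).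
Proof. by apply/fr_eqP/lc_add; exact: fr_reprK. Qed.

Lemma fr_oppE a : fr_opp (\pi a) = \pi_fr (LtOpp a).
Proof. by apply/fr_eqP/lc_opp; exact: fr_reprK. Qed.

Lemma fr_scaleE r a : fr_scale r (\pi a) = \pi_fr (LtScale r a).
Proof. by apply/fr_eqP/lc_scale; exact: fr_reprK. Qed.

Lemma fr_lieE a b : fr_lie (\pi a) (\pi b) = \pi_fr (LtLie a b).
Proof. by apply/fr_eqP/lc_lie; exact: fr_reprK. Qed.

Let frE := (fr_addE, fr_oppE, fr_scaleE, fr_lieE).

Lemma fr_ind (P : fr -> Prop) : (forall a, P (\pi a)) -> forall a, P a.
Proof. by move=> H a; rewrite -[a]reprK. Qed.

Fact fr_addA : associative fr_add.
Proof.
do 3!elim/fr_ind => ?; rewrite !frE; apply/fr_eqP; exact: lc_addA.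
Qed.

Fact fr_addC : commutative fr_add.
Proof. do 2!elim/fr_ind => ?; rewrite !frE; apply/fr_eqP; exact: lc_addC. Qed.

Fact fr_add0 : left_id fr_zero fr_add.
Proof. elim/fr_ind => ?; rewrite !frE; apply/fr_eqP; exact: lc_add0. Qed.

Fact fr_addN : left_inverse fr_zero fr_opp fr_add.
Proof. elim/fr_ind => ?; rewrite !frE; apply/fr_eqP; exact: lc_addN. Qed.

HB.instance Definition _ :=
  GRing.isZmodule.Build fr fr_addA fr_addC fr_add0 fr_addN.

Lemma fr_addrE (a b : T) : \pi_fr a + \pi_fr b = \pi_fr (LtAdd a b).
Proof. exact: fr_addE. Qed.

Fact fr_scaleA r s (a : fr) : fr_scale r (fr_scale s a) = fr_scale (r * s) a.
Proof.
by elim/fr_ind: a => ?; rewrite !frE; apply/fr_eqP; exact: lc_scaleA.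
Qed.

Fact fr_scale1 : left_id 1 fr_scale.
Proof. elim/fr_ind => ?; rewrite !frE; apply/fr_eqP; exact: lc_scale1. Qed.

Fact fr_scaleDr : right_distributive fr_scale +%R.
Proof.
move=> r; do 2!elim/fr_ind => ?; rewrite /GRing.add/= !frE.
by apply/fr_eqP; exact: lc_scaleDr.
Qed.

Fact fr_scaleDl (a : fr) : {morph fr_scale^~ a : r s / r + s >-> r + s}.
Proof.
move=> r s; elim/fr_ind: a => ?; rewrite [RHS]/GRing.add/= !frE.
by apply/fr_eqP; exact: lc_scaleDl.
Qed.

HB.instance Definition _ := GRing.Zmodule_isLmodule.Build R fr
  fr_scaleA fr_scale1 fr_scaleDr fr_scaleDl.

Fact fr_lieDl (a b c : fr) : fr_lie (a + b) c = fr_lie a c + fr_lie b c.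
Proof.
elim/fr_ind: a => ?; elim/fr_ind: b => ?; elim/fr_ind: c => ?.
by rewrite /GRing.add/= !frE; apply/fr_eqP; exact: lc_lieDl.
Qed.

Fact fr_lieDr (a b c : fr) : fr_lie a (b + c) = fr_lie a b + fr_lie a c.
Proof.
elim/fr_ind: a => ?; elim/fr_ind: b => ?; elim/fr_ind: c => ?.
by rewrite /GRing.add/= !frE; apply/fr_eqP; exact: lc_lieDr.
Qed.

Fact fr_lieZl (r : R) (a b : fr) : fr_lie (r *: a) b = r *: fr_lie a b.
Proof.
elim/fr_ind: a => ?; elim/fr_ind: b => ?.
by rewrite /GRing.scale/= !frE; apply/fr_eqP; exact: lc_lieZl.
Qed.

Fact fr_lieZr (r : R) (a b : fr) : fr_lie a (r *: b) = r *: fr_lie a b.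
Proof.
elim/fr_ind: a => ?; elim/fr_ind: b => ?.
by rewrite /GRing.scale/= !frE; apply/fr_eqP; exact: lc_lieZr.
Qed.

Fact fr_liexx (a : fr) : fr_lie a a = 0.
Proof. by elim/fr_ind: a => ?; rewrite !frE; apply/fr_eqP; exact: lc_liexx. Qed.

Fact fr_lie_jacobi (a b c : fr) :
  fr_lie a (fr_lie b c) + fr_lie b (fr_lie c a) + fr_lie c (fr_lie a b) = 0.
Proof.
elim/fr_ind: a => ?; elim/fr_ind: b => ?; elim/fr_ind: c => ?.
by rewrite !frE !fr_addrE; apply/fr_eqP; exact: lc_jacobi.
Qed.

HB.instance Definition _ := isLieAlgebra.Build R fr
  fr_lieDl fr_lieDr fr_lieZl fr_lieZr fr_liexx fr_lie_jacobi.

End Quotient.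

(* The natural projection fr_n(k+1) -> fr_n(k), the identity on expressions. *)
Definition fr_proj k (a : fr k.+1) : fr k := (\pi_(fr k) (repr a))%qT.

Lemma lie_cong_proj k (a b : T) : lie_cong k.+1 a b -> lie_cong k a b.
Proof.
elim; first exact: lc_refl.
- by move=> *; apply: lc_sym.
- by move=> ? b' *; apply: (@lc_trans k _ b').
- by move=> *; apply: lc_add.
- by move=> *; apply: lc_opp.
- by move=> *; apply: lc_scale.
- by move=> *; apply: lc_lie.
- exact: lc_addA.
- exact: lc_addC.
- exact: lc_add0.
- exact: lc_addN.
- exact: lc_scaleA.
- exact: lc_scale1.
- exact: lc_scaleDr.
- exact: lc_scaleDl.
- exact: lc_lieDl.
- exact: lc_lieDr.
- exact: lc_lieZl.
- exact: lc_lieZr.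
- exact: lc_liexx.
- exact: lc_jacobi.
move=> i [|j s]// [sk]; rewrite /=.
apply: (@lc_trans k _ (LtLie (LtGen i) LtZero)).
  by apply: lc_lie; [exact: lc_refl|exact: lc_nilp].
apply/fr_eqP; rewrite -fr_lieE; exact: (lier0 (fr_gen k i)).
Qed.

Lemma fr_projE k (a : T) : fr_proj (\pi a)%qT = (\pi_(fr k) a)%qT.
Proof. by apply/fr_eqP/lie_cong_proj; exact: fr_reprK. Qed.

End FreeNilpotent.

(* A chart of G at 1, with values in R^d, in which the group operations are
   smooth near 1. Every Lie group of dimension d has one; conversely, translating
   such a chart gives the unique Lie group structure on the topological group G,
   for which the chart is smooth near 1. *)
Record lie_chart (R : realType) (G : topologicalGroupType) (d : nat) :=
  LieChart {
    chart : G -> 'rV[R]_d;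
    chartV : 'rV[R]_d -> G;
    chart_dom : set G;
    chart_dom_open : open chart_dom;
    chart_dom1 : chart_dom 1%g;
    chart_cod_open : open (chart @` chart_dom);
    chartK : forall x, chart_dom x -> chartV (chart x) = x;
    chart_continuous : {within chart_dom, continuous chart};
    chartV_continuous : {within chart @` chart_dom, continuous chartV};
    chart1 : chart 1%g = 0;
    chart_mul_smooth : smooth_near (0, 0)
      (fun z : 'rV[R]_d * 'rV[R]_d => chart (chartV z.1 * chartV z.2)%g);
    chart_inv_smooth : smooth_near 0
      (fun z : 'rV[R]_d => chart (chartV z)^-1%g) }.

(* The bracket of the Lie algebra of G on the tangent space R^d at 1: if
   m(x, y) = x + y + B(x, y) + ... is the Taylor expansion of the product in the
   chart, with B bilinear, then [u, v] = B(u, v) - B(v, u). *)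
Definition chart_bracket (R : realType) (G : topologicalGroupType) (d : nat)
    (c : lie_chart R G d) (u v : 'rV[R]_d) : 'rV[R]_d :=
  let m (z : 'rV[R]_d * 'rV[R]_d) := chart c (chartV c z.1 * chartV c z.2)%g in
  let B x y := 'D_((x, 0) : 'rV[R]_d * 'rV[R]_d)
                 ('D_((0, y) : 'rV[R]_d * 'rV[R]_d) m) (0, 0) in
  B u v - B v u.

(* lg_tangent identifies L with the Lie algebra of the group, computed in the
   chart. *)
Record nilpotent_lie_group (R : realType) (L : lieAlgType R) :=
  NilpotentLieGroup {
    lg_group :> topologicalGroupType;
    lg_hausdorff : hausdorff_space lg_group;
    lg_connected : connected [set: lg_group];
    lg_simply_connected : simply_connected R lg_group;
    lg_nilpotent : nilpotent lg_group;
    lg_dim : nat;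
    lg_chart : lie_chart R lg_group lg_dim;
    lg_tangent : {linear L -> 'rV[R]_lg_dim};
    lg_tangent_bij : bijective lg_tangent;
    lg_tangent_lie : forall a b : L,
      lg_tangent (lie a b) = chart_bracket lg_chart (lg_tangent a) (lg_tangent b)
  }.

(* p is a homomorphism of Lie groups with differential phi at 1; q is p read in
   the charts. *)
Definition lie_group_hom (R : realType) (L M : lieAlgType R)
    (G : nilpotent_lie_group L) (H : nilpotent_lie_group M)
    (phi : L -> M) (p : G -> H) : Prop :=
  let q := chart (lg_chart H) \o p \o chartV (lg_chart G) in
  [/\ {morph p : x y / (x * y)%g},
      continuous p,
      smooth_near 0 q &
      forall a : L, 'D_(lg_tangent G a) q 0 = lg_tangent H (phi a)].

Definition pointwise_mul (G : nat -> topologicalGroupType)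
    (x y : prod_topology G) : prod_topology G := fun k => (x k * y k)%g.

Definition inverse_limit (T : nat -> Type) (p : forall k, T k.+1 -> T k) :
    set (prod_topology T) :=
  [set x | forall k, p k (x k.+1) = x k].

Definition Fr_circ (R : realType) n (delta : afr R n -> afr2 R n) :
    set (series1 R n) :=
  [set g | delta (val g) = tens (val g) (val g)].

Definition free_subgroup (R : realType) n : set (series1 R n) :=
  generated (range (@magnus_gen R n)).

Definition integral_series (R : realType) n : set (series1 R n) :=
  [set g | forall w, val g w \is a Num.int].

Arguments free_subgroup R n : clear implicits.
Arguments integral_series R n : clear implicits.

(* Main.v *)
(* The coefficient of u (x) v in delta(f) is the sum of the coefficients in f of
   the infiltrations of the words u and v: delta is dual to the infiltration
   product.

   (a) The automorphism w_j |-> exp(w_j) - 1 of Afr_n turns delta into the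
   coproduct dual to the shuffle product, for which the w_j are primitive. Up to
   degree k, the elements grouplike for this coproduct are parametrized by
   fr_n(k). Instead of the exponential series, take the solution g of
   Y g = (Y a) g with constant term 1, where Y multiplies a word by its length;
   conversely a is recovered from g because the Dynkin operator convolved with the
   identity is Y, and because the Dynkin operator is Y on Lie elements (Dynkin,
   Specht, Wever). Hence Fr_n(k) is the space fr_n(k) with a polynomial product.

   (b) For a Lyndon word l, the commutator in F_n of 1 + w_i's bracketed by the
   standard factorizations has the form 1 + w^l + (larger words of the same
   length) + (longer words), and these commutators generate F_n^(N-1) modulo
   F_n^(N). In the leading term of an element of Fr_n^o, the coefficient of a
   non-Lyndon word vanishes if those of all smaller words do, by a shuffle
   relation. So the leading term of an integral element of Fr_n^o can be
   eliminated word by word in increasing order by Lyndon commutators, and F_n is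
   dense among the integral elements. The same triangularity shows that an element
   of F_n of the form 1 + (words longer than k) belongs to F_n^(k), as Magnus
   proved; so the topology of the coefficients induces that of the nilpotent
   quotients. *)

From HB Require Import structures.
Require Import Defs.
From mathcomp Require Import all_boot all_order all_algebra.
From mathcomp Require Import all_classical all_reals all_analysis.
From mathcomp Require Import zify ring lra.

Set Implicit Arguments.
Unset Strict Implicit.
Unset Printing Implicit Defensive.

Import Order.TTheory GRing.Theory Num.Theory.
Import numFieldNormedType.Exports.

Local Open Scope classical_set_scope.
Local Open Scope ring_scope.

(** * The coproduct as the dual of the infiltration product *)

(** The obstacle in (a) is that [fr R n k] is only presented: neither its dimension nor the
    injectivity of its map to the series is given. Both come from the Dynkin operator, which yields
    a left inverse of this map without a Poincare-Birkhoff-Witt theorem. The gain from the degree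
    equation over the exponential series is that its inverse is linear: for grouplike [g] the Dynkin
    image of [g] is the logarithmic derivative [(Y g) g^-1], so the logarithm is division by the
    degree followed by the Dynkin operator. Hence derivatives pass through the logarithm, and the
    bracket of the group is read off from the product of two series. In the algebra, convergence is
    replaced by the congruences [eqlt k], and infinite recursions are fixed points of operators that
    only look at shorter words. In (b) the graded Lie ring of the lower central series is never
    constructed: its laws are closure properties of subgroups that contain the next term.
    Integrality enters twice: the coefficient to be eliminated becomes an exponent, and integers at
    distance less than 1 coincide, which makes cosets locally constant. *)

Section Words.
Variable n : nat.
Implicit Types (w : seq 'I_n) (k : nat).

Fixpoint words k : seq (seq 'I_n) :=
  if k is k'.+1 then
    [::] :: [seq j :: w | j <- enum 'I_n, w <- words k']
  else [:: [::]].

Lemma mem_words k w : (w \in words k) = (size w <= k)%N.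
Proof.
elim: k w => [|k IH] [|j w] //=; rewrite inE /= ltnS -IH.
apply/allpairsP/idP => [[[i v] [/= _ vin [_ ->]]]|win]//.
by exists (j, w); split => //=; rewrite mem_enum.
Qed.

Lemma words_uniq k : uniq (words k).
Proof.
elim: k => //= k IH; apply/andP; split.
  by apply/allpairsP => -[[i v] [/= _ _]].
apply: allpairs_uniq => //; first exact: enum_uniq.
by move=> [i v] [j w] _ _ [-> ->].
Qed.

End Words.

Section SeriesAlgebra.
Variables (A : nzRingType) (n : nat).
Implicit Types (f g h : ncseries A n) (w : seq 'I_n) (i j : 'I_n) (c : A).

Definition ncshift j f : ncseries A n := fun w => f (j :: w).

Lemma nc1E w : (1 : ncseries A n) w = (w == [::])%:R.
Proof. by case: w. Qed.

Lemma nc0E w : (0 : ncseries A n) w = 0. Proof. by []. Qed.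

Lemma ncoppE f w : (- f) w = - f w. Proof. by []. Qed.

Lemma ncBE f g w : (f - g) w = f w - g w. Proof. by []. Qed.

Lemma ncsumA I (s : seq I) (F : I -> ncseries A n) w :
  (\sum_(i <- s) F i) w = \sum_(i <- s) F i w.
Proof. by elim/big_rec2: _ => // i a b _ <-. Qed.

Lemma ncME f g w :
  (f * g) w = \sum_(i < (size w).+1) f (take i w) * g (drop i w).
Proof. by []. Qed.

Lemma ncM_nil f g : (f * g) [::] = f [::] * g [::].
Proof. exact: ncmul_nil. Qed.

Lemma ncM_cons f g j w :
  (f * g) (j :: w) = f [::] * g (j :: w) + (ncshift j f * g) w.
Proof. exact: ncmul_cons. Qed.

Lemma ncconstE c w : (ncconst c : ncseries A n) w = if w is [::] then c else 0.
Proof. by []. Qed.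

Lemma shift_const j c : ncshift j (ncconst c) = 0. Proof. by []. Qed.

Lemma ncconstME c f w : (ncconst c * f) w = c * f w.
Proof.
by case: w => [|j w]; rewrite ?ncM_nil// ncM_cons shift_const mul0r addr0.
Qed.

Lemma ncMconst f c w : (f * ncconst c) w = f w * c.
Proof.
elim: w f => [|j w IH] f; first by rewrite ncM_nil.
by rewrite ncM_cons IH mulr0 add0r.
Qed.

Lemma ncconst_is_zmod_morphism : zmod_morphism (@ncconst A n).
Proof.
by move=> a b; apply/funext => -[|j w]; rewrite ncBE /= ?subr0.
Qed.

Lemma ncconst_is_monoid_morphism : monoid_morphism (@ncconst A n).
Proof.
split=> // a b; apply/funext => w; rewrite ncconstME !ncconstE.
by case: w => //; rewrite mulr0.
Qed.

HB.instance Definition _ :=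
  GRing.isZmodMorphism.Build A (ncseries A n) (@ncconst A n)
    ncconst_is_zmod_morphism.
HB.instance Definition _ :=
  GRing.isMonoidMorphism.Build A (ncseries A n) (@ncconst A n)
    ncconst_is_monoid_morphism.

Lemma ncconst0 : ncconst 0 = 0 :> ncseries A n.
Proof. exact: rmorph0. Qed.

Lemma ncconst1 : ncconst 1 = 1 :> ncseries A n.
Proof. by []. Qed.

Lemma shiftM j f g :
  ncshift j (f * g) = ncconst (f [::]) * ncshift j g + ncshift j f * g.
Proof. by apply/funext => w; rewrite ncaddE ncconstME -ncM_cons. Qed.

Lemma shiftD j f g : ncshift j (f + g) = ncshift j f + ncshift j g.
Proof. by []. Qed.

Lemma ncvar_nil j : ncvar A j [::] = 0. Proof. by []. Qed.

Lemma shift_var i j : ncshift i (ncvar A j) = ncconst (i == j)%:R.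
Proof.
apply/funext => w; rewrite /ncshift /ncvar ncconstE eqseq_cons.
by case: w => [|? w]; rewrite ?andbT ?andbF.
Qed.

Lemma ncvarM_nil j f : (ncvar A j * f) [::] = 0.
Proof. by rewrite ncM_nil mul0r. Qed.

Lemma ncvarM_cons i j f w : (ncvar A j * f) (i :: w) = (i == j)%:R * f w.
Proof. by rewrite ncM_cons mul0r add0r shift_var ncconstME. Qed.

Lemma sum_eqop_mul (F : 'I_n -> A) i : \sum_j (i == j)%:R * F j = F i.
Proof.
rewrite (bigD1 i)//= eqxx mul1r big1 ?addr0// => j ji.
by rewrite eq_sym (negbTE ji) mul0r.
Qed.

Lemma series_decomp f :
  f = ncconst (f [::]) + \sum_j ncvar A j * ncshift j f.
Proof.
apply/funext => -[|i w]; rewrite ncaddE ncsumA ncconstE.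
  by rewrite big1 ?addr0// => j _; rewrite ncvarM_nil.
under eq_bigr do rewrite ncvarM_cons.
by rewrite add0r (sum_eqop_mul (fun j => ncshift j f w)).
Qed.

(** Congruence modulo the series of order at least [k]; two series congruent for all [k] are
    equal. *)
Definition eqlt k f g := forall w, (size w < k)%N -> f w = g w.

Lemma eqlt_trans k f g h : eqlt k f g -> eqlt k g h -> eqlt k f h.
Proof. by move=> fg gh w wk; rewrite fg// gh. Qed.

Lemma eqlt_sym k f g : eqlt k f g -> eqlt k g f.
Proof. by move=> fg w wk; rewrite fg. Qed.

Lemma eqltW k m f g : (m <= k)%N -> eqlt k f g -> eqlt m f g.
Proof. by move=> mk fg w wm; rewrite fg// (leq_trans wm). Qed.

Lemma eqltD k f f' g g' :
  eqlt k f f' -> eqlt k g g' -> eqlt k (f + g) (f' + g').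
Proof. by move=> ff gg w wk; rewrite !ncaddE ff// gg. Qed.

Lemma eqltN k f f' : eqlt k f f' -> eqlt k (- f) (- f').
Proof. by move=> ff w wk; rewrite !ncoppE ff. Qed.

Lemma eqltM k f f' g g' :
  eqlt k f f' -> eqlt k g g' -> eqlt k (f * g) (f' * g').
Proof.
move=> ff gg w wk; rewrite !ncME; apply: eq_bigr => i _.
rewrite ff ?gg//; first by rewrite size_drop (leq_ltn_trans (leq_subr _ _)).
by rewrite (leq_ltn_trans _ wk)// size_take_min geq_minr.
Qed.

(** A left factor without constant term consumes at least one letter, so the right factor is only
    read on shorter words. All recursive definitions below are contractive for this reason. *)
Lemma eqltM_raise k f g g' :
  f [::] = 0 -> eqlt k g g' -> eqlt k.+1 (f * g) (f * g').
Proof.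
move=> f0 gg w wk; rewrite !ncME; apply: eq_bigr => -[[|i] /= ilt] _.
  by rewrite take0 f0 !mul0r.
rewrite gg// size_drop; move: ilt wk; case: (size w) => // m _.
by rewrite subSS !ltnS => mk; rewrite (leq_ltn_trans (leq_subr _ _)).
Qed.

Lemma eqltM_raiser k f f' g :
  g [::] = 0 -> eqlt k f f' -> eqlt k.+1 (f * g) (f' * g).
Proof.
move=> g0 ff w wk; rewrite !ncME; apply: eq_bigr => -[i /= ilt] _.
rewrite ltnS leq_eqVlt in ilt; case/orP: ilt => [/eqP ->|ilt].
  by rewrite drop_size g0 !mulr0.
by rewrite ff// size_take ilt (leq_trans ilt).
Qed.

End SeriesAlgebra.

Section MapSeries.
Variables (A B : nzRingType) (n : nat) (phi : {rmorphism A -> B}).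

Definition ncmap (f : ncseries A n) : ncseries B n := phi \o f.

Lemma ncmap_is_zmod_morphism : zmod_morphism ncmap.
Proof.
by move=> f g; apply/funext => w; rewrite /ncmap ncBE /= -rmorphB.
Qed.

Lemma ncmap_is_monoid_morphism : monoid_morphism ncmap.
Proof.
split=> [|f g]; apply/funext => w; rewrite /ncmap /=.
  by rewrite !nc1E rmorph_nat.
by rewrite !ncME rmorph_sum; apply: eq_bigr => i _; rewrite rmorphM.
Qed.

HB.instance Definition _ :=
  GRing.isZmodMorphism.Build (ncseries A n) (ncseries B n) ncmap
    ncmap_is_zmod_morphism.
HB.instance Definition _ :=
  GRing.isMonoidMorphism.Build (ncseries A n) (ncseries B n) ncmap
    ncmap_is_monoid_morphism.

End MapSeries.

Section Series2.
Variables (A : comNzRingType) (n : nat).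
Local Notation S1 := (ncseries A n).
Local Notation S2 := (ncseries (ncseries A n) n).
Implicit Types (f g : S1) (h : S2) (u v w : seq 'I_n) (i j : 'I_n).

Lemma ncM2E h h' u v : (h * h') u v =
  \sum_(i < (size u).+1) \sum_(j < (size v).+1)
    h (take i u) (take j v) * h' (drop i u) (drop j v).
Proof. by rewrite ncME ncsumA; apply: eq_bigr => i _; rewrite ncME. Qed.

(** Exchanges the tensor factors, so that [ncmap], which acts on the inner factor, can also be used
    on the outer one. *)
Definition ncswap h : S2 := fun u v => h v u.

Lemma ncswap_is_zmod_morphism : zmod_morphism ncswap.
Proof. by []. Qed.

Lemma ncswap_is_monoid_morphism : monoid_morphism ncswap.
Proof.
split=> [|h h']; apply/funext => u; apply/funext => v; rewrite /ncswap.
  by case: u; case: v.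
by rewrite !ncM2E exchange_big.
Qed.

HB.instance Definition _ :=
  GRing.isZmodMorphism.Build S2 S2 ncswap ncswap_is_zmod_morphism.
HB.instance Definition _ :=
  GRing.isMonoidMorphism.Build S2 S2 ncswap ncswap_is_monoid_morphism.

Definition tensor f g : S2 := fun u v => f u * g v.

Lemma tensorM f f' g g' : tensor f g * tensor f' g' = tensor (f * f') (g * g').
Proof.
apply/funext => u; apply/funext => v; rewrite ncM2E /tensor !ncME big_distrlr.
apply: eq_bigr => i _; apply: eq_bigr => j _.
by rewrite /= mulrACA.
Qed.

Lemma tensor_split f g : tensor f g = tensor f 1 * tensor 1 g.
Proof. by rewrite tensorM mulr1 mul1r. Qed.

Lemma tensor11 : tensor 1 1 = 1.
Proof.
apply/funext => -[|i u]; apply/funext => -[|j v];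
by rewrite /tensor !nc1E ?mul0r ?mul1r.
Qed.

Lemma tensor_varl j : tensor (ncvar A j) 1 = ncvar S1 j.
Proof.
apply/funext => u; apply/funext => v; rewrite /tensor /ncvar.
by case: eqP => _; rewrite ?mul1r ?mul0r.
Qed.

Lemma tensor_constr f : tensor 1 f = ncconst f.
Proof.
by apply/funext => -[|j u]; apply/funext => v; rewrite /tensor ?mul1r ?mul0r.
Qed.

Definition eqlt2 k (h h' : S2) :=
  forall u v, (size u + size v < k)%N -> h u v = h' u v.

Lemma eqlt2_sym k (h h' : S2) : eqlt2 k h h' -> eqlt2 k h' h.
Proof. by move=> hh u v uvk; rewrite hh. Qed.

Lemma eqlt2D k (h h' g g' : S2) :
  eqlt2 k h h' -> eqlt2 k g g' -> eqlt2 k (h + g) (h' + g').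
Proof. by move=> hh gg u v uvk; rewrite !ncaddE hh// gg. Qed.

Lemma eqlt2M k (h h' g g' : S2) :
  eqlt2 k h h' -> eqlt2 k g g' -> eqlt2 k (h * g) (h' * g').
Proof.
move=> hh gg u v uvk; rewrite !ncM2E.
apply: eq_bigr => i _; apply: eq_bigr => j _.
rewrite hh ?gg//; apply: leq_ltn_trans uvk; rewrite ?size_drop.
  by rewrite leq_add// leq_subr.
by rewrite !size_take_min leq_add// geq_minr.
Qed.

Lemma eqlt2M_raise k h (g g' : S2) :
  h [::] [::] = 0 -> eqlt2 k g g' -> eqlt2 k.+1 (h * g) (h * g').
Proof.
move=> h0 gg u v uvk; rewrite !ncM2E.
apply: eq_bigr => -[i /= ilt] _; apply: eq_bigr => -[j /= jlt] _.
have [|ij] := posnP (i + j).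
  move/eqP; rewrite addn_eq0 => /andP[/eqP -> /eqP ->].
  by rewrite !take0 h0 !mul0r.
by rewrite gg// !size_drop; lia.
Qed.

End Series2.

(* An algebra homomorphism out of the series satisfies
   [D f = f_0 + \sum_j D(w_j) * D(ncshift j f)]; if every [D(w_j)] raises the
   filtration of the target, then this equation determines [D] and forces its
   multiplicativity. *)
Section Substitution.
Variables (A : comNzRingType) (n : nat) (B : nzRingType) (c : {rmorphism A -> B}).
Variables (E : nat -> B -> B -> Prop) (y : 'I_n -> B).
Hypothesis E0 : forall a b, E 0 a b.
Hypothesis Esep : forall a b, (forall k, E k a b) -> a = b.
Hypothesis ED : forall k a a' b b', E k a a' -> E k b b' -> E k (a + b) (a' + b').
Hypothesis Erefl : forall k a, E k a a.
Hypothesis EMr : forall k a a' b, E k a a' -> E k (a * b) (a' * b).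
Hypothesis Eraise : forall k j a a', E k a a' -> E k.+1 (y j * a) (y j * a').
Hypothesis cC : forall r b, c r * b = b * c r.

Definition subst_eq (D : ncseries A n -> B) :=
  forall f, D f = c (f [::]) + \sum_j y j * D (ncshift j f).

Lemma Esum k (F G : 'I_n -> B) :
  (forall j, E k (F j) (G j)) -> E k (\sum_j F j) (\sum_j G j).
Proof. by move=> FG; elim/big_ind2: _ => // *; apply: ED. Qed.

Lemma subst_uniq (D D' : ncseries A n -> B) :
  subst_eq D -> subst_eq D' -> D = D'.
Proof.
move=> DE DE'; apply/funext => f; apply: Esep => k.
elim: k f => [|k IH] f; first exact: E0.
rewrite DE DE'; apply: ED; first exact: Erefl.
by apply: Esum => j; apply: Eraise.
Qed.

Lemma substD (D : ncseries A n -> B) : subst_eq D -> {morph D : f g / f + g}.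
Proof.
move=> DE f g; apply: Esep => k; elim: k f g => [|k IH] f g; first exact: E0.
rewrite DE (DE f) (DE g) ncaddE rmorphD addrACA -big_split.
apply: ED; first exact: Erefl.
by apply: Esum => j; rewrite /= -mulrDr shiftD; apply: Eraise; apply: IH.
Qed.

Lemma subst0 (D : ncseries A n -> B) : subst_eq D -> D 0 = 0.
Proof. by move=> DE; apply: (addrI (D 0)); rewrite -substD// !addr0. Qed.

Lemma subst_const (D : ncseries A n -> B) r : subst_eq D -> D (ncconst r) = c r.
Proof.
move=> DE; rewrite DE /= big1 ?addr0// => j _.
by rewrite shift_const subst0// mulr0.
Qed.

Lemma subst_constM (D : ncseries A n -> B) r f :
  subst_eq D -> D (ncconst r * f) = c r * D f.
Proof.
move=> DE; apply: Esep => k; elim: k f => [|k IH] f; first exact: E0.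
rewrite DE (DE f) mulrDr mulr_sumr ncconstME rmorphM.
apply: ED; first exact: Erefl.
apply: Esum => j; rewrite mulrA cC -mulrA; apply: Eraise.
by rewrite shiftM shift_const mul0r addr0.
Qed.

Lemma substM (D : ncseries A n -> B) : subst_eq D -> {morph D : f g / f * g}.
Proof.
move=> DE f g; apply: Esep => k; elim: k f => [|k IH] f; first exact: E0.
(* Only the copy of [D g] next to the constant term of [f] is expanded; the copies behind [y j] stay
   intact for the induction hypothesis. *)
rewrite DE (DE f) mulrDl mulr_suml {1}(DE g) mulrDr mulr_sumr ncM_nil rmorphM.
rewrite -addrA -big_split; apply: ED; first exact: Erefl.
apply: Esum => j; rewrite /= [c _ * _]mulrA cC -!mulrA -mulrDr.
apply: Eraise; rewrite shiftM substD// subst_constM//.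
by apply: ED; [exact: Erefl|exact: IH].
Qed.

Lemma subst_var (D : ncseries A n -> B) j : subst_eq D -> D (ncvar A j) = y j.
Proof.
move=> DE; rewrite DE ncvar_nil rmorph0 add0r (bigD1 j)//= shift_var eqxx.
rewrite subst_const// rmorph1 mulr1 big1 ?addr0// => i /negbTE ij.
by rewrite shift_var ij rmorph0 subst0// mulr0.
Qed.

(** The sum in [series_decomp] is finite, so a homomorphism can be applied to it term by term. *)
Lemma subst_eqP (D : ncseries A n -> B) :
  {morph D : f g / f + g} -> {morph D : f g / f * g} ->
  (forall r, D (ncconst r) = c r) -> (forall j, D (ncvar A j) = y j) ->
  subst_eq D.
Proof.
move=> DD DM Dc Dv f; rewrite [in LHS](series_decomp f) DD Dc; congr (_ + _).
have D0 : D 0 = 0 by apply: (addrI (D 0)); rewrite -DD !addr0.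
rewrite (big_morph D DD D0).
by apply: eq_bigr => j _; rewrite DM Dv.
Qed.

End Substitution.

Section Coproduct.
Variables (A : comNzRingType) (n : nat).
Local Notation S1 := (ncseries A n).
Local Notation S2 := (ncseries (ncseries A n) n).
Implicit Types (f g : S1) (h : S2) (u v w : seq 'I_n) (a b : 'I_n) (e : bool).

(* The words of the infiltration of u and v if e, and of their shuffle
   otherwise, with multiplicities. *)
Fixpoint mix e u := fix mixu v : seq (seq 'I_n) :=
  match u, v with
  | [::], _ => [:: v]
  | _, [::] => [:: u]
  | a :: u', b :: v' =>
    [seq a :: w | w <- mix e u' v] ++ [seq b :: w | w <- mixu v'] ++
    (if e && (a == b) then [seq a :: w | w <- mix e u' v'] else [::])
  end.

Lemma mix_nill e v : mix e [::] v = [:: v].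
Proof. by case: v. Qed.

Lemma mix_nilr e u : mix e u [::] = [:: u].
Proof. by case: u. Qed.

Lemma mix_cons e a u b v : mix e (a :: u) (b :: v) =
  [seq a :: w | w <- mix e u (b :: v)] ++
  [seq b :: w | w <- mix e (a :: u) v] ++
  (if e && (a == b) then [seq a :: w | w <- mix e u v] else [::]).
Proof. by []. Qed.

Definition mixcop e f : S2 := fun u v => \sum_(w <- mix e u v) f w.

Lemma mixcop_nill e f v : mixcop e f [::] v = f v.
Proof. by rewrite /mixcop mix_nill big_seq1. Qed.

Lemma mixcop_nilr e f u : mixcop e f u [::] = f u.
Proof. by rewrite /mixcop mix_nilr big_seq1. Qed.

Lemma mixcop_cons e f a u b v : mixcop e f (a :: u) (b :: v) =
  mixcop e (ncshift a f) u (b :: v) + mixcop e (ncshift b f) (a :: u) v +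
  (e && (a == b))%:R * mixcop e (ncshift a f) u v.
Proof.
rewrite /mixcop mix_cons !big_cat /= !big_map addrA; congr (_ + _).
by case: ifP => _; rewrite ?big_map ?mul1r// big_nil mul0r.
Qed.

Definition mixcop_gen e j : S2 :=
  tensor (ncvar A j) 1 + tensor 1 (ncvar A j) +
  (if e then tensor (ncvar A j) (ncvar A j) else 0).

Let c : {rmorphism A -> S2} := [the {rmorphism A -> S2} of
  (@ncconst S1 n \o @ncconst A n)].

(** The summands of [mixcop_gen] remove the first letter of the left word, of the right word, or of
    both; these are the clauses of [mix]. *)
Lemma mixcop_subst e : subst_eq c (mixcop_gen e) (mixcop e).
Proof.
move=> f; apply/funext => u; apply/funext => v.
rewrite ncaddE ncsumA ncaddE ncsumA /c /=.
under eq_bigr => j _ do rewrite /mixcop_gen tensor_varl tensor_constr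
  !mulrDl !ncaddE ncconstME.
rewrite !big_split /=.
have vl (F : 'I_n -> S2) : \sum_j (ncvar S1 j * F j) u v =
    if u is a :: u' then F a u' v else 0.
  case: u => [|a u]; first by rewrite big1// => j _; rewrite ncvarM_nil.
  rewrite (bigD1 a)//= ncvarM_cons eqxx mul1r big1 ?addr0// => j ja.
  by rewrite ncvarM_cons eq_sym (negbTE ja) mul0r.
have vr (F : 'I_n -> S1) : \sum_j (ncvar A j * F j) v =
    if v is b :: v' then F b v' else 0.
  case: v {vl} => [|b v]; first by rewrite big1// => j _; rewrite ncvarM_nil.
  under eq_bigr do rewrite ncvarM_cons.
  by rewrite (sum_eqop_mul (fun j => F j v)).
rewrite vl vr.
have -> : \sum_i
   ((if e then tensor (ncvar A i) (ncvar A i) else 0) *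
    mixcop e (ncshift i f)) u v =
   match u, v with
   | a :: u', b :: v' => (e && (a == b))%:R * mixcop e (ncshift a f) u' v'
   | _, _ => 0 end.
  case: e => /=; last first.
    rewrite big1 => [|j _]; last by rewrite mul0r.
    by case: u {vl vr} => // ? ?; case: v => // ? ?; rewrite mul0r.
  under eq_bigr => j _ do rewrite tensor_split tensor_varl tensor_constr -mulrA.
  rewrite vl; case: u {vl vr} => // a u; rewrite ncconstME.
  by case: v => [|b v]; rewrite ?ncvarM_nil// ncvarM_cons eq_sym.
case: u {vl vr} => [|a u]; case: v => [|b v];
  rewrite ?mixcop_nill ?mixcop_nilr ?mixcop_cons ?addr0 ?add0r//.
Qed.

Let E0 : forall h h', eqlt2 0 h h'. Proof. by []. Qed.
Let Esep h h' : (forall k, eqlt2 k h h') -> h = h'.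
Proof.
by move=> hh; apply/funext => u; apply/funext => v; apply: hh (ltnSn _).
Qed.
Let Erefl k h : eqlt2 k h h. Proof. by []. Qed.
Let EMr k h h' (g : S2) : eqlt2 k h h' -> eqlt2 k (h * g) (h' * g).
Proof. by move=> hh; apply: eqlt2M. Qed.
Let cC r h : c r * h = h * c r.
Proof.
apply/funext => u; apply/funext => v.
by rewrite /c /= !ncconstME !ncMconst mulrC.
Qed.
Let Eraise e k j h h' :
  eqlt2 k h h' -> eqlt2 k.+1 (mixcop_gen e j * h) (mixcop_gen e j * h').
Proof.
apply: eqlt2M_raise; rewrite /mixcop_gen !ncaddE /tensor ncvar_nil.
by case: e; rewrite ?mul0r ?mulr0 !addr0.
Qed.

Lemma mixcop_decomp e f : mixcop e f = ncconst (ncconst (f [::])) +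
  \sum_j mixcop_gen e j * mixcop e (ncshift j f).
Proof. exact: mixcop_subst. Qed.

Lemma mixcop_uniq e D : subst_eq c (mixcop_gen e) D -> D = mixcop e.
Proof.
move=> DE; apply: (subst_uniq E0 Esep (@eqlt2D A n) Erefl (@Eraise e) DE).
exact: mixcop_subst.
Qed.

Lemma mixcop_constM e r f :
  mixcop e (ncconst r * f) = ncconst (ncconst r) * mixcop e f.
Proof.
exact: (subst_constM E0 Esep (@eqlt2D A n) Erefl (@Eraise e) cC r f
  (mixcop_subst e)).
Qed.

Lemma mixcop_const e r : mixcop e (ncconst r) = ncconst (ncconst r).
Proof.
exact: (subst_const E0 Esep (@eqlt2D A n) Erefl (@Eraise e) r
  (mixcop_subst e)).
Qed.

Lemma mixcop_var e j : mixcop e (ncvar A j) = mixcop_gen e j.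
Proof.
exact: (subst_var E0 Esep (@eqlt2D A n) Erefl (@Eraise e) j
  (mixcop_subst e)).
Qed.

Lemma mixcop_is_zmod_morphism e : zmod_morphism (mixcop e).
Proof.
move=> f g; apply/funext => u; apply/funext => v.
by rewrite !ncBE /mixcop -sumrB.
Qed.

Lemma mixcop_is_monoid_morphism e : monoid_morphism (mixcop e).
Proof.
split; first exact: (mixcop_const e 1).
exact: (substM E0 Esep (@eqlt2D A n) Erefl (@Eraise e) cC (mixcop_subst e)).
Qed.

HB.instance Definition _ e :=
  GRing.isZmodMorphism.Build S1 S2 (mixcop e) (mixcop_is_zmod_morphism e).
HB.instance Definition _ e :=
  GRing.isMonoidMorphism.Build S1 S2 (mixcop e)
    (mixcop_is_monoid_morphism e).

Lemma size_mix_shuffle u v w : w \in mix false u v -> size w = (size u + size v)%N.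
Proof.
elim: u v w => [|a u IHu] v w; first by rewrite mix_nill inE => /eqP ->.
elim: v w => [|b v IHv] w; first by rewrite inE addn0 => /eqP ->.
rewrite mix_cons !mem_cat => /or3P[]// /mapP[t tin ->] /=.
  by rewrite (IHu _ _ tin).
by rewrite (IHv _ tin) addnS.
Qed.

End Coproduct.

(** * The Dynkin operator *)

Section Contractive.
Variables (I V : Type) (deg : I -> nat) (v0 : V).
Implicit Types (T : (I -> V) -> I -> V) (F G : I -> V) (i : I).

Definition contractive T := forall F G i,
  (forall i', (deg i' < deg i)%N -> F i' = G i') -> T F i = T G i.

(** A discrete Banach fixed point: for contractive [T], the value at [i] is stable after
    [(deg i).+1] iterations and independent of the starting value [v0]. *)
Definition fixpt T : I -> V := fun i => iter (deg i).+1 T (fun _ => v0) i.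

Lemma fixptE T i : contractive T -> fixpt T i = T (fixpt T) i.
Proof.
move=> cT.
have stable m m' i' : (deg i' < m)%N -> (deg i' < m')%N ->
    iter m T (fun _ => v0) i' = iter m' T (fun _ => v0) i'.
  elim: m m' i' => // m IH [//|m'] i' im im'; rewrite !iterS; apply: cT => i'' lt.
  by apply: IH; exact: leq_trans lt _.
apply: cT => i' lt; exact: stable.
Qed.

Lemma contractive_uniq T k F G : contractive T ->
  (forall i, (deg i < k)%N -> F i = T F i) ->
  (forall i, (deg i < k)%N -> G i = T G i) ->
  forall i, (deg i < k)%N -> F i = G i.
Proof.
move=> cT FE GE i; have [m] := ubnP (deg i); elim: m i => // m IH i im ik.
rewrite FE// GE//; apply: cT => i' lt; apply: IH (ltn_trans lt ik).
exact: leq_trans lt im.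
Qed.

End Contractive.

Section DegreeOperator.
Variables (R : realType) (n : nat).
Local Notation afr := (ncseries R n).
Implicit Types (f g lam : afr) (w : seq 'I_n) (j : 'I_n).

Definition degop f : afr := fun w => (size w)%:R * f w.

(** By the convention [0^-1 = 0] the constant term is sent to 0, so this inverts [degop] on series
    without constant term. *)
Definition degopV f : afr := fun w => (size w)%:R^-1 * f w.

Lemma degop_nil f : degop f [::] = 0. Proof. exact: mul0r. Qed.

Lemma degopD f g : degop (f + g) = degop f + degop g.
Proof. by apply/funext => w; rewrite /degop !ncaddE mulrDr. Qed.

Lemma degopN f : degop (- f) = - degop f.
Proof. by apply/funext => w; rewrite /degop !ncoppE mulrN. Qed.

Lemma degop0 : degop 0 = 0.
Proof. by apply/funext => w; rewrite /degop mulr0. Qed.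

Lemma degop_const c : degop (ncconst c) = 0 :> afr.
Proof. by apply/funext => -[|j w]; rewrite ?degop_nil// /degop mulr0. Qed.

Lemma degopVK f w : w != [::] -> degop (degopV f) w = f w.
Proof.
by case: w => // j w _; rewrite /degop /degopV mulrA mulfV ?mul1r// pnatr_eq0.
Qed.

Lemma degopKV f w : w != [::] -> degopV (degop f) w = f w.
Proof.
by case: w => // j w _; rewrite /degop /degopV mulrA mulVf ?mul1r// pnatr_eq0.
Qed.

Lemma degopV_nil f : degopV f [::] = 0.
Proof. by rewrite /degopV invr0 mul0r. Qed.

Lemma degopM f g : degop (f * g) = degop f * g + f * degop g.
Proof.
apply/funext => w; rewrite /degop ncaddE !ncME mulr_sumr -big_split.
apply: eq_bigr => i _ /=; rewrite [f _ * (_ * _)]mulrCA !mulrA -!mulrDl.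
congr (_ * _ * _); rewrite -natrD size_takel ?size_drop -1?ltnS ?ltn_ord//.
by rewrite subnKC// -ltnS.
Qed.

Lemma degop_var j : degop (ncvar R j) = ncvar R j.
Proof.
apply/funext => w; rewrite /degop /ncvar; case: eqP => [->|]; rewrite ?mulr0//.
by rewrite mul1r.
Qed.

Lemma degop_letter j f : degop f [:: j] = f [:: j].
Proof. by rewrite /degop mul1r. Qed.

Lemma shift_degop j f : ncshift j (degop f) = degop (ncshift j f) + ncshift j f.
Proof.
apply/funext => w; rewrite ncaddE /ncshift /degop /= -[X in _ + X]mul1r -mulrDl.
by rewrite -natr1.
Qed.

Lemma degop_eqlt k f g : eqlt k f g -> eqlt k (degop f) (degop g).
Proof. by move=> fg w wk; rewrite /degop fg. Qed.

Lemma degopV_eqlt k f g : eqlt k f g -> eqlt k (degopV f) (degopV g).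
Proof. by move=> fg w wk; rewrite /degopV fg. Qed.

(* The series g with constant term 1 and logarithmic derivative
   [degop g = degop lam * g]; it plays the role of the exponential. *)
Definition dexp_step lam (g : afr) : afr :=
  fun w => (w == [::])%:R + (size w)%:R^-1 * (degop lam * g) w.

Lemma dexp_step_contractive lam : contractive size (dexp_step lam).
Proof.
move=> F G w FG; rewrite /dexp_step; congr (_ + _ * _).
by apply: (@eqltM_raise _ _ (size w)); [exact: degop_nil|exact: FG|].
Qed.

Definition dexp lam : afr := fixpt size 0 (dexp_step lam).

Lemma dexpE lam w : dexp lam w = dexp_step lam (dexp lam) w.
Proof. exact/fixptE/dexp_step_contractive. Qed.

Lemma dexp_nil lam : dexp lam [::] = 1.
Proof. by rewrite dexpE /dexp_step invr0 mul0r addr0. Qed.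

Lemma degop_dexp lam : degop (dexp lam) = degop lam * dexp lam.
Proof.
apply/funext => -[|j w].
  by rewrite degop_nil ncM_nil degop_nil mul0r.
rewrite /degop dexpE /dexp_step add0r mulrA mulfV ?mul1r//.
by rewrite pnatr_eq0.
Qed.

Lemma dexp_uniq k lam g : g [::] = 1 ->
  eqlt k (degop g) (degop lam * g) -> eqlt k g (dexp lam).
Proof.
move=> g1 gE; apply: (contractive_uniq (@dexp_step_contractive lam)).
  move=> -[|j w] wk; first by rewrite /dexp_step invr0 mul0r addr0.
  rewrite /dexp_step -gE// /degop add0r mulrA mulVf ?mul1r//.
  by rewrite pnatr_eq0.
by move=> w _; exact: dexpE.
Qed.

Lemma dexp_eqlt k lam lam' :
  eqlt k lam lam' -> eqlt k (dexp lam) (dexp lam').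
Proof.
move=> ll; apply: dexp_uniq; first exact: dexp_nil.
by rewrite degop_dexp; apply: eqltM => //; exact: degop_eqlt.
Qed.

End DegreeOperator.

Section LieTheory.
Variables (R : realType) (L : lieAlgType R).
Implicit Types (a b c : L).

Lemma lie0r a : lie 0 a = 0 :> L.
Proof. by apply: (addIr (lie 0 a)); rewrite -lieDl !add0r. Qed.

Lemma lieNr a b : lie a (- b) = - lie a b.
Proof. by apply/eqP; rewrite -addr_eq0 -lieDr addNr lier0. Qed.

Lemma lieC a b : lie a b = - lie b a.
Proof.
apply/eqP; rewrite -addr_eq0; apply/eqP; have := liexx (a + b).
by rewrite lieDl !lieDr !liexx add0r addr0.
Qed.

Lemma lie_lie a b c : lie (lie a b) c = lie a (lie b c) - lie b (lie a c).
Proof.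
have := lie_jacobi a b c => /eqP; rewrite addr_eq0 => /eqP.
by rewrite [lie c (lie a b)]lieC opprK => <-; rewrite [lie c a]lieC lieNr.
Qed.

Lemma lie_suml I (r : seq I) (F : I -> L) a :
  lie (\sum_(i <- r) F i) a = \sum_(i <- r) lie (F i) a.
Proof.
elim: r => [|i r IH]; first by rewrite !big_nil lie0r.
by rewrite !big_cons lieDl IH.
Qed.

End LieTheory.

Section Dynkin.
Variables (R : realType) (n : nat) (L : lieAlgType R) (x : 'I_n -> L).
Local Notation afr := (ncseries R n).
Local Notation Xv j := (ncvar R j : afr).
Implicit Types (f g : afr) (a b : L) (N : nat) (i j : 'I_n).

(* Replaces each word of length at most N by the right-normed bracket of its
   letters. *)
Fixpoint dynkin N f : L :=
  if N is N'.+1 then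
    \sum_i (f [:: i] *: x i + lie (x i) (dynkin N' (ncshift i f)))
  else 0.

(** The adjoint action of the free associative algebra on [L], cut off at words of length [N]: a
    word acts as the composite of the [ad (x i)] of its letters. *)
Fixpoint adaction N f b : L :=
  f [::] *: b +
  (if N is N'.+1 then \sum_i lie (x i) (adaction N' (ncshift i f) b) else 0).

(** The same operator with commutators of series as brackets; it is written out because the series
    carry no [lieAlgType] structure here. *)
Fixpoint dynkin_series N f : afr :=
  if N is N'.+1 then
    \sum_i (ncconst (f [:: i]) * Xv i + (Xv i * dynkin_series N' (ncshift i f) -
                                        dynkin_series N' (ncshift i f) * Xv i))
  else 0.

Lemma dynkin_succ N f : dynkin N.+1 f =
  \sum_i (f [:: i] *: x i + lie (x i) (dynkin N (ncshift i f))).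
Proof. by []. Qed.

Lemma dynkin_series_succ N f : dynkin_series N.+1 f =
  \sum_i (ncconst (f [:: i]) * Xv i + (Xv i * dynkin_series N (ncshift i f) -
                                      dynkin_series N (ncshift i f) * Xv i)).
Proof. by []. Qed.

Lemma dynkinD N f g : dynkin N (f + g) = dynkin N f + dynkin N g.
Proof.
elim: N f g => [|N IH] f g /=; first by rewrite addr0.
rewrite -big_split; apply: eq_bigr => i _ /=.
by rewrite ncaddE scalerDl shiftD IH lieDr addrACA.
Qed.

Lemma dynkinZ N c f : dynkin N (ncconst c * f) = c *: dynkin N f.
Proof.
elim: N f => [|N IH] f /=; first by rewrite scaler0.
rewrite scaler_sumr; apply: eq_bigr => i _.
rewrite ncconstME shiftM shift_const mul0r addr0 IH lieZr.
by rewrite scalerDr scalerA.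
Qed.

Lemma dynkin0 N : dynkin N 0 = 0.
Proof. by apply: (addIr (dynkin N 0)); rewrite -dynkinD !add0r. Qed.

Lemma dynkinN N f : dynkin N (- f) = - dynkin N f.
Proof. by apply/eqP; rewrite -addr_eq0 -dynkinD addNr dynkin0. Qed.

Lemma dynkin_sum N I (r : seq I) (F : I -> afr) :
  dynkin N (\sum_(i <- r) F i) = \sum_(i <- r) dynkin N (F i).
Proof. exact: (big_morph _ (dynkinD N) (dynkin0 N)). Qed.

Lemma dynkin_const N c : dynkin N (ncconst c) = 0.
Proof.
case: N => //= N; rewrite big1// => i _.
by rewrite shift_const dynkin0 lier0 scale0r addr0.
Qed.

Lemma dynkin_eqlt N f g : eqlt N.+1 f g -> dynkin N f = dynkin N g.
Proof.
elim: N f g => //= N IH f g fg; apply: eq_bigr => i _.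
by rewrite fg// (IH _ (ncshift i g))// => w wN; apply: fg.
Qed.

Lemma dynkin_var N j : dynkin N.+1 (Xv j) = x j.
Proof.
rewrite /= (bigD1 j)//= big1 ?addr0 => [|i ij].
  by rewrite {1}/ncvar eqxx shift_var eqxx dynkin_const lier0 scale1r addr0.
rewrite shift_var dynkin_const lier0 addr0 /ncvar eqseq_cons (negbTE ij).
by rewrite scale0r.
Qed.

Lemma dynkin_mull N j f : dynkin N.+1 (Xv j * f) =
  f [::] *: x j + lie (x j) (dynkin N f).
Proof.
have E i : ncshift i (Xv j * f) = ncconst (i == j)%:R * f.
  by rewrite shiftM ncvar_nil ncconst0 mul0r add0r shift_var.
rewrite /= (bigD1 j)//= big1 ?addr0 => [|i ij].
  by rewrite E eqxx ncconst1 mul1r ncvarM_cons eqxx mul1r.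
by rewrite E ncvarM_cons (negbTE ij) ncconst0 !mul0r dynkin0 lier0 scale0r addr0.
Qed.

Lemma adactionD N f g b :
  adaction N (f + g) b = adaction N f b + adaction N g b.
Proof.
elim: N f g => [|N IH] f g /=; first by rewrite !addr0 scalerDl.
rewrite ncaddE scalerDl addrACA -big_split; congr (_ + _).
by apply: eq_bigr => i _; rewrite shiftD IH lieDr.
Qed.

Lemma adaction0 N b : adaction N 0 b = 0.
Proof. by apply: (addIr (adaction N 0 b)); rewrite -adactionD !add0r. Qed.

Lemma adactionN N f b : adaction N (- f) b = - adaction N f b.
Proof. by apply/eqP; rewrite -addr_eq0 -adactionD addNr adaction0. Qed.

Lemma adaction_sum N I (r : seq I) (F : I -> afr) b :
  adaction N (\sum_(i <- r) F i) b = \sum_(i <- r) adaction N (F i) b.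
Proof.
exact: (big_morph (adaction N ^~ b) (fun f g => adactionD N f g b)
  (adaction0 N b)).
Qed.

Lemma adaction_const N c b : adaction N (ncconst c) b = c *: b.
Proof.
case: N => [|N] /=; rewrite ?addr0// big1 ?addr0// => i _.
by rewrite shift_const adaction0 lier0.
Qed.

Lemma adactionZ N c f b : adaction N (ncconst c * f) b = c *: adaction N f b.
Proof.
elim: N f => [|N IH] f /=; rewrite ncconstME ?addr0 ?scalerA//.
rewrite scalerDr scalerA; congr (_ + _).
rewrite scaler_sumr; apply: eq_bigr => i _.
by rewrite shiftM shift_const mul0r addr0 IH lieZr.
Qed.

Lemma adaction_mull N j f b :
  adaction N.+1 (Xv j * f) b = lie (x j) (adaction N f b).
Proof.
have E i : ncshift i (Xv j * f) = ncconst (i == j)%:R * f.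
  by rewrite shiftM ncvar_nil ncconst0 mul0r add0r shift_var.
rewrite /= ncvarM_nil scale0r add0r (bigD1 j)//= big1 ?addr0 => [|i ij].
  by rewrite E eqxx ncconst1 mul1r.
by rewrite E (negbTE ij) ncconst0 mul0r adaction0 lier0.
Qed.

Lemma adaction_var N j b : adaction N.+1 (Xv j) b = lie (x j) b.
Proof. by rewrite -[Xv j]mulr1 adaction_mull (adaction_const N 1) scale1r. Qed.

Lemma adaction_mulr N j f b :
  adaction N.+1 (f * Xv j) b = adaction N f (lie (x j) b).
Proof.
elim: N f => [|N IH] f.
  have E i : ncshift i (f * Xv j) [::] = f [::] * (i == j)%:R.
    by rewrite shiftM ncaddE ncconstME shift_var ncM_nil ncvar_nil mulr0 addr0.
  rewrite /= ncM_nil mulr0 scale0r add0r (bigD1 j)//= big1 => [|i ij].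
    by rewrite E eqxx mulr1 !addr0 lieZr.
  by rewrite E (negbTE ij) mulr0 scale0r addr0 lier0.
have -> : adaction N.+2 (f * Xv j) b = (f * Xv j) [::] *: b +
    \sum_i lie (x i) (adaction N.+1 (ncshift i (f * Xv j)) b) by [].
rewrite ncM_nil mulr0 scale0r add0r.
under eq_bigr => i _ do rewrite shiftM shift_var adactionD IH -rmorphM
  adaction_const lieDr.
rewrite big_split /=; congr (_ + _).
rewrite (bigD1 j)//= eqxx mulr1 big1 ?addr0 ?lieZr// => i ij.
by rewrite (negbTE ij) mulr0 scale0r lier0.
Qed.

Lemma dynkin_mulr N j f : dynkin N.+1 (f * Xv j) = adaction N f (x j).
Proof.
have h1 g i : (g * Xv j) [:: i] = g [::] * (i == j)%:R.
  rewrite ncM_cons ncM_nil ncvar_nil mulr0 addr0 /ncvar eqseq_cons.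
  by rewrite andbT.
have h2 g : \sum_i (g * Xv j) [:: i] *: x i = g [::] *: x j.
  under eq_bigr do rewrite h1.
  rewrite (bigD1 j)//= eqxx mulr1 big1 ?addr0// => i ij.
  by rewrite (negbTE ij) mulr0 scale0r.
elim: N f => [|N IH] f.
  rewrite /= addr0 -h2; apply: eq_bigr => i _.
  by rewrite lier0 addr0.
have -> : dynkin N.+2 (f * Xv j) = \sum_i ((f * Xv j) [:: i] *: x i +
    lie (x i) (dynkin N.+1 (ncshift i (f * Xv j)))) by [].
rewrite big_split h2; congr (_ + _); apply: eq_bigr => i _.
by rewrite shiftM shift_var -rmorphM dynkinD dynkin_const add0r IH.
Qed.

Lemma dynkin_series_nil N f : dynkin_series N f [::] = 0.
Proof.
case: N => //= N; rewrite ncsumA big1// => i _.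
by rewrite ncaddE ncBE !ncM_nil ncvar_nil !(mulr0, mul0r) subr0 addr0.
Qed.

(** By Jacobi, in the form [lie_lie], a commutator of operators [ad] is [ad] of the bracket; so a
    Lie polynomial acts by a single bracket with its value. *)
Lemma adaction_dynkin_series N f b :
  adaction N (dynkin_series N f) b = lie (dynkin N f) b.
Proof.
elim: N f b => [|N IH] f b; first by rewrite /= lie0r scale0r addr0.
rewrite dynkin_series_succ dynkin_succ adaction_sum lie_suml.
apply: eq_bigr => i _; rewrite adactionD adactionD adactionN.
by rewrite adactionZ adaction_var adaction_mull adaction_mulr !IH lieDl lieZl
  lie_lie.
Qed.

(* The theorem of Dynkin, Specht and Wever. *)
Lemma dynkin_dynkin_series N f : dynkin N (dynkin_series N f) = dynkin N (degop f).
Proof.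
elim: N f => // N IH f; rewrite dynkin_series_succ dynkin_sum [RHS]dynkin_succ.
apply: eq_bigr => i _; rewrite !dynkinD dynkinN dynkinZ dynkin_var.
(* In the commutator [x_i P - P x_i], the second product contributes one more copy of the bracket of
   [x_i] with [dynkin N (ncshift i f)]; it matches the extra summand of [shift_degop]. *)
rewrite dynkin_mull dynkin_mulr adaction_dynkin_series dynkin_series_nil.
rewrite scale0r add0r IH degop_letter shift_degop dynkinD lieDr.
by rewrite [lie (dynkin _ _) _]lieC opprK.
Qed.

Fixpoint dynkin_top N f : L :=
  if N is N'.+1 then \sum_i lie (x i) (dynkin_top N' (ncshift i f))
  else \sum_i f [:: i] *: x i.

Lemma dynkinS N f : dynkin N.+1 f = dynkin N f + dynkin_top N f.
Proof.
elim: N f => [|N IH] f.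
  by rewrite add0r; apply: eq_bigr => i _; rewrite /= lier0 addr0.
rewrite dynkin_succ [dynkin N.+1 f]dynkin_succ -big_split.
by apply: eq_bigr => i _; rewrite IH lieDr addrA.
Qed.

Fixpoint right_normed (w : seq 'I_n) : L :=
  if w is j :: s then
    if s is [::] then x j else lie (x j) (right_normed s)
  else 0.

Lemma right_normed_cons i j s :
  right_normed [:: i, j & s] = lie (x i) (right_normed (j :: s)).
Proof. by []. Qed.

Lemma dynkin_top_eq0 N f :
  (forall w, size w = N.+1 -> right_normed w = 0) -> dynkin_top N f = 0.
Proof.
(* The linear map [T] accumulates the brackets with the letters already read. *)
have key (T : L -> L) : (forall a b, T (a + b) = T a + T b) ->
    (forall c a, T (c *: a) = c *: T a) ->
    (forall w, size w = N.+1 -> T (right_normed w) = 0) ->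
    T (dynkin_top N f) = 0.
  elim: N f T => [|N IH] f T TD TZ T0 /=.
    have T00 : T 0 = 0 by have := TZ 0 0; rewrite !scale0r.
    rewrite (big_morph T TD T00) big1// => i _.
    by rewrite TZ (T0 [:: i])// scaler0.
  have T00 : T 0 = 0 by have := TZ 0 0; rewrite !scale0r.
  rewrite (big_morph T TD T00) big1// => i _.
  apply: (IH (ncshift i f) (fun a => T (lie (x i) a))) => [a b|c a|[|j w]// wN].
  - by rewrite lieDr TD.
  - by rewrite lieZr TZ.
  - by rewrite -right_normed_cons T0//; case: wN => /= ->.
by move=> h; exact: (key id).
Qed.

End Dynkin.

Lemma addrB_ACA (V : zmodType) (a a' b b' c c' : V) :
  a + a' + (b + b' - (c + c')) = (a + (b - c)) + (a' + (b' - c')).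
Proof. by rewrite opprD (addrACA b) (addrACA a). Qed.

Section DynkinSeries.
Variables (R : realType) (n : nat).
Local Notation afr := (ncseries R n).
Local Notation afr2 := (ncseries (ncseries R n) n).
Local Notation Xv j := (ncvar R j : afr).
Local Notation psi := (@dynkin_series R n).
Implicit Types (f g lam : afr) (h : afr2) (N k : nat) (i j : 'I_n).

Lemma dynkin_seriesD N f g : psi N (f + g) = psi N f + psi N g.
Proof.
elim: N f g => [|N IH] f g /=; first by rewrite addr0.
rewrite -big_split; apply: eq_bigr => i _ /=.
by rewrite ncaddE rmorphD mulrDl shiftD IH mulrDl mulrDr addrB_ACA.
Qed.

Lemma dynkin_series0 N : psi N 0 = 0.
Proof. by apply: (addIr (psi N 0)); rewrite -dynkin_seriesD !add0r. Qed.

Lemma dynkin_series_degop N f : psi N (degop f) = degop (psi N f).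
Proof.
elim: N f => [|N IH] f /=; first by rewrite degop0.
rewrite (big_morph (@degop R n) (@degopD R n) (degop0 R n)).
apply: eq_bigr => i _.
rewrite shift_degop dynkin_seriesD IH !degopD degopN.
have -> : degop (ncconst (f [:: i]) * Xv i) = ncconst (degop f [:: i]) * Xv i.
  rewrite degop_letter -{2}(degop_var R i); apply/funext => w.
  by rewrite /degop !ncconstME mulrCA.
rewrite !degopM degop_var !mulrDl !mulrDr; congr (_ + (_ - _)).
exact: addrC.
Qed.

(* The left-to-right convolution of dynkin_series N with the identity. *)
Fixpoint dynkin_conv N h : afr :=
  if N is N'.+1 then
    \sum_i (Xv i * h [:: i] + (Xv i * dynkin_conv N' (ncshift i h) -
      dynkin_conv N' (ncconst (Xv i) * ncshift i h)))
  else 0.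

Lemma dynkin_convD N h h' :
  dynkin_conv N (h + h') = dynkin_conv N h + dynkin_conv N h'.
Proof.
elim: N h h' => [|N IH] h h' /=; first by rewrite addr0.
rewrite -big_split; apply: eq_bigr => i _ /=.
by rewrite ncaddE mulrDr shiftD IH mulrDr [ncconst _ * _]mulrDr IH addrB_ACA.
Qed.

Lemma dynkin_conv0 N : dynkin_conv N 0 = 0.
Proof. by apply: (addIr (dynkin_conv N 0)); rewrite -dynkin_convD !add0r. Qed.

Lemma dynkin_conv_const N f : dynkin_conv N (ncconst f) = 0.
Proof.
case: N => //= N; rewrite big1// => i _.
by rewrite shift_const !(mulr0, dynkin_conv0, subr0, addr0).
Qed.

Lemma dynkin_conv_tensor N f g : dynkin_conv N (tensor f g) = psi N f * g.
Proof.
have sh i f' g' : ncshift i (tensor f' g') = tensor (ncshift i f') g' by [].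
have cst i f' g' : ncconst (Xv i) * tensor f' g' = tensor f' (Xv i * g').
  by rewrite -tensor_constr tensorM mul1r.
elim: N f g => [|N IH] f g /=; first by rewrite mul0r.
rewrite mulr_suml; apply: eq_bigr => i _.
rewrite sh cst !IH !mulrDl mulNr -!mulrA; congr (_ + _).
apply/funext => w; rewrite ncconstME.
have -> : tensor f g [:: i] = ncconst (f [:: i]) * g.
  by apply/funext => u; rewrite ncconstME.
elim: w => [|j w _]; first by rewrite !ncvarM_nil mulr0.
by rewrite !ncvarM_cons ncconstME mulrCA.
Qed.

Lemma dynkin_conv_eqlt K N h h' :
  eqlt2 K h h' -> eqlt K (dynkin_conv N h) (dynkin_conv N h').
Proof.
elim: N K h h' => [//|N IH] [//|K] h h' hh /=.
have hs i : eqlt2 K (ncshift i h) (ncshift i h').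
  by move=> u v uv; apply: hh; rewrite addSn.
elim/big_ind2: _ => // [*|i _]; first exact: eqltD.
apply: eqltD; first by apply: eqltM_raise => // w wK; apply: hh.
apply: eqltD; first by apply: eqltM_raise => //; apply: IH.
by apply: eqltN; apply: IH; apply: eqlt2M_raise.
Qed.

(** Depth [N.+1] adds to depth [N] only terms with [N.+1] letters from the left factor, and the
    right factor contributes at least [K] more. *)
Lemma dynkin_convS_eqlt K N h : (forall u, eqlt K (h u) 0) ->
  eqlt (K + N.+1) (dynkin_conv N.+1 h) (dynkin_conv N h).
Proof.
elim: N K h => [|N IH] K h h0.
  rewrite addn1 /=; elim/big_ind: _ => // [a b a0 b0|i _].
    by rewrite -[0](addr0 0); exact: eqltD.
  rewrite mulr0 subr0 addr0 -(mulr0 (Xv i)).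
  by apply: eqltM_raise.
have -> : dynkin_conv N.+2 h = \sum_i (Xv i * h [:: i] +
    (Xv i * dynkin_conv N.+1 (ncshift i h) -
      dynkin_conv N.+1 (ncconst (Xv i) * ncshift i h))) by [].
have -> : dynkin_conv N.+1 h = \sum_i (Xv i * h [:: i] +
    (Xv i * dynkin_conv N (ncshift i h) -
      dynkin_conv N (ncconst (Xv i) * ncshift i h))) by [].
elim/big_ind2: _ => // [*|i _]; first exact: eqltD.
apply: eqltD => //; apply: eqltD.
  by rewrite addnS; apply: eqltM_raise => //; apply: IH => u; apply: h0.
apply: eqltN; rewrite -addSnnS; apply: IH => u.
by rewrite ncconstME -(mulr0 (Xv i)); apply: eqltM_raise => //; apply: h0.
Qed.

Lemma dynkin_conv_mull N j h :
  dynkin_conv N.+1 (tensor (Xv j) 1 * h) =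
  Xv j * h [::] + (Xv j * dynkin_conv N h - dynkin_conv N (tensor 1 (Xv j) * h)).
Proof.
rewrite tensor_varl tensor_constr.
have E i : ncshift i (ncvar _ j * h) = ncconst (i == j)%:R * h.
  by rewrite shiftM ncvar_nil ncconst0 mul0r add0r shift_var.
rewrite /= (bigD1 j)//= big1 ?addr0 => [|i ij].
  by rewrite E eqxx ncconst1 mul1r ncvarM_cons eqxx mul1r.
by rewrite E ncvarM_cons (negbTE ij) ncconst0
  !(mul0r, mulr0, dynkin_conv0, subr0, addr0).
Qed.

(* In Hopf-algebraic terms: the Dynkin operator convolved with the identity
   is the degree operator. *)
Lemma dynkin_conv_mixcop N f :
  eqlt N.+1 (dynkin_conv N (mixcop false f)) (degop f).
Proof.
elim: N f => [|N IH] f; first by case=> // _; rewrite degop_nil.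
have -> : degop f = \sum_j Xv j * (ncshift j f + degop (ncshift j f)).
  rewrite {1}[f]series_decomp degopD.
  rewrite (big_morph (@degop R n) (@degopD R n) (degop0 R n)).
  rewrite degop_const add0r; apply: eq_bigr => j _.
  by rewrite degopM degop_var mulrDr.
rewrite mixcop_decomp dynkin_convD dynkin_conv_const add0r.
rewrite (big_morph _ (dynkin_convD N.+1) (dynkin_conv0 N.+1)).
elim/big_ind2: _ => // [*|j _]; first exact: eqltD.
rewrite /mixcop_gen addr0 mulrDl dynkin_convD dynkin_conv_mull.
rewrite -addrA mulrDr; apply: eqltD.
  have -> : mixcop false (ncshift j f) [::] = ncshift j f.
    by apply/funext => v; rewrite mixcop_nill.
  by [].
rewrite -addrA -[Xv j * degop _]addr0; apply: eqltD.
  by apply: eqltM_raise => //; apply: IH.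
(* The contribution of [1 (x) w_j] cancels the negative term of [dynkin_conv_mull], up to the change
   of depth; the right factor starts with [w_j], hence [K = 1]. *)
rewrite -[0](addNr (dynkin_conv N (tensor 1 (Xv j) * mixcop false (ncshift j f)))).
apply: eqltD => //.
apply: eqltW (_ : eqlt (1 + N.+1) _ _) => //; apply: dynkin_convS_eqlt => u.
by rewrite tensor_constr ncconstME -(mulr0 (Xv j)); apply: eqltM_raise.
Qed.

Definition grouplike_upto k g :=
  g [::] = 1 /\ eqlt2 k (mixcop false g) (tensor g g).

Definition primitive_upto k f :=
  eqlt2 k (mixcop false f) (tensor f 1 + tensor 1 f).

(** In the convolution with the identity, the coproduct of [g] may be replaced by [tensor g g], on
    which the convolution is a plain product. *)
Lemma dynkin_series_grouplike k g : grouplike_upto k.+1 g ->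
  eqlt k.+1 (psi k g * g) (degop g).
Proof.
move=> [_ gg]; rewrite -dynkin_conv_tensor.
apply: (@eqlt_trans _ _ _ _ (dynkin_conv k (mixcop false g))).
  exact/dynkin_conv_eqlt/eqlt2_sym.
exact: dynkin_conv_mixcop.
Qed.

Definition degop2 h : afr2 := fun u v => (size u + size v)%:R * h u v.

Lemma mixcop_degop f : mixcop false (degop f) = degop2 (mixcop false f).
Proof.
apply/funext => u; apply/funext => v; rewrite /mixcop /degop2 mulr_sumr.
by apply: eq_big_seq => w /size_mix_shuffle wE; rewrite /degop wE.
Qed.

Lemma degop2_tensor f g :
  degop2 (tensor f g) = tensor (degop f) g + tensor f (degop g).
Proof.
apply/funext => u; apply/funext => v.
by rewrite /degop2 !ncaddE /tensor /degop natrD mulrDl mulrA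
  [f u * (_ * _)]mulrCA.
Qed.

Lemma degop2D h h' : degop2 (h + h') = degop2 h + degop2 h'.
Proof.
by apply/funext => u; apply/funext => v; rewrite /degop2 !ncaddE mulrDr.
Qed.

Lemma degop1 : degop 1 = 0 :> afr.
Proof. exact: degop_const. Qed.

Lemma tensor0r f : tensor f (0 : afr) = 0.
Proof. by apply/funext => u; apply/funext => v; rewrite /tensor mulr0. Qed.

Lemma tensor0l f : tensor (0 : afr) f = 0.
Proof. by apply/funext => u; apply/funext => v; rewrite /tensor mul0r. Qed.

(** A linear differential equation for the total degree: [m] has no constant term, so each
    homogeneous part of [h] follows from the lower ones after division by its degree. *)
Lemma degop2_uniq k (m h h' : afr2) : m [::] [::] = 0 -> h [::] [::] = h' [::] [::] ->
  eqlt2 k (degop2 h) (m * h) -> eqlt2 k (degop2 h') (m * h') -> eqlt2 k h h'.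
Proof.
move=> m0 h0; elim: k => [//|k IH] hE hE'.
have hh : eqlt2 k h h'.
  by apply: IH => u v uv; [apply: hE|apply: hE']; exact: ltnW.
have mh : eqlt2 k.+1 (m * h) (m * h') by apply: eqlt2M_raise.
move=> u v uv; have [uv0|uv0] := eqVneq (size u + size v)%N 0%N.
  by case: u v uv0 {uv} => [|//] [].
apply: (@mulfI _ (size u + size v)%:R); first by rewrite pnatr_eq0.
by rewrite -[LHS]/(degop2 h u v) hE// mh// -hE'.
Qed.

(** The total degree is a derivation compatible with both [mixcop false] and [tensor], so the two
    sides solve the same equation, with [m] the coproduct of [degop lam]. *)
Lemma dexp_grouplike k lam :
  primitive_upto k lam -> grouplike_upto k (dexp lam).
Proof.
move=> lamP; split; first exact: dexp_nil.
apply: (@degop2_uniq k (degop2 (mixcop false lam))).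
- by rewrite /degop2 mul0r.
- by rewrite mixcop_nill /tensor dexp_nil mulr1.
- by rewrite -mixcop_degop degop_dexp rmorphM /= mixcop_degop.
rewrite degop2_tensor degop_dexp.
rewrite -[X in tensor X (_ * _)]mul1r -[X in tensor (_ * _) X]mul1r -!tensorM.
rewrite -mulrDl; apply: eqlt2M => //; apply: eqlt2_sym.
have -> : tensor (degop lam) 1 + tensor 1 (degop lam) =
    degop2 (tensor lam 1 + tensor 1 lam).
  by rewrite degop2D !degop2_tensor degop1 tensor0r tensor0l add0r addr0.
by move=> u v uv; rewrite /degop2 lamP.
Qed.

Lemma primitive_uptoD k f g :
  primitive_upto k f -> primitive_upto k g -> primitive_upto k (f + g).
Proof.
move=> fP gP u v uv; rewrite rmorphD /= ncaddE ncaddE fP// gP//.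
by rewrite !ncaddE /tensor !ncaddE !(mulrDl, mulrDr) addrACA.
Qed.

Lemma primitive_uptoZ k c f :
  primitive_upto k f -> primitive_upto k (ncconst c * f).
Proof.
move=> fP u v uv; rewrite mixcop_constM !ncconstME fP//.
by rewrite !ncaddE /tensor !ncconstME mulrDr; congr (_ + _);
  [rewrite mulrA|rewrite mulrCA].
Qed.

Lemma primitive_uptoN k f : primitive_upto k f -> primitive_upto k (- f).
Proof.
move=> /(primitive_uptoZ (-1)); rewrite rmorphN rmorph1 mulN1r.
exact.
Qed.

Lemma primitive_upto0 k : primitive_upto k 0.
Proof. by move=> u v _; rewrite rmorph0 tensor0r tensor0l addr0. Qed.

Lemma primitive_upto_var k j : primitive_upto k (Xv j).
Proof. by move=> u v _; rewrite mixcop_var /mixcop_gen addr0. Qed.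

Lemma primitive_upto_comm k f g :
  primitive_upto k f -> primitive_upto k g -> primitive_upto k (f * g - g * f).
Proof.
move=> fP gP; rewrite /primitive_upto rmorphB /= !rmorphM /=.
pose F := tensor f 1 + tensor 1 f; pose G := tensor g 1 + tensor 1 g.
have FG : eqlt2 k (mixcop false f * mixcop false g) (F * G) by apply: eqlt2M.
have GF : eqlt2 k (mixcop false g * mixcop false f) (G * F) by apply: eqlt2M.
move=> u v uv; rewrite ncBE ncBE FG// GF// -ncBE -ncBE.
rewrite /F /G !mulrDl !mulrDr !tensorM !mulr1 !mul1r.
have -> : tensor (f * g - g * f) 1 = tensor (f * g) 1 - tensor (g * f) 1.
  by apply/funext => s; apply/funext => t; rewrite /tensor !ncBE mulrBl.
have -> : tensor 1 (f * g - g * f) = tensor 1 (f * g) - tensor 1 (g * f).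
  by apply/funext => s; apply/funext => t; rewrite /tensor !ncBE mulrBr.
set a := tensor (f * g) 1; set b := tensor f g; set c := tensor g f.
set d := tensor 1 (f * g); set a' := tensor (g * f) 1; set d' := tensor 1 (g * f).
(* The mixed tensors [b] and [c] occur in both products and cancel. *)
have E1 : a + b + (c + d) = (a + d) + (b + c).
  by rewrite [c + d]addrC addrACA.
have E2 : a' + c + (b + d') = (a' + d') + (b + c).
  by rewrite [b + d']addrC addrACA [c + b]addrC.
by rewrite E1 E2 opprD addrACA subrr addr0 opprD addrACA.
Qed.

End DynkinSeries.

(** * The free nilpotent Lie algebra inside the series *)

Section FreeNilpotentSeries.
Variables (R : realType) (n : nat).
Local Notation afr := (ncseries R n).
Local Notation psi := (@dynkin_series R n).
Implicit Types (f g : afr) (w : seq 'I_n) (i j : 'I_n) (k N : nat).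

Lemma dynkin_series_const N c : psi N (ncconst c) = 0.
Proof.
case: N => //= N; rewrite big1// => i _.
by rewrite shift_const dynkin_series0 mulr0 mul0r subrr ncconst0 mul0r addr0.
Qed.

Lemma degop_degopV f : degop (degopV f) = f - ncconst (f [::]).
Proof.
apply/funext => -[|j w]; first by rewrite degop_nil ncBE ncconstE subrr.
by rewrite degopVK// ncBE ncconstE subr0.
Qed.

Lemma degopV_degop f : f [::] = 0 -> degopV (degop f) = f.
Proof.
move=> f0; apply/funext => -[|j w]; first by rewrite degopV_nil f0.
by rewrite degopKV.
Qed.

Lemma dynkin_series_degopV N f : psi N (degopV f) = degopV (psi N f).
Proof.
have E : psi N f = degop (psi N (degopV f)).
  rewrite -dynkin_series_degop degop_degopV dynkin_seriesD -rmorphN.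
  by rewrite dynkin_series_const addr0.
by rewrite E degopV_degop// dynkin_series_nil.
Qed.

Definition trunc k f : afr := fun w => if (size w < k)%N then f w else 0.

Lemma trunc_eqlt k f : eqlt k (trunc k f) f.
Proof. by move=> w wk; rewrite /trunc wk. Qed.

Lemma eq_trunc k f g : eqlt k f g -> trunc k f = trunc k g.
Proof. by move=> fg; apply/funext => w; rewrite /trunc; case: ifP => // /fg. Qed.

Lemma truncD k f g : trunc k (f + g) = trunc k f + trunc k g.
Proof.
apply/funext => w; rewrite !ncaddE /trunc; case: ifP => // _.
by rewrite addr0.
Qed.

Lemma truncZ k c f : trunc k (ncconst c * f) = ncconst c * trunc k f.
Proof.
apply/funext => w; rewrite ncconstME /trunc; case: ifP => _.
  by rewrite ncconstME.
by rewrite mulr0.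
Qed.

Fixpoint term_series (t : lie_term R n) : afr :=
  match t with
  | LtZero => 0
  | LtGen j => ncvar R j
  | LtAdd a b => term_series a + term_series b
  | LtOpp a => - term_series a
  | LtScale c a => ncconst c * term_series a
  | LtLie a b => term_series a * term_series b - term_series b * term_series a
  end.

Lemma eqlt_comm k f f' g g' : eqlt k f f' -> eqlt k g g' ->
  eqlt k (f * g - g * f) (f' * g' - g' * f').
Proof. by move=> ff gg; apply: eqltD; [|apply: eqltN]; apply: eqltM. Qed.

Lemma term_series_right_bracket i s :
  eqlt (size s).+1 (term_series (right_bracket R i s)) 0.
Proof.
elim: s i => [|j s IH] i; first by case.
rewrite /= -(subrr 0); apply: eqltD; last apply: eqltN.
  by rewrite -(mulr0 (ncvar R i)); apply: eqltM_raise.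
by rewrite -(mul0r (ncvar R i)); apply: eqltM_raiser.
Qed.

Lemma term_series_primitive k t : primitive_upto k (term_series t).
Proof.
elim: t => [|j|a IHa b IHb|a IHa|c a IHa|a IHa b IHb] /=.
- exact: primitive_upto0.
- exact: primitive_upto_var.
- exact: primitive_uptoD.
- exact: primitive_uptoN.
- exact: primitive_uptoZ.
- exact: primitive_upto_comm.
Qed.

Lemma ncconstMCA c f g : f * (ncconst c * g) = ncconst c * (f * g).
Proof.
apply/funext => w; rewrite ncconstME !ncME mulr_sumr.
by apply: eq_bigr => i _; rewrite ncconstME mulrCA.
Qed.

Lemma jacobi_comm (a b c : afr) :
  (a * (b * c - c * b) - (b * c - c * b) * a) +
  (b * (c * a - a * c) - (c * a - a * c) * b) +
  (c * (a * b - b * a) - (a * b - b * a) * c) = 0.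
Proof.
rewrite !mulrBl !mulrBr !mulrA.
set x1 := a * b * c; set x2 := a * c * b; set x3 := b * c * a.
set x4 := c * b * a; set x5 := b * a * c; set x6 := c * a * b.
by apply/funext => w; rewrite !(ncaddE, ncoppE) nc0E; ring.
Qed.

(** The nilpotency relations are brackets of [k.+1] letters and vanish on shorter words; this fixes
    the precision [k.+1] used for [fr R n k] throughout. *)
Lemma lie_cong_term_series k s t : lie_cong k s t ->
  eqlt k.+1 (term_series s) (term_series t).
Proof.
elim=> {s t} //=.
- by move=> a b _ ab; exact: eqlt_sym.
- by move=> a b c _ ab _ bc; exact: eqlt_trans ab bc.
- by move=> *; exact: eqltD.
- by move=> *; exact: eqltN.
- by move=> c a b _ ab; apply: eqltM.
- by move=> *; exact: eqlt_comm.
- by move=> a b c; rewrite addrA.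
- by move=> a b; rewrite addrC.
- by move=> a; rewrite add0r.
- by move=> a; rewrite addNr.
- by move=> r s a; rewrite mulrA -rmorphM.
- by move=> a; rewrite ncconst1 mul1r.
- by move=> r a b; rewrite mulrDr.
- by move=> r s a; rewrite rmorphD mulrDl.
- by move=> a b c; rewrite mulrDl mulrDr opprD addrACA.
- by move=> a b c; rewrite mulrDl mulrDr opprD addrACA.
- by move=> r a b; rewrite ncconstMCA mulrBr -!mulrA.
- by move=> r a b; rewrite ncconstMCA mulrBr -!mulrA.
- by move=> a; rewrite subrr.
- by move=> a b c; rewrite jacobi_comm.
- by move=> i s <-; exact: term_series_right_bracket.
Qed.

Section Step.
Variable k : nat.
Local Notation L := (fr R n k).
Local Notation x := (@fr_gen R n k).
Implicit Types (a b : L).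

(** The truncation makes the series independent of the representative. *)
Definition fr_series a : afr := trunc k.+1 (term_series (repr a)).

Lemma fr_series_pi t : fr_series (\pi_L t)%qT = trunc k.+1 (term_series t).
Proof. exact/eq_trunc/lie_cong_term_series/fr_reprK. Qed.

Lemma fr_seriesD a b : fr_series (a + b) = fr_series a + fr_series b.
Proof.
elim/fr_ind: a => s; elim/fr_ind: b => t.
by rewrite fr_addrE !fr_series_pi truncD.
Qed.

Lemma fr_seriesZ c a : fr_series (c *: a) = ncconst c * fr_series a.
Proof.
elim/fr_ind: a => s; rewrite /GRing.scale /= fr_scaleE.
by rewrite !fr_series_pi truncZ.
Qed.

Lemma fr_series0 : fr_series 0 = 0.
Proof. by rewrite -(scale0r 0) fr_seriesZ ncconst0 mul0r. Qed.

Lemma fr_series_sum I (r : seq I) (F : I -> L) :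
  fr_series (\sum_(i <- r) F i) = \sum_(i <- r) fr_series (F i).
Proof. exact: (big_morph _ fr_seriesD fr_series0). Qed.

Lemma fr_series_nil a : fr_series a [::] = 0.
Proof.
elim/fr_ind: a => s; rewrite fr_series_pi /trunc /=.
elim: s => //= [s IHs t IHt|s IHs|c s IHs|s IHs t IHt].
- by rewrite ncaddE IHs IHt addr0.
- by rewrite ncoppE IHs oppr0.
- by rewrite ncconstME IHs mulr0.
- by rewrite ncBE !ncM_nil IHs IHt mul0r subr0.
Qed.

Lemma fr_series_lie a b : eqlt k.+1 (fr_series (lie a b))
  (fr_series a * fr_series b - fr_series b * fr_series a).
Proof.
elim/fr_ind: a => s; elim/fr_ind: b => t.
rewrite /lie /= fr_lieE !fr_series_pi.
apply: eqlt_trans; first exact: trunc_eqlt.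
by apply: eqlt_comm; apply: eqlt_sym; apply: trunc_eqlt.
Qed.

Lemma fr_series_gen j : eqlt k.+1 (fr_series (x j)) (ncvar R j).
Proof. by rewrite /fr_gen fr_series_pi; apply: trunc_eqlt. Qed.

Lemma fr_series_primitive a : primitive_upto k.+1 (fr_series a).
Proof.
have E f g : eqlt k.+1 f g -> eqlt2 k.+1 (mixcop false f) (mixcop false g).
  move=> fg u v uv; apply: eq_big_seq => w /size_mix_shuffle wE.
  by rewrite fg// wE.
move=> u v uv; rewrite (E _ (term_series (repr a)))//; last exact: trunc_eqlt.
have uk := leq_ltn_trans (leq_addr (size v) (size u)) uv.
have vk := leq_ltn_trans (leq_addl (size u) (size v)) uv.
rewrite (@term_series_primitive k.+1)// !ncaddE /tensor /fr_series.
by rewrite !trunc_eqlt.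
Qed.

Lemma right_normed_gen i s :
  right_normed x (i :: s) = (\pi_L (right_bracket R i s))%qT.
Proof.
elim: s i => [//|j s IH] i; rewrite right_normed_cons IH.
by rewrite /lie /= fr_lieE.
Qed.

Lemma right_normed_eq0 w : (k < size w)%N -> right_normed x w = 0.
Proof.
elim: w => // i w IH; rewrite ltnS leq_eqVlt => /orP[/eqP kE|kw].
  rewrite right_normed_gen; apply/fr_eqP; exact: lc_nilp.
case: w IH kw => // j w IH kw.
by rewrite right_normed_cons IH// lier0.
Qed.

Lemma dynkin_stable N f : dynkin x (k + N) f = dynkin x k f.
Proof.
elim: N => [|N IH]; first by rewrite addn0.
rewrite addnS dynkinS IH dynkin_top_eq0 ?addr0// => w wN.
by rewrite right_normed_eq0// wN ltnS leq_addr.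
Qed.

Lemma dynkin_onto a : exists f, a = dynkin x k f.
Proof.
pose S a := exists f, a = dynkin x k f; rewrite -/(S a).
have S0 : S 0 by exists 0; rewrite dynkin0.
have SD b c : S b -> S c -> S (b + c).
  by move=> [f ->] [g ->]; exists (f + g); rewrite dynkinD.
have SZ r b : S b -> S (r *: b).
  by move=> [f ->]; exists (ncconst r * f); rewrite dynkinZ.
have SN b : S b -> S (- b) by move=> /(SZ (-1)); rewrite scaleN1r.
have Sgen j : S (x j).
  by exists (ncvar R j); rewrite -(dynkin_stable 1) addn1 dynkin_var.
have Slgen j b : S b -> S (lie (x j) b).
  (* Removing the constant term avoids the extra summand [f [::] *: x j] of [dynkin_mull]. *)
  move=> [f ->]; exists (ncvar R j * (f - ncconst (f [::]))).
  rewrite -[RHS](dynkin_stable 1) addn1 dynkin_mull ncBE ncconstE subrr scale0r add0r.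
  by rewrite dynkinD -rmorphN dynkin_const addr0.
(* Right-normed brackets span: the left argument is itself in the image of [dynkin], and Jacobi
   moves its letters outwards one at a time. *)
have Slie N f b : S b -> S (lie (dynkin x N f) b).
  elim: N f b => [|N IH] f b Sb; first by rewrite /= lie0r.
  rewrite dynkin_succ lie_suml; apply: (big_ind S) => // i _.
  rewrite lieDl lieZl lie_lie; apply: (SD); first exact/SZ/Slgen.
  by apply: SD; [apply/Slgen/IH|apply/SN/IH/Slgen].
elim/fr_ind: a; elim=> [|j|s IHs t IHt|s IHs|c s IHs|s IHs t IHt].
- exact: S0.
- exact: Sgen.
- by rewrite -fr_addrE; apply: SD.
- suff <- : - (\pi_L s)%qT = (\pi_L (LtOpp s))%qT by exact: SN.
  by rewrite /GRing.opp /= fr_oppE.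
- suff <- : c *: (\pi_L s)%qT = (\pi_L (LtScale c s))%qT by exact: SZ.
  by rewrite /GRing.scale /= fr_scaleE.
- suff <- : lie (\pi_L s)%qT (\pi_L t)%qT = (\pi_L (LtLie s t))%qT.
    by have [f ->] := IHs; apply: Slie.
  by rewrite /lie /= fr_lieE.
Qed.

Lemma fr_series_dynkin N f : eqlt k.+1 (fr_series (dynkin x N f)) (psi N f).
Proof.
elim: N f => [|N IH] f; first by rewrite /= fr_series0.
rewrite dynkin_succ dynkin_series_succ fr_series_sum.
elim/big_ind2: _ => // [*|i _]; first exact: eqltD.
rewrite fr_seriesD fr_seriesZ; apply: eqltD.
  by apply: eqltM => //; apply: fr_series_gen.
apply: eqlt_trans; first exact: fr_series_lie.
by apply: eqlt_comm => //; apply: fr_series_gen.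
Qed.

Definition fr_log f : L := dynkin x k (degopV f).

Lemma fr_log_eqlt f g : eqlt k.+1 f g -> fr_log f = fr_log g.
Proof. by move=> fg; apply: dynkin_eqlt; apply: degopV_eqlt. Qed.

(** On [a = dynkin x k f] the composite applies the Dynkin operator to a Dynkin series, which
    multiplies by the degree; [degopV] has divided this out. *)
Lemma fr_seriesK a : fr_log (fr_series a) = a.
Proof.
have [f ->] := dynkin_onto a.
rewrite (fr_log_eqlt (@fr_series_dynkin k f)) /fr_log -dynkin_series_degopV.
rewrite dynkin_dynkin_series degop_degopV dynkinD -rmorphN dynkin_const.
by rewrite addr0.
Qed.

Lemma fr_series_log f : eqlt k.+1 (fr_series (fr_log f)) (degopV (psi k f)).
Proof. by rewrite -dynkin_series_degopV; exact: fr_series_dynkin. Qed.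

Definition fr_exp a : afr := dexp (fr_series a).

Lemma fr_exp_nil a : fr_exp a [::] = 1. Proof. exact: dexp_nil. Qed.

Lemma fr_exp_grouplike a : grouplike_upto k.+1 (fr_exp a).
Proof. exact/dexp_grouplike/fr_series_primitive. Qed.

Lemma fr_expK a : fr_log (fr_exp a) = a.
Proof.
rewrite -[LHS]fr_seriesK -[RHS]fr_seriesK; apply: fr_log_eqlt.
apply: eqlt_trans; first exact: fr_series_log.
rewrite -[fr_series a]degopV_degop ?fr_series_nil//; apply: degopV_eqlt.
have := dynkin_series_grouplike (fr_exp_grouplike a).
rewrite degop_dexp => E.
(* Right multiplication by the inverse of [fr_exp a] cancels the common factor in [E]. *)
rewrite -[psi _ _]mulr1 -[degop _]mulr1 -(ncmulfV (fr_exp_nil a)) !mulrA.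
exact: eqltM.
Qed.

Lemma fr_logK g : grouplike_upto k.+1 g -> eqlt k.+1 (fr_exp (fr_log g)) g.
Proof.
move=> gg; apply: eqlt_sym; apply: dexp_uniq; first by case: gg.
apply: eqlt_trans; first exact: eqlt_sym (dynkin_series_grouplike gg).
apply: eqltM => //; apply: eqlt_sym.
apply: eqlt_trans; first exact: degop_eqlt (fr_series_log _).
by rewrite degop_degopV dynkin_series_nil ncconst0 subr0.
Qed.

End Step.

Lemma fr_projD k (a b : fr R n k.+1) : fr_proj (a + b) = fr_proj a + fr_proj b.
Proof.
elim/fr_ind: a => s; elim/fr_ind: b => t.
by rewrite fr_addrE !fr_projE fr_addrE.
Qed.

Lemma fr_projZ k c (a : fr R n k.+1) : fr_proj (c *: a) = c *: fr_proj a.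
Proof.
elim/fr_ind: a => s; rewrite /GRing.scale /= fr_scaleE !fr_projE.
by rewrite fr_scaleE.
Qed.

Lemma fr_proj_lie k (a b : fr R n k.+1) :
  fr_proj (lie a b) = lie (fr_proj a) (fr_proj b).
Proof.
elim/fr_ind: a => s; elim/fr_ind: b => t.
by rewrite /lie /= fr_lieE !fr_projE fr_lieE.
Qed.

Lemma fr_proj0 k : fr_proj 0 = 0 :> fr R n k.
Proof. by rewrite -(scale0r (0 : fr R n k.+1)) fr_projZ scale0r. Qed.

Lemma fr_proj_dynkin k N f :
  fr_proj (dynkin (@fr_gen R n k.+1) N f) = dynkin (@fr_gen R n k) N f.
Proof.
elim: N f => [|N IH] f; first exact: fr_proj0.
rewrite !dynkin_succ (big_morph _ (@fr_projD k) (@fr_proj0 k)).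
apply: eq_bigr => i _; rewrite fr_projD fr_projZ fr_proj_lie IH.
by rewrite fr_projE.
Qed.

Lemma fr_proj_log k f : fr_proj (fr_log k.+1 f) = fr_log k f.
Proof.
rewrite /fr_log fr_proj_dynkin -[k.+1]addn1.
exact: dynkin_stable.
Qed.

Lemma fr_series_proj k (a : fr R n k.+1) :
  eqlt k.+1 (fr_series (fr_proj a)) (fr_series a).
Proof.
elim/fr_ind: a => s; rewrite fr_projE !fr_series_pi.
move=> w wk; rewrite trunc_eqlt// trunc_eqlt//.
exact: ltnW.
Qed.

End FreeNilpotentSeries.

(** * The change of variables exp(w_j) - 1 *)

Section ChangeOfVariables.
Variables (R : realType) (n : nat).
Local Notation afr := (ncseries R n).
Local Notation afr2 := (ncseries (ncseries R n) n).
Implicit Types (f g h : afr) (w : seq 'I_n) (j : 'I_n) (k : nat).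

Definition expm1 j : afr := dexp (ncvar R j) - 1.

Lemma expm1_nil j : expm1 j [::] = 0.
Proof. by rewrite /expm1 ncBE dexp_nil subrr. Qed.

Lemma expm1_letter i j : expm1 j [:: i] = ncvar R j [:: i].
Proof.
rewrite /expm1 ncBE nc1E subr0 dexpE /dexp_step add0r invr1 mul1r degop_var.
by rewrite ncM_cons ncvar_nil mul0r add0r ncM_nil dexp_nil mulr1.
Qed.

Lemma eqlt_expm1 j : eqlt 2 (expm1 j) (ncvar R j).
Proof. by case=> [|i []]// _; rewrite ?expm1_nil ?expm1_letter. Qed.

(* The continuous endomorphism w_j |-> exp(w_j) - 1 of the algebra of series,
   defined by recursion on the length of words. *)
Definition expsubst_step (F : afr * seq 'I_n -> R) (p : afr * seq 'I_n) : R :=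
  ncconst (p.1 [::]) p.2 +
  \sum_j (expm1 j * (fun v => F (ncshift j p.1, v) : R)) p.2.

Lemma expsubst_step_contractive :
  contractive (fun p : afr * seq 'I_n => size p.2) expsubst_step.
Proof.
move=> F G [f w] FG; rewrite /expsubst_step /=; congr (_ + _).
apply: eq_bigr => j _; apply: (@eqltM_raise _ _ (size w)) => //.
  exact: expm1_nil.
by move=> v vw; apply: FG.
Qed.

Definition expsubst f : afr :=
  fun w => fixpt (fun p : afr * seq 'I_n => size p.2) 0 expsubst_step (f, w).

Let c : {rmorphism R -> afr} := [the {rmorphism R -> afr} of @ncconst R n].

Lemma expsubst_decomp f :
  expsubst f = ncconst (f [::]) + \sum_j expm1 j * expsubst (ncshift j f).
Proof.
apply/funext => w; rewrite ncaddE ncsumA /expsubst.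
exact: (fixptE 0 (f, w) expsubst_step_contractive).
Qed.

Lemma expsubst_subst : subst_eq c expm1 expsubst.
Proof. exact: expsubst_decomp. Qed.

Let E0 : forall f g, eqlt 0 f g. Proof. by []. Qed.
Let Esep f g : (forall k, eqlt k f g) -> f = g.
Proof. by move=> fg; apply/funext => w; apply: fg (ltnSn _). Qed.
Let Erefl k f : eqlt k f f. Proof. by []. Qed.
Let cC r f : c r * f = f * c r.
Proof. by apply/funext => w; rewrite ncconstME ncMconst mulrC. Qed.
Let Eraise k j f g : eqlt k f g -> eqlt k.+1 (expm1 j * f) (expm1 j * g).
Proof. by apply: eqltM_raise; exact: expm1_nil. Qed.

Lemma expsubst_constM r f : expsubst (ncconst r * f) = ncconst r * expsubst f.
Proof.
exact: (subst_constM E0 Esep (@eqltD R n) Erefl Eraise cC r f expsubst_subst).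
Qed.

Lemma expsubst_const r : expsubst (ncconst r) = ncconst r.
Proof.
exact: (subst_const E0 Esep (@eqltD R n) Erefl Eraise r expsubst_subst).
Qed.

Lemma expsubst_var j : expsubst (ncvar R j) = expm1 j.
Proof.
exact: (subst_var E0 Esep (@eqltD R n) Erefl Eraise j expsubst_subst).
Qed.

Lemma expsubstD : {morph expsubst : f g / f + g}.
Proof. exact: (substD E0 Esep (@eqltD R n) Erefl Eraise expsubst_subst). Qed.

Lemma expsubst_is_zmod_morphism : zmod_morphism expsubst.
Proof.
have NE f : - f = ncconst (-1) * f.
  by apply/funext => w; rewrite ncconstME mulN1r.
have N f : expsubst (- f) = - expsubst f by rewrite NE expsubst_constM -NE.
by move=> f g; rewrite expsubstD N.
Qed.

Lemma expsubst_is_monoid_morphism : monoid_morphism expsubst.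
Proof.
split; first exact: (expsubst_const 1).
exact: (substM E0 Esep (@eqltD R n) Erefl Eraise cC expsubst_subst).
Qed.

HB.instance Definition _ :=
  GRing.isZmodMorphism.Build afr afr expsubst expsubst_is_zmod_morphism.
HB.instance Definition _ :=
  GRing.isMonoidMorphism.Build afr afr expsubst expsubst_is_monoid_morphism.

Lemma expsubst_nil f : expsubst f [::] = f [::].
Proof.
rewrite expsubst_decomp ncaddE ncsumA big1 ?addr0// => j _.
by rewrite ncM_nil expm1_nil mul0r.
Qed.

Lemma expsubst_eqlt k f g : eqlt k f g -> eqlt k (expsubst f) (expsubst g).
Proof.
elim: k f g => [//|k IH] f g fg.
rewrite expsubst_decomp (expsubst_decomp g) (fg [::])//; apply: eqltD => //.
elim/big_ind2: _ => // [*|j _]; first exact: eqltD.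
by apply: Eraise; apply: IH => w wk; apply: fg.
Qed.

(** Since [expm1 j] is the letter plus words of length at least 2, what [expsubst] adds to a word is
    strictly longer; hence the recursion for the inverse is contractive. *)
Lemma expsubst_sub_eqlt k f g :
  eqlt k f g -> eqlt k.+1 (expsubst f - f) (expsubst g - g).
Proof.
have E f' : expsubst f' - f' = \sum_j ((expm1 j - ncvar R j) *
    expsubst (ncshift j f') + ncvar R j * (expsubst (ncshift j f') - ncshift j f')).
  rewrite {2}[f']series_decomp expsubst_decomp opprD addrACA subrr add0r.
  rewrite -sumrB; apply: eq_bigr => j _.
  by rewrite (mulrBl _ (expm1 j)) mulrBr [RHS]addrA subrK.
elim: k f g => [|k IH] f g fg.
  by case=> // _; rewrite !ncBE !expsubst_nil !subrr.
rewrite !E; elim/big_ind2: _ => // [*|j _]; first exact: eqltD.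
have fgj : eqlt k (ncshift j f) (ncshift j g) by move=> w wk; apply: fg.
apply: eqltD; last by apply: eqltM_raise => //; apply: IH.
have d2 : eqlt 2 (expm1 j - ncvar R j) 0.
  by rewrite -(subrr (ncvar R j)); apply: eqltD => //; apply: eqlt_expm1.
move=> w wk; rewrite !ncME; apply: eq_bigr => i _.
have [i2|i2] := ltnP i 2.
  rewrite d2 ?nc0E ?mul0r// size_take_min.
  exact: leq_ltn_trans (geq_minl _ _) i2.
by rewrite (expsubst_eqlt fgj)// size_drop; have := ltn_ord i; lia.
Qed.

(* expsubst is unipotent for the filtration by the length. *)
Definition expsubst_inv_step h (f : afr) : afr :=
  h - (expsubst f - f).

Lemma expsubst_inv_contractive h : contractive size (expsubst_inv_step h).
Proof.
move=> f g w fg; rewrite /expsubst_inv_step [LHS]ncBE [RHS]ncBE; congr (_ - _).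
exact: (@expsubst_sub_eqlt (size w)).
Qed.

Definition expsubst_inv h : afr := fixpt size 0 (expsubst_inv_step h).

Lemma expsubst_invE h w :
  expsubst_inv h w = expsubst_inv_step h (expsubst_inv h) w.
Proof. exact/fixptE/expsubst_inv_contractive. Qed.

Lemma expsubst_invK : cancel expsubst_inv expsubst.
Proof.
move=> h; set x := expsubst_inv h.
have E : x = h + (x - expsubst x).
  by apply/funext => w; rewrite {1}/x expsubst_invE /expsubst_inv_step opprB.
by rewrite -[h](addrK (x - expsubst x)) -E opprB addrC subrK.
Qed.

Lemma expsubstK : cancel expsubst expsubst_inv.
Proof.
move=> f; apply: Esep => k.
apply: (contractive_uniq (@expsubst_inv_contractive (expsubst f))) => w _.
  exact: expsubst_invE.
by rewrite /expsubst_inv_step opprB addrC subrK.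
Qed.

(** The tensor square of [expsubst]: first on the inner factor, then on the outer one between two
    swaps. *)
Definition expsubst2 : afr2 -> afr2 :=
  @ncswap R n \o ncmap expsubst \o @ncswap R n \o ncmap expsubst.

HB.instance Definition _ := GRing.RMorphism.on expsubst2.

Lemma expsubst2_tensor f g :
  expsubst2 (tensor f g) = tensor (expsubst f) (expsubst g).
Proof.
have sc (a : R) (f' : afr) : (fun v => a * f' v) = ncconst a * f' :> afr.
  by apply/funext => v; rewrite ncconstME.
apply/funext => u; apply/funext => v; rewrite /expsubst2 /= /ncswap /ncmap /=.
rewrite (_ : (fun v0 => expsubst (tensor f g v0) v) = ncconst (expsubst g v) * f).
  by rewrite expsubst_constM ncconstME mulrC.
apply/funext => s.
have -> : tensor f g s = ncconst (f s) * g.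
  by apply/funext => t; rewrite ncconstME.
by rewrite expsubst_constM !ncconstME mulrC.
Qed.

Lemma expsubst2_inj : injective expsubst2.
Proof.
have mi : injective (ncmap expsubst : afr2 -> afr2).
  move=> h h' hh; apply/funext => u; apply: (can_inj expsubstK).
  exact: (congr1 (@^~ u) hh).
have si : injective (@ncswap R n).
  move=> h h' hh; apply/funext => u; apply/funext => v.
  exact: (congr1 (fun h : afr2 => h v u) hh).
by move=> h h' /si/mi/si/mi.
Qed.

Lemma dexp_var_grouplike j :
  mixcop false (dexp (ncvar R j)) = tensor (dexp (ncvar R j)) (dexp (ncvar R j)).
Proof.
apply/funext => u; apply/funext => v.
have [_] := dexp_grouplike (@primitive_upto_var R n (size u + size v).+1 j).
by apply.
Qed.

Lemma mixcop_gen_trueE j : mixcop_gen R true j =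
  tensor (1 + ncvar R j) (1 + ncvar R j) - 1.
Proof.
apply/funext => u; apply/funext => v; rewrite ncBE ncBE /mixcop_gen.
rewrite -tensor11 !ncaddE /tensor !ncaddE.
by rewrite !mulrDl !mulrDr; ring.
Qed.

(** Both sides are homomorphisms in [f] with the same values on letters: [1 + w_j] is grouplike for
    infiltration, its image [dexp (ncvar R j)] is grouplike for the shuffle coproduct. *)
Lemma expsubst2_mixcop f :
  expsubst2 (mixcop true f) = mixcop false (expsubst f).
Proof.
pose cc : {rmorphism R -> afr2} := [the {rmorphism R -> afr2} of
  (@ncconst afr n \o @ncconst R n)].
pose y j := mixcop false (expm1 j).
have yE j : y j = expsubst2 (mixcop_gen R true j).
  rewrite mixcop_gen_trueE rmorphB rmorph1 /= expsubst2_tensor rmorphD rmorph1.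
  rewrite /= expsubst_var /y {1}/expm1 rmorphB rmorph1 /= dexp_var_grouplike.
  by rewrite [1 + _]addrC subrK.
suff : expsubst2 \o mixcop true = mixcop false \o expsubst.
  by move/(congr1 (@^~ f)).
apply: (@subst_uniq R n afr2 cc (@eqlt2 R n) y _ _ (@eqlt2D R n)) => //.
- move=> h h' hh; apply/funext => u; apply/funext => v.
  exact: hh (ltnSn _).
- move=> k j h h'; apply: eqlt2M_raise.
  by rewrite /y mixcop_nill expm1_nil.
- apply: subst_eqP => [g h|g h|r|j] /=.
  + by rewrite !rmorphD.
  + by rewrite !rmorphM.
  + rewrite mixcop_const.
    have -> : ncconst (ncconst r) = tensor (ncconst r) 1 :> afr2.
      apply/funext => -[|? ?]; apply/funext => -[|? ?];
      by rewrite /tensor !ncconstE nc1E ?mulr1 ?mulr0 ?mul0r.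
    rewrite expsubst2_tensor expsubst_const rmorph1.
    apply/funext => -[|? ?]; apply/funext => -[|? ?];
    by rewrite /tensor !ncconstE nc1E ?mulr1 ?mulr0 ?mul0r.
  + by rewrite mixcop_var -yE.
- apply: subst_eqP => [g h|g h|r|j] /=.
  + by rewrite expsubstD rmorphD.
  + by rewrite (rmorphM expsubst) /= rmorphM.
  + by rewrite expsubst_const mixcop_const.
  + by rewrite expsubst_var.
Qed.

Lemma expsubst_grouplike g :
  mixcop true g = tensor g g <->
  mixcop false (expsubst g) = tensor (expsubst g) (expsubst g).
Proof.
rewrite -expsubst2_mixcop -expsubst2_tensor.
by split=> [->//|/expsubst2_inj].
Qed.

End ChangeOfVariables.

(** * Polynomial functions and topology *)

Section TopologyLemmas.

Lemma cvg_initial (S : Type) (T : topologicalType) (U : choiceType) (f : U -> T)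
    (FS : set_system S) (h : S -> U) (x : U) : Filter FS ->
  f \o h @ FS --> f x -> h @ FS --> (x : initial_topology f).
Proof.
move=> FF fh A /=; rewrite nbhsE => -[_ [[B oB <-] /= Bx] BA].
apply: filterS BA _; apply: (fh B).
exact: open_nbhs_nbhs.
Qed.

Lemma cvg_prod (S : Type) (I : Type) (K : I -> topologicalType)
    (FS : set_system S) (h : S -> prod_topology K) (x : prod_topology K) :
  Filter FS -> (forall i, h ^~ i @ FS --> x i) -> h @ FS --> x.
Proof.
move=> FF hx; apply/cvg_sup => i.
exact: (@cvg_initial S (K i) (forall i, K i) (fun f => f i) FS h x FF (hx i)).
Qed.

Lemma continuous_prod (S : topologicalType) (I : Type)
    (K : I -> topologicalType) (F : S -> prod_topology K) :
  (forall i, continuous (fun s => F s i)) -> continuous F.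
Proof. by move=> Fc s; apply: cvg_prod => i; exact: Fc. Qed.

Lemma continuous_mx (R : realType) (S : topologicalType) (m n : nat)
    (F : S -> 'M[R]_(m, n)) :
  (forall i j, continuous (fun s => F s i j)) -> continuous F.
Proof.
move=> Fc s; apply/cvgrPdist_le => /= e e0; near=> t.
rewrite /Num.Def.normr/= mx_normrE (bigmax_le _ (ltW e0))//= => i _.
rewrite !mxE/=; move: i; near: t; apply: filter_forall => /= i.
exact: ((cvgrPdist_le _ _).1 (Fc i.1 i.2 s)).
Unshelve. all: by end_near. Qed.

End TopologyLemmas.

Section PolynomialFunctions.
Variables (R : realType) (V : normedModType R).

(** A class closed under directional derivatives, so that one induction gives [class_C k] for all
    [k]; [V] is general because the group product lives on pairs of row vectors. *)
Inductive polyfun : (V -> R) -> Prop :=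
| polyfun_cst c : polyfun (fun=> c)
| polyfun_lin (l : {linear V -> R}) : continuous l -> polyfun l
| polyfunD f g : polyfun f -> polyfun g -> polyfun (fun x => f x + g x)
| polyfunM f g : polyfun f -> polyfun g -> polyfun (fun x => f x * g x).

Lemma polyfun_continuous f : polyfun f -> continuous f.
Proof.
elim=> {f} [c|l //|f g _ fc _ gc|f g _ fc _ gc] x.
- exact: cvg_cst.
- by apply: cvgD; [exact: fc|exact: gc].
- by apply: cvgM; [exact: fc|exact: gc].
Qed.

Lemma polyfun_derivable f x v : polyfun f -> derivable f x v.
Proof.
elim=> {f} [c|l lc|f g _ fd _ gd|f g _ fd _ gd].
- exact: derivable_cst.
- exact/diff_derivable/linear_differentiable.
- exact: derivableD.
- exact: derivableM.
Qed.

Lemma derive_lin (W : normedModType R) (l : {linear V -> W}) x v :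
  continuous l -> 'D_v l x = l v.
Proof.
move=> lc; rewrite deriveE ?diff_lin//.
exact: linear_differentiable.
Qed.

Lemma polyfun_derive f v : polyfun f -> polyfun ('D_v f).
Proof.
elim=> {f} [c|l lc|f g fp fd gp gd|f g fp fd gp gd].
- have -> : 'D_v (fun=> c) = (fun=> 0) :> (V -> R).
    by apply/funext => x; exact: derive_cst.
  exact: polyfun_cst.
- have -> : 'D_v l = fun=> l v by apply/funext => x; rewrite derive_lin.
  exact: polyfun_cst.
- have -> : 'D_v (fun x => f x + g x) = fun x => 'D_v f x + 'D_v g x.
    by apply/funext => x; apply: deriveD; exact: polyfun_derivable.
  exact: polyfunD.
- have -> : 'D_v (fun x => f x * g x) = fun x => f x * 'D_v g x + g x * 'D_v f x.
    by apply/funext => x; apply: deriveM; exact: polyfun_derivable.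
  by apply: polyfunD; apply: polyfunM.
Qed.

Lemma polyfun_sum I (r : seq I) (F : I -> V -> R) :
  (forall i, polyfun (F i)) -> polyfun (fun x => \sum_(i <- r) F i x).
Proof.
move=> Fp; elim: r => [|i r IH].
  rewrite (_ : (fun _ => _) = fun=> 0); first exact: polyfun_cst.
  by apply/funext => x; rewrite big_nil.
rewrite (_ : (fun _ => _) = fun x => F i x + \sum_(j <- r) F j x).
  exact: polyfunD.
by apply/funext => x; rewrite big_cons.
Qed.

Lemma polyfun_class_C d (f : V -> 'rV[R]_d) :
  (forall j, polyfun (fun x => f x ord0 j)) ->
  forall k, class_C k [set: V] f.
Proof.
move=> fp k; elim: k f fp => [|k IH] f fp /=.
  move=> x _; apply: continuous_mx => i j; rewrite (ord1 i).
  exact/polyfun_continuous/fp.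
have fd x v : derivable f x v.
  by apply/derivable_mxP => i j; rewrite (ord1 i); exact/polyfun_derivable/fp.
move=> v; split=> [x _|]; first exact: fd.
apply: IH => j; rewrite (_ : (fun _ => _) = 'D_v (fun x => f x ord0 j)).
  exact/polyfun_derive/fp.
by apply/funext => x; rewrite derive_mx// mxE.
Qed.

Lemma polyfun_smooth_near d (f : V -> 'rV[R]_d) x :
  (forall j, polyfun (fun x => f x ord0 j)) -> smooth_near x f.
Proof.
move=> fp; exists setT; split => //; first exact: openT.
exact: polyfun_class_C.
Qed.

End PolynomialFunctions.

Section PolynomialComposition.
Variables (R : realType) (U V : normedModType R).

Lemma polyfun_comp (l : {linear U -> V}) (f : V -> R) :
  continuous l -> polyfun f -> polyfun (f \o l).
Proof.
move=> lc; elim=> {f} [c|f fc|f g _ fp _ gp|f g _ fp _ gp].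
- exact: (polyfun_cst U c).
- apply: (@polyfun_lin _ _ [the {linear U -> R} of f \o l]) => x.
  by apply: continuous_comp; [exact: lc|exact: fc].
- exact: polyfunD fp gp.
- exact: polyfunM fp gp.
Qed.

Lemma derive_comp_lin (W : normedModType R) (l : {linear U -> V}) (f : V -> W) x v :
  'D_v (f \o l) x = 'D_(l v) f (l x).
Proof.
rewrite /derive.
have -> : (fun h : R => h^-1 *: (((f \o l) \o shift x) (h *: v) - (f \o l) x)) =
    (fun h => h^-1 *: ((f \o shift (l x)) (h *: l v) - f (l x))).
  by apply/funext => h /=; rewrite (linearD l) (linearZZ l).
by [].
Qed.

End PolynomialComposition.

Section FunctionAlgebra.
Variables (R : realType) (n : nat) (Z : Type) (P : (Z -> R) -> Prop).
Hypothesis Pcst : forall c, P (fun=> c).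
Hypothesis PD : forall f g, P f -> P g -> P (fun z => f z + g z).
Hypothesis PM : forall f g, P f -> P g -> P (fun z => f z * g z).
Local Notation afr := (ncseries R n).
Implicit Types (F G : Z -> afr).

(** The function algebra [P] is abstract so that the same lemmas give polynomiality in coordinates
    and continuity in the series. *)
Definition coefwise F := forall w, P (fun z => F z w).

Lemma closed_sum I (r : seq I) (F : I -> Z -> R) :
  (forall i, P (F i)) -> P (fun z => \sum_(i <- r) F i z).
Proof.
move=> Fp; elim: r => [|i r IH].
  rewrite (_ : (fun _ => _) = fun=> 0); first exact: Pcst.
  by apply/funext => x; rewrite big_nil.
rewrite (_ : (fun _ => _) = fun x => F i x + \sum_(j <- r) F j x).
  exact: PD.
by apply/funext => x; rewrite big_cons.
Qed.

Lemma coefwise_cst f : coefwise (fun=> f).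
Proof. by move=> w; exact: Pcst. Qed.

Lemma coefwiseD F G : coefwise F -> coefwise G -> coefwise (fun z => F z + G z).
Proof. by move=> FP GP w; exact: PD. Qed.

Lemma coefwiseM F G : coefwise F -> coefwise G -> coefwise (fun z => F z * G z).
Proof.
move=> FP GP w.
by apply: closed_sum => i; apply: PM.
Qed.

Lemma coefwiseN F : coefwise F -> coefwise (fun z => - F z).
Proof.
move=> FP w; rewrite (_ : (fun _ => _) = fun z => -1 * F z w).
  exact: PM.
by apply/funext => z; rewrite mulN1r.
Qed.

Lemma coefwiseX F k : coefwise F -> coefwise (fun z => F z ^+ k).
Proof.
move=> FP; elim: k => [|k IH].
  rewrite (_ : (fun _ => _) = fun=> 1); first exact: coefwise_cst.
  by apply/funext => z; rewrite expr0.
rewrite (_ : (fun _ => _) = fun z => F z * F z ^+ k); first exact: coefwiseM.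
by apply/funext => z; rewrite exprS.
Qed.

Lemma coefwise_shift F j : coefwise F -> coefwise (fun z => ncshift j (F z)).
Proof. by move=> FP w; exact: FP. Qed.

Lemma coefwise_inv F : coefwise F -> coefwise (fun z => ncinv (F z)).
Proof.
move=> FP w.
rewrite (_ : (fun _ => _) = fun z => \sum_(k < (size w).+1) ((1 - F z) ^+ k) w).
  apply: closed_sum => k; apply: coefwiseX.
  by apply: coefwiseD; [exact: coefwise_cst|exact: coefwiseN].
by apply/funext => z; rewrite /ncinv ncsumA.
Qed.

Lemma coefwise_degop F : coefwise F -> coefwise (fun z => degop (F z)).
Proof. by move=> FP w; apply: PM. Qed.

Lemma coefwise_degopV F : coefwise F -> coefwise (fun z => degopV (F z)).
Proof. by move=> FP w; apply: PM. Qed.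

Lemma coefwise_iter (T : Z -> afr -> afr) (f0 : afr) k :
  (forall G, coefwise G -> coefwise (fun z => T z (G z))) ->
  coefwise (fun z => iter k (T z) f0).
Proof.
move=> TP; elim: k => [|k IH]; first exact: coefwise_cst.
exact: TP IH.
Qed.

Lemma coefwise_dexp F : coefwise F -> coefwise (fun z => dexp (F z)).
Proof.
move=> FP w; apply: (@coefwise_iter (fun z => dexp_step (F z))) => G GP v.
apply: PD; first exact: Pcst.
apply: PM; first exact: Pcst.
exact: (coefwiseM (coefwise_degop FP) GP).
Qed.

Lemma coefwise_expsubst F : coefwise F -> coefwise (fun z => expsubst (F z)).
Proof.
move=> FP w; have [m] := ubnP (size w).
elim: m w F FP => // m IH w F FP wm.
rewrite (_ : (fun _ => _) = fun z => ncconst (F z [::]) w +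
    \sum_j \sum_(i < (size w).+1)
      expm1 R j (take i w) * expsubst (ncshift j (F z)) (drop i w)); last first.
  by apply/funext => z; rewrite expsubst_decomp ncaddE ncsumA.
apply: PD; first by case: {wm} w => [|? ?]; [exact: FP|exact: Pcst].
apply: closed_sum => j; apply: closed_sum => i.
(* For [i = 0] the recursive call would not be on a shorter word, but its factor [expm1 R j [::]] is
   0. *)
have [i0|i0] := posnP i.
  rewrite i0 take0 expm1_nil (_ : (fun _ => _) = fun=> 0); first exact: Pcst.
  by apply/funext => z; rewrite mul0r.
apply: PM; first exact: Pcst.
apply: (IH (drop i w) (fun z => ncshift j (F z))); first exact: coefwise_shift.
by rewrite size_drop; have := ltn_ord i; lia.
Qed.

Lemma coefwise_expsubst_inv F :
  coefwise F -> coefwise (fun z => expsubst_inv (F z)).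
Proof.
move=> FP w; apply: (@coefwise_iter (fun z => expsubst_inv_step (F z))).
move=> G GP; apply: coefwiseD => //; apply: coefwiseN.
by apply: coefwiseD; [exact: coefwise_expsubst|exact: coefwiseN].
Qed.

Section Dynkin.
Variables (L : lieAlgType R) (x : 'I_n -> L).

(** The linear form [T] is general because the recursion composes it with brackets; in the
    application it is a coordinate. *)
Lemma coefwise_dynkin (T : L -> R) N F :
  (forall a b, T (a + b) = T a + T b) ->
  (forall c a, T (c *: a) = c * T a) ->
  coefwise F -> P (fun z => T (dynkin x N (F z))).
Proof.
elim: N T F => [|N IH] T F TD TZ FP; first exact: (Pcst (T 0)).
have T0 : T 0 = 0 by rewrite -(scale0r 0) TZ mul0r.
rewrite (_ : (fun _ => _) = fun z => \sum_i
  (F z [:: i] * T (x i) + T (lie (x i) (dynkin x N (ncshift i (F z)))))); last first.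
  apply/funext => z; rewrite dynkin_succ (big_morph T TD T0).
  by apply: eq_bigr => i _; rewrite TD TZ.
apply: closed_sum => i; apply: PD; first exact: PM.
apply: (IH (fun a => T (lie (x i) a)) (fun z => ncshift i (F z))).
- by move=> a b; rewrite lieDr TD.
- by move=> c a; rewrite lieZr TZ.
- exact: coefwise_shift.
Qed.

End Dynkin.

End FunctionAlgebra.

Section DeriveCoefwise.
Variables (R : realType) (n : nat) (V : normedModType R).
Local Notation afr := (ncseries R n).
Implicit Types (F : V -> afr) (v z : V).

Lemma derive_sumE I (r : seq I) (F : I -> V -> R) v z :
  (forall i, polyfun (F i)) ->
  'D_v (fun z => \sum_(i <- r) F i z) z = \sum_(i <- r) 'D_v (F i) z.
Proof.
move=> Fp; elim: r => [|i r IH].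
  rewrite (_ : (fun _ => _) = cst 0); first by rewrite derive_cst big_nil.
  by apply/funext => y; rewrite big_nil.
rewrite (_ : (fun _ => _) = F i + (fun y => \sum_(j <- r) F j y)).
  rewrite deriveD ?IH ?big_cons//; apply: polyfun_derivable => //.
  exact: polyfun_sum.
by apply/funext => y; rewrite big_cons.
Qed.

Lemma derive_mulE (f g : V -> R) v z : polyfun f -> polyfun g ->
  'D_v (fun z => f z * g z) z = f z * 'D_v g z + g z * 'D_v f z.
Proof. by move=> fp gp; apply: deriveM; exact: polyfun_derivable. Qed.

Lemma derive_addE (f g : V -> R) v z : polyfun f -> polyfun g ->
  'D_v (fun z => f z + g z) z = 'D_v f z + 'D_v g z.
Proof. by move=> fp gp; apply: deriveD; exact: polyfun_derivable. Qed.

Lemma derive_cstE (c : R) v z : 'D_v (fun=> c) z = 0.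
Proof. exact: derive_cst. Qed.

Definition derive_coef F v : V -> afr := fun z w => 'D_v (fun y => F y w) z.

Lemma derive_dynkin (L : lieAlgType R) (x : 'I_n -> L) (T : L -> R) N F v z :
  (forall a b, T (a + b) = T a + T b) ->
  (forall c a, T (c *: a) = c * T a) ->
  coefwise (@polyfun R V) F ->
  'D_v (fun y => T (dynkin x N (F y))) z = T (dynkin x N (derive_coef F v z)).
Proof.
elim: N T F => [|N IH] T F TD TZ FP.
  have T0 : T 0 = 0 by rewrite -(scale0r 0) TZ mul0r.
  by rewrite /= derive_cstE T0.
have T0 : T 0 = 0 by rewrite -(scale0r 0) TZ mul0r.
rewrite (_ : (fun _ => _) = fun z => \sum_i
  (F z [:: i] * T (x i) + T (lie (x i) (dynkin x N (ncshift i (F z)))))); last first.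
  apply/funext => y; rewrite dynkin_succ (big_morph T TD T0).
  by apply: eq_bigr => i _; rewrite TD TZ.
have TlD i a b : T (lie (x i) (a + b)) = T (lie (x i) a) + T (lie (x i) b).
  by rewrite lieDr TD.
have TlZ i c a : T (lie (x i) (c *: a)) = c * T (lie (x i) a).
  by rewrite lieZr TZ.
have P1 i : polyfun (fun z => F z [:: i] * T (x i)).
  by apply: polyfunM => //; exact: polyfun_cst.
have P2 i : polyfun (fun z => T (lie (x i) (dynkin x N (ncshift i (F z))))).
  apply: (@coefwise_dynkin R n V (@polyfun R V) (@polyfun_cst R V)
    (@polyfunD R V) (@polyfunM R V) L x (fun a => T (lie (x i) a)) N
    (fun z => ncshift i (F z))) => //.
  by move=> w; exact: FP.
rewrite derive_sumE; last by move=> i; exact: polyfunD.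
rewrite dynkin_succ (big_morph T TD T0); apply: eq_bigr => i _.
rewrite derive_addE// derive_mulE//; last exact: polyfun_cst.
rewrite derive_cstE mulr0 add0r TD TZ mulrC; congr (_ + _).
rewrite (IH (fun a => T (lie (x i) a)) (fun z => ncshift i (F z)))//.
by move=> w; exact: FP.
Qed.

End DeriveCoefwise.

(** * Linear coordinates on a retract of a row space *)

Section LinearRetract.
Variables (R : fieldType) (L : lmodType R) (N : nat).
Variables (e : {linear L -> 'rV[R]_N}) (r : {linear 'rV[R]_N -> L}).
Hypothesis eK : cancel e r.

(** The matrix of an idempotent, whose row space is a copy of [L]; its rank serves as the dimension
    of a space given by generators and relations. *)
Let M : 'M[R]_N := lin1_mx [the {linear 'rV[R]_N -> 'rV[R]_N} of e \o r].

Let rM v : v *m M = e (r v). Proof. by rewrite mul_rV_lin1. Qed.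

Definition retract_dim := \rank M.

Definition retract_coord (a : L) : 'rV[R]_retract_dim :=
  e a *m pinvmx (row_base M).

Definition retract_vect (v : 'rV[R]_retract_dim) : L := r (v *m row_base M).

Lemma retract_coord_is_linear : linear retract_coord.
Proof. by move=> c a b; rewrite /retract_coord linearP mulmxDl scalemxAl. Qed.

Lemma retract_vect_is_linear : linear retract_vect.
Proof.
by move=> c a b; rewrite /retract_vect mulmxDl -scalemxAl linearP.
Qed.

HB.instance Definition _ := GRing.isLinear.Build R L 'rV[R]_retract_dim *:%R
  retract_coord retract_coord_is_linear.
HB.instance Definition _ := GRing.isLinear.Build R 'rV[R]_retract_dim L *:%R
  retract_vect retract_vect_is_linear.

Lemma retract_coordK : cancel retract_coord retract_vect.
Proof.
move=> a; rewrite /retract_vect /retract_coord mulmxKpV ?eK//.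
by rewrite eq_row_base -[e a](congr1 e (eK a)) -rM submxMl.
Qed.

Lemma retract_vectK : cancel retract_vect retract_coord.
Proof.
move=> v; rewrite /retract_vect /retract_coord.
have /submxP[u uE] : (v *m row_base M <= M)%MS.
  by rewrite -(eq_row_base M) submxMl.
have -> : e (r (v *m row_base M)) = v *m row_base M.
  by rewrite uE rM eK.
by rewrite -mulmxA mulmxVp ?row_base_free// mulmx1.
Qed.

End LinearRetract.

(** * The group Fr_n(k) *)

Section Series1Lemmas.
Variables (R : realType) (n : nat).
Local Notation afr := (ncseries R n).
Implicit Types (f g : afr) (x y : series1 R n) (e : bool) (k K : nat).

Lemma val_mul1 x y : val (x * y)%g = val x * val y. Proof. by []. Qed.
Lemma val_inv1 x : val x^-1%g = ncinv (val x). Proof. by []. Qed.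
Lemma val_one1 : val (1%g : series1 R n) = 1. Proof. by []. Qed.

Lemma series1_mulVf x : val x * ncinv (val x) = 1.
Proof. by rewrite ncmulfV// series1_nil. Qed.

Lemma series1_mulfV x : ncinv (val x) * val x = 1.
Proof. by rewrite -val_inv1 -val_mul1 mulVg. Qed.

Lemma eqlt_mulVI k x f g :
  eqlt k (val x * f) (val x * g) -> eqlt k f g.
Proof.
move=> fg; rewrite -[f]mul1r -[g]mul1r -(series1_mulfV x) -!mulrA.
exact: eqltM.
Qed.

Lemma eqlt_inv k x y : eqlt k (val x) (val y) -> eqlt k (val x^-1%g) (val y^-1%g).
Proof.
move=> xy; apply: (@eqlt_mulVI k y).
rewrite !val_inv1 series1_mulVf -(series1_mulVf x).
by apply: eqltM => //; exact: eqlt_sym.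
Qed.

Lemma grouplike_mul e K x y :
  eqlt2 K (mixcop e (val x)) (tensor (val x) (val x)) ->
  eqlt2 K (mixcop e (val y)) (tensor (val y) (val y)) ->
  eqlt2 K (mixcop e (val (x * y)%g)) (tensor (val (x * y)%g) (val (x * y)%g)).
Proof.
move=> xg yg; rewrite val_mul1 rmorphM /= -tensorM.
exact: eqlt2M.
Qed.

Lemma grouplike_one e K :
  eqlt2 K (mixcop e (1 : afr)) (tensor 1 1).
Proof. by rewrite rmorph1 tensor11. Qed.

Lemma grouplike_inv e K x :
  eqlt2 K (mixcop e (val x)) (tensor (val x) (val x)) ->
  eqlt2 K (mixcop e (val x^-1%g)) (tensor (val x^-1%g) (val x^-1%g)).
Proof.
move=> xg; set h := mixcop e _; set t := tensor _ _.
have t1 : tensor (val x) (val x) * t = 1.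
  by rewrite tensorM series1_mulVf tensor11.
have h1 : h * mixcop e (val x) = 1.
  by rewrite -rmorphM /= series1_mulfV rmorph1.
rewrite -[h]mulr1 -t1 -[t in eqlt2 _ _ t]mul1r -h1 mulrA.
by apply: eqlt2M => //; apply: eqlt2M => //; exact: eqlt2_sym.
Qed.

Lemma comm_series1 (a b : afr) : a * b - b * a =
  (a - 1) * (b - 1) - (b - 1) * (a - 1).
Proof.
rewrite !mulrBl !mulrBr !mul1r !mulr1 !opprB [_ - 1 in RHS]addrC.
by apply/funext => w; rewrite !(ncaddE, ncoppE, ncBE); ring.
Qed.

(** A commutator does not change when 1 is subtracted from both factors, and [x - 1] has no constant
    term; this gains one length. *)
Lemma eqlt_comm_mul i x y :
  eqlt i.+1 (val y) 1 -> eqlt i.+2 (val x * val y) (val y * val x).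
Proof.
move=> y1; have {}y1 : eqlt i.+1 (val y - 1) 0.
  by rewrite -(subrr 1); apply: eqltD.
have x0 : (val x - 1) [::] = 0 by rewrite ncBE series1_nil nc1E subrr.
have r1 := eqltM_raise x0 y1; have r2 := eqltM_raiser x0 y1.
move=> w wi; apply/eqP; rewrite -subr_eq0 -ncBE comm_series1 ncBE r1// r2//.
by rewrite mulr0 mul0r subr0.
Qed.

Lemma eqlt_mul1 i f g : eqlt i f 1 -> eqlt i g 1 -> eqlt i (f * g) 1.
Proof.
by move=> f1 g1; rewrite -[X in eqlt _ _ X]mulr1; exact: eqltM.
Qed.

Lemma eqlt_inv1 i x : eqlt i (val x) 1 -> eqlt i (val x^-1%g) 1.
Proof.
move=> x1; have -> : (1 : afr) = val (1^-1%g : series1 R n) by rewrite invg1.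
exact: eqlt_inv.
Qed.

End Series1Lemmas.

Section Words.
Variables (R : realType) (n : nat).
Local Notation afr := (ncseries R n).
Implicit Types (f : afr) (w : seq 'I_n) (k : nat).

Definition word_vec k f : 'rV[R]_(size (words n k)) :=
  \row_i f (nth [::] (words n k) i).

Definition vec_word k (v : 'rV[R]_(size (words n k))) : afr :=
  fun w => \sum_i v 0 i * (w == nth [::] (words n k) i)%:R.

Lemma word_vecK k f : eqlt k.+1 (vec_word (word_vec k f)) f.
Proof.
move=> w; rewrite ltnS -mem_words => win.
have iw : (index w (words n k) < size (words n k))%N by rewrite index_mem.
rewrite /vec_word (bigD1 (Ordinal iw))//= nth_index// eqxx mulr1 mxE /=.
rewrite nth_index// big1 ?addr0// => i; rewrite -val_eqE /= => ne.
rewrite (_ : (_ == _) = false) ?mulr0//; apply/negbTE; apply: contraNneq ne.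
by move=> ->; rewrite index_uniq// words_uniq.
Qed.

End Words.

Section Coordinates.
Variables (R : realType) (n k : nat).
Local Notation afr := (ncseries R n).
Local Notation L := (fr R n k).

Lemma fr_logD (f g : afr) : fr_log k (f + g) = fr_log k f + fr_log k g.
Proof.
rewrite /fr_log -dynkinD; congr (dynkin _ _ _).
by apply/funext => w; rewrite /degopV !ncaddE mulrDr.
Qed.

Lemma fr_logZ c (f : afr) : fr_log k (ncconst c * f) = c *: fr_log k f.
Proof.
rewrite /fr_log -dynkinZ; congr (dynkin _ _ _).
by apply/funext => w; rewrite /degopV !ncconstME mulrCA.
Qed.

Lemma fr_log1 : fr_log k (1 : afr) = 0.
Proof.
rewrite /fr_log (_ : degopV 1 = 0) ?dynkin0//.
by apply/funext => -[|j w]; rewrite ?degopV_nil// /degopV mulr0.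
Qed.

Let N := size (@words n k).

Definition fr_vec (a : L) : 'rV[R]_N := word_vec k (fr_series a).
Definition vec_fr (v : 'rV[R]_N) : L := fr_log k (vec_word v).

Lemma fr_vec_is_linear : linear fr_vec.
Proof.
move=> c a b; apply/rowP => i.
by rewrite !mxE fr_seriesD fr_seriesZ ncaddE ncconstME.
Qed.

Lemma vec_fr_is_linear : linear vec_fr.
Proof.
move=> c u v; rewrite /vec_fr -fr_logZ -fr_logD; congr (fr_log k _).
apply/funext => w; rewrite ncaddE ncconstME /vec_word mulr_sumr -big_split.
by apply: eq_bigr => i _; rewrite !mxE mulrDl mulrA.
Qed.

HB.instance Definition _ :=
  GRing.isLinear.Build R L 'rV[R]_N *:%R fr_vec fr_vec_is_linear.
HB.instance Definition _ :=
  GRing.isLinear.Build R 'rV[R]_N L *:%R vec_fr vec_fr_is_linear.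

Lemma fr_vecK : cancel fr_vec vec_fr.
Proof.
by move=> a; rewrite /vec_fr (fr_log_eqlt (word_vecK _)) fr_seriesK.
Qed.

Definition fr_dim : nat :=
  retract_dim (fr_vec : {linear L -> 'rV[R]_N})
    (vec_fr : {linear 'rV[R]_N -> L}).
Definition fr_coord : {linear L -> 'rV[R]_fr_dim} :=
  [the {linear L -> 'rV[R]_fr_dim} of
    @retract_coord R L N fr_vec vec_fr].
Definition fr_vect : {linear 'rV[R]_fr_dim -> L} :=
  [the {linear 'rV[R]_fr_dim -> L} of
    @retract_vect R L N fr_vec vec_fr].

Lemma fr_coordK : cancel fr_coord fr_vect.
Proof. exact/retract_coordK/fr_vecK. Qed.

Lemma fr_vectK : cancel fr_vect fr_coord.
Proof. exact/retract_vectK/fr_vecK. Qed.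

End Coordinates.

Section FreeNilpotentGroup.
Variables (R : realType) (n k : nat).
Local Notation L := (fr R n k).

(* The group fr R n k carries through [fr_exp], in linear coordinates. *)
Definition fr_group : Type := 'rV[R]_(fr_dim R n k).

HB.instance Definition _ := Topological.copy fr_group 'rV[R]_(fr_dim R n k).

Implicit Types (x y z : fr_group) (g h : series1 R n).

Fact fr_group_series_subproof x : fr_exp (fr_vect R n k x) [::] == 1.
Proof. by rewrite fr_exp_nil. Qed.

Definition fr_group_series x : series1 R n :=
  Series1 (fr_group_series_subproof x).

Definition series_fr_group g : fr_group := fr_coord R n k (fr_log k (val g)).

Local Notation ev := fr_group_series.
Local Notation lg := series_fr_group.

Lemma val_fr_group_series x : val (ev x) = fr_exp (fr_vect R n k x).
Proof. by []. Qed.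

Lemma lg_eqlt g h : eqlt k.+1 (val g) (val h) -> lg g = lg h.
Proof. by move=> gh; rewrite /series_fr_group (fr_log_eqlt gh). Qed.

Lemma fr_group_seriesK : cancel ev lg.
Proof.
by move=> x; rewrite /series_fr_group val_fr_group_series fr_expK fr_vectK.
Qed.

Definition grouplike1 g := eqlt2 k.+1 (mixcop false (val g)) (tensor (val g) (val g)).

Lemma grouplike1_ev x : grouplike1 (ev x).
Proof. by case: (fr_exp_grouplike (fr_vect R n k x)). Qed.

Lemma series_fr_groupK g : grouplike1 g -> eqlt k.+1 (val (ev (lg g))) (val g).
Proof.
move=> gg; rewrite val_fr_group_series /series_fr_group fr_coordK.
by apply: fr_logK; split => //; exact: series1_nil.
Qed.

Definition fr_mul x y : fr_group := lg (ev x * ev y)%g.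
Definition fr_one : fr_group := lg 1%g.
Definition fr_inv x : fr_group := lg (ev x)^-1%g.

(** The series [ev x] is grouplike only up to length [k], so [ev] is multiplicative only modulo
    longer words; [lg] ignores these, which suffices for the group axioms. *)
Lemma ev_mul x y : eqlt k.+1 (val (ev (fr_mul x y))) (val (ev x) * val (ev y)).
Proof. by apply: series_fr_groupK; apply: grouplike_mul; exact: grouplike1_ev. Qed.

Lemma ev_one : eqlt k.+1 (val (ev fr_one)) 1.
Proof. by apply: series_fr_groupK; exact: grouplike_one. Qed.

Lemma ev_inv x : eqlt k.+1 (val (ev (fr_inv x))) (val (ev x)^-1%g).
Proof. by apply: series_fr_groupK; apply: grouplike_inv; exact: grouplike1_ev. Qed.

Fact fr_mulA : associative fr_mul.
Proof.
move=> x y z; apply: lg_eqlt; rewrite !val_mul1.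
apply: (@eqlt_trans _ _ _ _ (val (ev x) * val (ev y) * val (ev z))).
  by rewrite -mulrA; apply: eqltM => //; exact: ev_mul.
by apply: eqltM => //; apply: eqlt_sym; exact: ev_mul.
Qed.

Fact fr_mul1 : left_id fr_one fr_mul.
Proof.
move=> x; rewrite -[RHS]fr_group_seriesK; apply: lg_eqlt.
by rewrite -[val (ev x) in X in eqlt _ _ X]mul1r; apply: eqltM => //; exact: ev_one.
Qed.

Fact fr_mulr1 : right_id fr_one fr_mul.
Proof.
move=> x; rewrite -[RHS]fr_group_seriesK; apply: lg_eqlt.
by rewrite -[val (ev x) in X in eqlt _ _ X]mulr1; apply: eqltM => //; exact: ev_one.
Qed.

Fact fr_mulVl : left_inverse fr_one fr_inv fr_mul.
Proof.
move=> x; apply: lg_eqlt; rewrite val_one1 -(series1_mulfV (ev x)).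
by apply: eqltM => //; exact: ev_inv.
Qed.

Fact fr_mulV : right_inverse fr_one fr_inv fr_mul.
Proof.
move=> x; apply: lg_eqlt; rewrite val_one1 -(series1_mulVf (ev x)).
by apply: eqltM => //; exact: ev_inv.
Qed.

HB.instance Definition _ := isGroup.Build fr_group
  fr_mulA fr_mul1 fr_mulr1 fr_mulVl fr_mulV.

Lemma fr_one0 : fr_one = 0 :> 'rV[R]_(fr_dim R n k).
Proof. by rewrite /fr_one /series_fr_group fr_log1 linear0. Qed.

End FreeNilpotentGroup.

Section LinearForms.
Variables (R : realType) (d : nat).

Definition rV_coord (j : 'I_d) (x : 'rV[R]_d) : R := x 0 j.

Lemma rV_coord_is_linear j : linear_for *%R (rV_coord j).
Proof. by move=> c x y; rewrite /rV_coord !mxE. Qed.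

HB.instance Definition _ j :=
  GRing.isLinear.Build R 'rV[R]_d R *%R (rV_coord j) (rV_coord_is_linear j).

Lemma polyfun_coord j : polyfun (rV_coord j).
Proof.
apply: (@polyfun_lin _ _ [the {linear 'rV[R]_d -> R} of rV_coord j]) => x.
exact: coord_continuous.
Qed.

Lemma polyfun_linear (l : 'rV[R]_d -> R) :
  (forall x y, l (x + y) = l x + l y) -> (forall c x, l (c *: x) = c * l x) ->
  polyfun l.
Proof.
move=> lD lZ; have l0 : l 0 = 0 by rewrite -(scale0r 0) lZ mul0r.
rewrite (_ : l = fun x => \sum_j rV_coord j x * l (delta_mx 0 j)).
  apply: polyfun_sum => j; apply: polyfunM; first exact: polyfun_coord.
  exact: polyfun_cst.
apply/funext => x; rewrite {1}(row_sum_delta x) (big_morph l lD l0).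
by apply: eq_bigr => j _; rewrite lZ.
Qed.

End LinearForms.

Section Vector.
Variables (R : realType) (d : nat).
Local Notation V := 'rV[R]_d.

Lemma rV_connected : connected [set: V].
Proof.
have -> : [set: V] = \bigcup_v range (fun t : R => t *: v).
  apply/seteqP; split => // v _; exists v => //.
  by exists 1 => //; rewrite scale1r.
apply: bigcup_connected.
  by exists 0 => v _; exists 0 => //; rewrite scale0r.
move=> v _; apply: connected_continuous_connected.
  by apply/connected_intervalP.
by apply: continuous_subspaceT => t; apply: cvgZr_tmp; exact: cvg_id.
Qed.

End Vector.

(** * Smooth structure, Lie bracket and nilpotency of the group *)

Section FrGroupTopology.
Variables (R : realType) (n k : nat).
Local Notation d := (fr_dim R n k).
Local Notation V := 'rV[R]_d.
Local Notation ev := (@fr_group_series R n k).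
Local Notation lg := (@series_fr_group R n k).
Local Notation L := (fr R n k).
Local Notation vect := (fr_vect R n k).
Local Notation coord := (fr_coord R n k).
Local Notation afr := (ncseries R n).
Local Notation VV := ('rV[R]_(fr_dim R n k) * 'rV[R]_(fr_dim R n k))%type.

Lemma coefwise_fr_series :
  coefwise (@polyfun R V) (fun x => fr_series (vect x) : afr).
Proof.
move=> w; apply: polyfun_linear => [x y|c x].
  by rewrite linearD fr_seriesD.
by rewrite linearZZ fr_seriesZ ncconstME.
Qed.

Lemma coefwise_ev : coefwise (@polyfun R V) (fun x => val (ev x)).
Proof.
exact: (coefwise_dexp (@polyfun_cst R V) (@polyfunD R V) (@polyfunM R V)
  coefwise_fr_series).
Qed.

Lemma closed_lg (Z : Type) (P : (Z -> R) -> Prop) (F : Z -> afr) j :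
  (forall c, P (fun=> c)) ->
  (forall f g, P f -> P g -> P (fun z => f z + g z)) ->
  (forall f g, P f -> P g -> P (fun z => f z * g z)) ->
  coefwise P F -> P (fun z => coord (fr_log k (F z)) 0 j).
Proof.
move=> Pc PD PM FP.
apply: (@coefwise_dynkin R n Z P Pc PD PM L (@fr_gen R n k) (fun a => coord a 0 j) k
  (fun z => degopV (F z))).
- by move=> a b; rewrite linearD mxE.
- by move=> c a; rewrite linearZZ mxE.
- exact: coefwise_degopV.
Qed.

Lemma coefwise_comp (U W : normedModType R) (l : {linear U -> W})
    (F : W -> afr) : continuous l ->
  coefwise (@polyfun R W) F -> coefwise (@polyfun R U) (fun z => F (l z)).
Proof. by move=> lc FP w; exact: (polyfun_comp lc (FP w)). Qed.

Let fstL : {linear VV -> V} := [the {linear _ -> _} of fst].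
Let sndL : {linear VV -> V} := [the {linear _ -> _} of snd].

Let fst_cont : continuous fstL.
Proof. by move=> z; exact: cvg_fst. Qed.
Let snd_cont : continuous sndL.
Proof. by move=> z; exact: cvg_snd. Qed.

Lemma coefwise_ev_mul : coefwise (@polyfun R VV)
  (fun z => val (ev z.1) * val (ev z.2)).
Proof.
apply: (coefwiseM (@polyfun_cst _ _) (@polyfunD _ _) (@polyfunM _ _)).
  exact: (coefwise_comp fst_cont coefwise_ev).
exact: (coefwise_comp snd_cont coefwise_ev).
Qed.

Lemma polyfun_fr_mul j : polyfun (fun z : VV => fr_mul z.1 z.2 0 j).
Proof.
apply: (closed_lg (F := fun z => val (ev z.1) * val (ev z.2))).
- exact: polyfun_cst.
- exact: polyfunD.
- exact: polyfunM.
- exact: coefwise_ev_mul.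
Qed.

Lemma polyfun_fr_inv j : polyfun (fun x : V => fr_inv x 0 j).
Proof.
apply: (closed_lg (F := fun x => ncinv (val (ev x)))).
- exact: polyfun_cst.
- exact: polyfunD.
- exact: polyfunM.
- exact: (coefwise_inv (@polyfun_cst _ _) (@polyfunD _ _) (@polyfunM _ _)
    coefwise_ev).
Qed.

Fact fr_mul_continuous :
  continuous (fun z : fr_group R n k * fr_group R n k => (z.1 * z.2)%g).
Proof.
apply: (@continuous_mx R VV 1 d) => i j; rewrite (ord1 i).
exact/polyfun_continuous/polyfun_fr_mul.
Qed.

Fact fr_inv_continuous : continuous (fun x : fr_group R n k => x^-1%g).
Proof.
apply: (@continuous_mx R V 1 d) => i j; rewrite (ord1 i).
exact/polyfun_continuous/polyfun_fr_inv.
Qed.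

HB.instance Definition _ := isTopologicalGroup.Build (fr_group R n k)
  fr_mul_continuous fr_inv_continuous.

(** The identity is a global chart. It is transparent because [fr_chart_bracket] computes with its
    fields. *)
Definition fr_chart : lie_chart R (fr_group R n k) d.
Proof.
refine (@LieChart R (fr_group R n k) d (fun x => x) (fun v => v) setT
  _ _ _ _ _ _ _ _ _).
- exact: openT.
- by [].
- by rewrite image_id; exact: openT.
- by [].
- by apply: continuous_subspaceT => x; exact: cvg_id.
- by apply: continuous_subspaceT => x; exact: cvg_id.
- exact: fr_one0.
- by apply: polyfun_smooth_near => j; exact: polyfun_fr_mul.
- by apply: polyfun_smooth_near => j; exact: polyfun_fr_inv.
Defined.

Lemma ev0 : val (ev (0 : V)) = 1.
Proof.
rewrite val_fr_group_series linear0 /fr_exp fr_series0.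
apply/funext => w; apply: esym.
apply: (@dexp_uniq R n (size w).+1 0 1) => // v _.
by rewrite degop1 degop0 mul0r.
Qed.

(** To first order [dexp lam] is [1 + lam]: in the product rule for [degop lam * dexp lam] at 0, one
    term vanishes with [lam] and the other has the factor [ev 0 = 1]. *)
Lemma derive_ev (u : V) w :
  'D_u (fun x => val (ev x) w) (0 : V) = fr_series (vect u) w.
Proof.
have polyS v : polyfun (fun x => degop (fr_series (vect x) : afr) v).
  by apply: polyfunM; [exact: polyfun_cst|exact: coefwise_fr_series].
case: w => [|a w].
  rewrite (_ : (fun _ => _) = fun=> 1) ?derive_cstE ?fr_series_nil//.
  by apply/funext => x; rewrite series1_nil.
pose F i x := degop (fr_series (vect x) : afr) (take i (a :: w)) *
  val (ev x) (drop i (a :: w)).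
pose c : R := (size (a :: w))%:R^-1.
have Fp i : polyfun (F i) by apply: polyfunM => //; exact: coefwise_ev.
rewrite (_ : (fun _ => _) = fun x => c * \sum_(i < (size (a :: w)).+1) F i x).
  rewrite derive_mulE; [|exact: polyfun_cst|exact: polyfun_sum].
  rewrite derive_cstE mulr0 addr0 derive_sumE//.
  rewrite -[RHS](@degopKV R n _ (a :: w))// /degopV; congr (_ * _).
  rewrite -[degop _]mulr1 ncME; apply: eq_bigr => i _.
  rewrite derive_mulE//; last exact: coefwise_ev.
  rewrite [degop (fr_series (vect 0)) _](_ : _ = 0) ?mul0r ?add0r; last first.
    by rewrite linear0 fr_series0 degop0.
  rewrite ev0 mulrC; congr (_ * _).
  rewrite derive_mulE; [|exact: polyfun_cst|exact: coefwise_fr_series].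
  rewrite derive_cstE mulr0 addr0; congr (_ * _).
  pose l (x : V) : R := fr_series (vect x) (take i (a :: w)).
  have lL : linear_for *%R l.
    move=> r x y; rewrite /l linearP fr_seriesD fr_seriesZ.
    by rewrite ncaddE ncconstME.
  pose ll : {linear V -> R} := HB.pack l (GRing.isLinear.Build _ _ _ _ l lL).
  apply: (@derive_lin R V R ll).
  exact: (polyfun_continuous (coefwise_fr_series (take i (a :: w)))).
by apply/funext => x; rewrite val_fr_group_series /fr_exp dexpE /dexp_step add0r.
Qed.

(** Each factor depends on one of the two variables only, so the mixed derivative is the product of
    the two derivatives from [derive_ev]. *)
Lemma derive2_ev_mul (u v : V) w :
  'D_((u, 0) : VV)
    ('D_((0, v) : VV) (fun z => (val (ev z.1) * val (ev z.2)) w)) 0 =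
  (fr_series (vect u) * fr_series (vect v)) w.
Proof.
have e1 p : polyfun (fun z : VV => val (ev z.1) p).
  exact: (coefwise_comp fst_cont coefwise_ev p).
have e2 p : polyfun (fun z : VV => val (ev z.2) p).
  exact: (coefwise_comp snd_cont coefwise_ev p).
have D1 p (y z : VV) : 'D_y (fun z => val (ev z.1) p) z =
    'D_(y.1) (fun x => val (ev x) p) z.1.
  exact: (derive_comp_lin fstL (fun x => val (ev x) p)).
have D2 p (y z : VV) : 'D_y (fun z => val (ev z.2) p) z =
    'D_(y.2) (fun x => val (ev x) p) z.2.
  exact: (derive_comp_lin sndL (fun x => val (ev x) p)).
have D10 p z : 'D_((0, v) : VV) (fun z : VV => val (ev z.1) p) z = 0.
  by rewrite D1; exact: derive0.
have D20 p z : 'D_((0, v) : VV) (fun z : VV => val (ev z.2) p) z =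
    'D_v (fun x => val (ev x) p) z.2.
  exact: D2.
have e3 p : polyfun (fun z : VV => 'D_v (fun x => val (ev x) p) z.2).
  exact: (polyfun_comp snd_cont (polyfun_derive v (coefwise_ev p))).
rewrite (_ : 'D_(0, v) _ = fun z : VV => \sum_(i < (size w).+1)
    val (ev z.1) (take i w) * 'D_v (fun x => val (ev x) (drop i w)) z.2).
  rewrite derive_sumE; last by move=> i; exact: polyfunM.
  rewrite ncME; apply: eq_bigr => i _.
  rewrite derive_mulE// D1 /= derive_ev.
  rewrite (_ : 'D_(u, 0) _ 0 = 0) ?mulr0 ?add0r; last first.
    rewrite (derive_comp_lin sndL ('D_v (fun x => val (ev x) (drop i w)))).
    by rewrite /= derive0.
  by rewrite derive_ev mulrC.
apply/funext => z; rewrite (_ : (fun z => _) = fun z : VV =>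
    \sum_(i < (size w).+1) val (ev z.1) (take i w) * val (ev z.2) (drop i w))//.
rewrite derive_sumE; last by move=> i; exact: polyfunM.
apply: eq_bigr => i _; rewrite (derive_mulE _ _ (e1 _) (e2 _)).
by rewrite D20 D10 [X in _ + X]mulr0 addr0.
Qed.

Lemma derive_lg (U : normedModType R) (F : U -> afr) (x u : U) :
  coefwise (@polyfun R U) F ->
  'D_u (fun z => coord (fr_log k (F z)) : V) x =
  coord (fr_log k (derive_coef F u x)).
Proof.
move=> FP; apply/rowP => j.
rewrite derive_mx ?[LHS]mxE; last first.
  apply/derivable_mxP => i j'; rewrite (ord1 i); apply: polyfun_derivable.
  apply: closed_lg => //; [exact: polyfun_cst|exact: polyfunD|exact: polyfunM].
rewrite (@derive_dynkin R n U L (@fr_gen R n k) (fun a => coord a 0 j) k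
  (fun z => degopV (F z))).
- congr (fun_of_matrix (coord _) _ _); apply: dynkin_eqlt => w _.
  rewrite /derive_coef /degopV derive_mulE//; last exact: polyfun_cst.
  by rewrite derive_cstE mulr0 addr0.
- by move=> a b; rewrite linearD mxE.
- by move=> c a; rewrite linearZZ mxE.
- exact: (coefwise_degopV (@polyfun_cst _ _) (@polyfunM _ _)).
Qed.

(** The bilinear part of the group product is [fr_log] of the product of the two series, so its
    antisymmetrization is [fr_log] of a commutator. *)
Lemma fr_chart_bracket (a b : L) :
  coord (lie a b) = chart_bracket fr_chart (coord a) (coord b).
Proof.
have B (u v : V) : 'D_((u, 0) : VV) ('D_((0, v) : VV)
      (fun z : VV => fr_mul z.1 z.2 : V)) (0, 0) =
    coord (fr_log k (fr_series (vect u) * fr_series (vect v))).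
  have -> : 'D_((0, v) : VV) (fun z : VV => fr_mul z.1 z.2 : V) =
      fun z => coord (fr_log k (derive_coef
        (fun z => val (ev z.1) * val (ev z.2)) (0, v) z)).
    by apply/funext => z; rewrite -derive_lg//; exact: coefwise_ev_mul.
  rewrite derive_lg; last by move=> w; exact/polyfun_derive/coefwise_ev_mul.
  congr (coord (fr_log k _)); apply/funext => w.
  exact: derive2_ev_mul.
transitivity (coord (fr_log k (fr_series a * fr_series b)) -
              coord (fr_log k (fr_series b * fr_series a)) : V); last first.
  have := B (coord a) (coord b); rewrite !fr_coordK => <-.
  by have := B (coord b) (coord a); rewrite !fr_coordK => <-.
rewrite -linearB; congr (coord _).
rewrite -[lie a b]fr_seriesK (fr_log_eqlt (fr_series_lie a b)) fr_logD.
congr (_ + _); rewrite -scaleN1r -fr_logZ; congr (fr_log k _).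
by apply/funext => w; rewrite ncconstME mulN1r.
Qed.

Lemma fr_simply_connected : simply_connected R (fr_group R n k).
Proof.
move=> gamma gc g0 g1.
exists (fun p => (1 - p.1) *: (gamma p.2 : V)); split.
- apply/subspace_continuousP => -[s t] [/= Is It].
  have /subspace_continuousP/(_ t It) gt := gc.
  apply: cvgZ.
    apply: cvgB; first exact: cvg_cst.
    apply: cvg_trans (_ : fst @ nbhs (s, t) --> s); last exact: cvg_fst.
    by apply: cvg_app; exact: cvg_within.
  apply: cvg_trans gt => A; rewrite /= !nbhs_simpl /= /within /=.
  move=> gA; near=> p => -[Ip1 Ip2]; move: Ip2.
  near: p; exact: (cvg_snd gA).
- by move=> t It; rewrite subr0 scale1r.
- by move=> t It; rewrite subrr scale0r -fr_one0.
- move=> s Is; rewrite g0 g1.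
  by split; rewrite /= [X in _ *: X]fr_one0 scaler0 -fr_one0.
Unshelve. all: by end_near. Qed.

Lemma fr_nilpotent : nilpotent (fr_group R n k).
Proof.
exists k; apply/seteqP; split; last first.
  move=> _ ->; case: k => [|m] //=.
  by move=> S [[]].
(* Commutators raise the order by one. The bound [i <= k] stays within the precision of [ev], and at
   [i = k] everything visible to [lg] is trivial. *)
have key i : (i <= k)%N -> lower_central [set: fr_group R n k] i `<=`
    [set x | eqlt i.+1 (val (ev x)) 1].
  elim: i => [_ x _|i IH ik].
    by case=> // _; rewrite series1_nil.
  apply: smallest_sub; last first.
    move=> _ [a _ [b bi <-]] /=; have {}bi := IH (ltnW ik) b bi.
    (* The product [(b a) [a, b] = a b] is compared with [b a]; since [b] is 1 below length [i.+1],
       the two agree one length further. *)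
    apply: (@eqlt_mulVI _ _ _ (ev (b * a)%g)).
    have E : eqlt k.+1 (val (ev (b * a)%g) * val (ev [~ a, b]%g))
        (val (ev a) * val (ev b)).
      apply: eqlt_trans (ev_mul a b).
      rewrite -[fr_mul a b]/(a * b)%g [in X in eqlt _ _ X]commgC.
      exact/eqlt_sym/ev_mul.
    apply: eqlt_trans; first exact: eqltW E.
    rewrite [X in eqlt _ _ X]mulr1.
    apply: eqlt_trans; first exact: eqlt_comm_mul bi.
    by apply: eqltW (eqlt_sym (ev_mul b a)).
  split => /=.
  - exact: (eqltW _ (@ev_one R n k)).
  - move=> x y xi yi; apply: eqlt_trans; first exact: (eqltW _ (ev_mul x y)).
    exact: eqlt_mul1.
  - move=> x xi; apply: eqlt_trans; first exact: (eqltW _ (ev_inv x)).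
    exact: eqlt_inv1.
move=> x /(key k (leqnn k)) /= x1.
by rewrite -[x]fr_group_seriesK; exact: lg_eqlt.
Qed.

Definition fr_lie_group : nilpotent_lie_group L.
Proof.
refine (@NilpotentLieGroup R L (fr_group R n k) _ _ fr_simply_connected
  fr_nilpotent d fr_chart coord _ fr_chart_bracket).
- exact: norm_hausdorff.
- exact: rV_connected.
- by exists vect; [exact: fr_coordK|exact: fr_vectK].
Defined.

End FrGroupTopology.

(** * The isomorphism with the inverse limit *)

Section ContinuousAlgebra.
Variables (R : realType) (Z : topologicalType).

Definition continuousR (f : Z -> R) : Prop := continuous f.

Lemma continuousR_cst c : continuousR (fun=> c).
Proof. by move=> x; exact: cvg_cst. Qed.

Lemma continuousRD f g :
  continuousR f -> continuousR g -> continuousR (fun z => f z + g z).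
Proof. by move=> fc gc x; apply: cvgD; [exact: fc|exact: gc]. Qed.

Lemma continuousRM f g :
  continuousR f -> continuousR g -> continuousR (fun z => f z * g z).
Proof. by move=> fc gc x; apply: cvgM; [exact: fc|exact: gc]. Qed.

End ContinuousAlgebra.

Section Coefficients.
Variables (R : realType) (n : nat).

Lemma continuous_coef w : continuousR (fun f : ncseries R n => f w).
Proof.
exact: (@proj_continuous (seq 'I_n) (fun=> R : topologicalType) w).
Qed.

Lemma continuous_val : continuous (val : series1 R n -> ncseries R n).
Proof. exact: initial_continuous. Qed.

Lemma continuous_val_coef w : continuousR (fun g : series1 R n => val g w).
Proof.
move=> g; apply: (@continuous_comp _ _ _ (val : series1 R n -> ncseries R n)
  (fun f => f w)); first exact: continuous_val.
exact: continuous_coef.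
Qed.

Lemma cvg_series1 (S : Type) (FS : set_system S) (h : S -> series1 R n)
    (x : series1 R n) : Filter FS ->
  (forall w, (fun s => val (h s) w) @ FS --> val x w) -> h @ FS --> x.
Proof.
move=> FF hx; apply: cvg_initial.
exact: (@cvg_prod S (seq 'I_n) (fun=> R : topologicalType) FS
  (fun s => val (h s)) (val x) FF hx).
Qed.

Lemma continuous_series1 (S : topologicalType) (F : S -> series1 R n) :
  (forall w, continuous (fun s => val (F s) w)) -> continuous F.
Proof. by move=> Fc s; apply: cvg_series1 => w; exact: Fc. Qed.

End Coefficients.

(** * Existence and uniqueness of the coproduct *)

Section CoproductUniqueness.
Variables (R : realType) (n : nat).

Lemma mixcop_is_coproduct : is_coproduct (@mixcop R n true).
Proof.
split.
- apply: (@continuous_prod _ (seq 'I_n)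
    (fun=> ncseries R n : topologicalType)) => u.
  apply: (@continuous_prod _ (seq 'I_n) (fun=> R : topologicalType)) => v.
  apply: (closed_sum (@continuousR_cst R _) (@continuousRD R _)) => w.
  exact: continuous_coef.
- by move=> f g; rewrite rmorphD.
- by move=> f g; rewrite rmorphM.
- exact: rmorph1.
- by move=> c f; exact: mixcop_constM.
- by move=> j; exact: mixcop_var.
Qed.

Lemma is_coproduct_mixcop (delta : afr R n -> afr2 R n) :
  is_coproduct delta -> delta = mixcop true.
Proof.
move=> [_ dD dM d1 dZ dv]; apply: mixcop_uniq; apply: subst_eqP => //= r.
by rewrite -[in LHS](mulr1 (ncconst r)) dZ d1 mulr1.
Qed.

Lemma exists_unique_coproduct :
  exists! delta : afr R n -> afr2 R n, is_coproduct delta.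
Proof.
exists (mixcop true); split; first exact: mixcop_is_coproduct.
by move=> delta /is_coproduct_mixcop.
Qed.

End CoproductUniqueness.

Section FrCirc.
Variables (R : realType) (n : nat).
Implicit Types (x y : series1 R n).

Lemma Fr_circP x : Fr_circ (mixcop true) x <->
  forall K, eqlt2 K (mixcop true (val x)) (tensor (val x) (val x)).
Proof.
split=> [xE K|xE]; first by rewrite xE.
apply/funext => u; apply/funext => v.
exact: xE (ltnSn _).
Qed.

Lemma Fr_circ_subgroup : is_subgroup (@Fr_circ R n (mixcop true)).
Proof.
split=> [|x y /Fr_circP xg /Fr_circP yg|x /Fr_circP xg]; apply/Fr_circP => K.
- exact: grouplike_one.
- exact: grouplike_mul.
- exact: grouplike_inv.
Qed.

End FrCirc.

Section LieGroupProjection.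
Variables (R : realType) (n k : nat).

Definition fr_group_proj (x : fr_group R n k.+1) : fr_group R n k :=
  fr_coord R n k (fr_proj (fr_vect R n k.+1 x)).

Lemma fr_group_proj_log g :
  fr_group_proj (series_fr_group k.+1 g) = series_fr_group k g.
Proof. by rewrite /fr_group_proj /series_fr_group fr_coordK fr_proj_log. Qed.

Lemma fr_group_series_proj x : eqlt k.+1
  (val (fr_group_series (fr_group_proj x))) (val (fr_group_series x)).
Proof.
rewrite !val_fr_group_series fr_coordK; apply: dexp_eqlt.
exact: fr_series_proj.
Qed.

(** In the chosen coordinates the projection is a linear map, hence its own differential. *)
Lemma fr_group_proj_hom :
  lie_group_hom (@fr_proj R n k) (fr_group_proj : fr_lie_group R n k.+1 ->
    fr_lie_group R n k).
Proof.
pose V := 'rV[R]_(fr_dim R n k.+1); pose W := 'rV[R]_(fr_dim R n k).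
have lP : linear (fr_group_proj : V -> W).
  move=> c x y; rewrite /fr_group_proj linearP fr_projD fr_projZ.
  by rewrite linearP.
pose ll : {linear V -> W} :=
  HB.pack (fr_group_proj : V -> W) (GRing.isLinear.Build _ _ _ _ _ lP).
have lp j : polyfun (fun x : V => (fr_group_proj x : W) 0 j).
  apply: polyfun_linear => [x y|c x].
    by rewrite -[fr_group_proj _]/(ll _) linearD mxE.
  by rewrite -[fr_group_proj _]/(ll _) linearZZ mxE.
have lc : continuous (fr_group_proj : V -> W).
  apply: continuous_mx => i j; rewrite (ord1 i).
  exact/polyfun_continuous/lp.
split => //.
- move=> x y; rewrite [LHS]fr_group_proj_log; apply: lg_eqlt.
  by rewrite !val_mul1; apply: eqltM; apply: eqlt_sym; apply: fr_group_series_proj.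
- exact: polyfun_smooth_near.
- move=> a; rewrite [LHS](@derive_lin R V W ll)//.
  by rewrite /= /fr_group_proj fr_coordK.
Qed.

End LieGroupProjection.

Section InverseLimit.
Variables (R : realType) (n : nat).
Local Notation Fr := (fun k => fr_group R n k).
Implicit Types (x y g : series1 R n) (a : prod_topology Fr) (k : nat).

Fact expsubst1_subproof x : expsubst (val x) [::] == 1.
Proof. by rewrite expsubst_nil series1_nil. Qed.

Definition expsubst1 x : series1 R n := Series1 (expsubst1_subproof x).

Definition fr_tower x : prod_topology Fr :=
  fun k => series_fr_group k (expsubst1 x).

(* The coefficient of a word is read off the group of its length. *)
Definition tower_series a : afr R n :=
  fun w => val (fr_group_series (a (size w))) w.

Lemma tower_series_eqlt a k : inverse_limit (@fr_group_proj R n) a ->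
  eqlt k.+1 (tower_series a) (val (fr_group_series (a k))).
Proof.
move=> ap w; rewrite ltnS => wk; rewrite /tower_series -(subnK wk).
elim: (k - size w)%N => [|m IH]; first by rewrite add0n.
by rewrite IH -(ap (m + size w)%N) fr_group_series_proj// ltnS leq_addl.
Qed.

Fact tower_unsubst_subproof a : expsubst_inv (tower_series a) [::] == 1.
Proof.
by rewrite -expsubst_nil expsubst_invK /tower_series series1_nil.
Qed.

Definition tower_unsubst a : series1 R n := Series1 (tower_unsubst_subproof a).

Lemma grouplike_expsubst1 x k :
  Fr_circ (mixcop true) x -> grouplike1 k (expsubst1 x).
Proof. by move=> /expsubst_grouplike xg u v _; rewrite xg. Qed.

Lemma expsubst1M x y : expsubst1 (x * y)%g = (expsubst1 x * expsubst1 y)%g.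
Proof. by apply/val_inj; rewrite /= rmorphM. Qed.

Lemma fr_tower_proj x : inverse_limit (@fr_group_proj R n) (fr_tower x).
Proof. by move=> k; exact: fr_group_proj_log. Qed.

Lemma fr_towerK x : Fr_circ (mixcop true) x -> tower_unsubst (fr_tower x) = x.
Proof.
move=> xg; apply/val_inj; rewrite /= -[RHS]expsubstK; congr expsubst_inv.
apply/funext => w; rewrite /tower_series.
exact: (series_fr_groupK (grouplike_expsubst1 (k := size w) xg)).
Qed.

Lemma tower_unsubst_grouplike a : inverse_limit (@fr_group_proj R n) a ->
  Fr_circ (mixcop true) (tower_unsubst a).
Proof.
move=> ap; apply/expsubst_grouplike; rewrite expsubst_invK.
apply/funext => u; apply/funext => v; pose k := (size u + size v)%N.
have ta := @tower_series_eqlt a k ap.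
rewrite /tensor !ta ?ltnS ?leq_addr ?leq_addl//.
rewrite -[RHS](@grouplike1_ev R n k (a k) u v (ltnSn _)).
apply: eq_big_seq => w /size_mix_shuffle wE; apply: ta.
by rewrite wE.
Qed.

Lemma tower_unsubstK a : inverse_limit (@fr_group_proj R n) a ->
  fr_tower (tower_unsubst a) = a.
Proof.
move=> ap; apply: functional_extensionality_dep => k; rewrite /fr_tower.
rewrite -[RHS]fr_group_seriesK; apply: lg_eqlt.
rewrite [val (expsubst1 _)]expsubst_invK.
exact: tower_series_eqlt.
Qed.

Lemma fr_tower_continuous : continuous fr_tower.
Proof.
apply: (@continuous_prod _ nat (fun k => fr_group R n k : topologicalType)).
move=> k; apply: (@continuous_mx R _ 1 (fr_dim R n k)) => i j; rewrite (ord1 i).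
apply: (@closed_lg R n k _ (@continuousR R (series1 R n))
  (fun g => expsubst (val g))).
- exact: continuousR_cst.
- exact: continuousRD.
- exact: continuousRM.
- apply: (coefwise_expsubst (@continuousR_cst _ _) (@continuousRD _ _)
    (@continuousRM _ _)).
  exact: continuous_val_coef.
Qed.

Lemma tower_unsubst_continuous : continuous tower_unsubst.
Proof.
apply: continuous_series1.
apply: (coefwise_expsubst_inv (@continuousR_cst _ _) (@continuousRD _ _)
    (@continuousRM _ _)) => w.
have c1 : continuous (fun a : prod_topology Fr => a (size w)).
  exact: (@proj_continuous nat (fun k => fr_group R n k : topologicalType)).
have c2 := polyfun_continuous (@coefwise_ev R n (size w) w).
have c3 : continuous ((fun x : fr_group R n (size w) =>
    val (fr_group_series x) w) \o (fun a : prod_topology Fr => a (size w))).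
  by move=> a; apply: continuous_comp; [exact: c1|exact: c2].
exact: c3.
Qed.

Lemma fr_tower_iso : topgroup_iso (fun x y => (x * y)%g)
  (@pointwise_mul (fun k => fr_lie_group R n k))
  (Fr_circ (mixcop true)) (inverse_limit (@fr_group_proj R n)) fr_tower.
Proof.
split.
- split=> [x _|x y /set_mem xg /set_mem yg xy|a ap].
  + exact: fr_tower_proj.
  + by rewrite -[x]fr_towerK// xy fr_towerK.
  + exists (tower_unsubst a); last exact: tower_unsubstK.
    exact: tower_unsubst_grouplike.
- move=> x y xg yg; apply: functional_extensionality_dep => k.
  rewrite /fr_tower expsubst1M; apply: lg_eqlt; apply: eqlt_sym.
  by apply: eqltM; apply: series_fr_groupK; exact: grouplike_expsubst1.
- exact/continuous_subspaceT/fr_tower_continuous.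
- exists tower_unsubst; split; first exact: fr_towerK.
  exact/continuous_subspaceT/tower_unsubst_continuous.
Qed.

End InverseLimit.

(** * Lyndon words *)

Notation "u <=l v" := (@Order.le _ (seqlexi (ordinal _)) u v)
  (at level 70, no associativity).
Notation "u <l v" := (@Order.lt _ (seqlexi (ordinal _)) u v)
  (at level 70, no associativity).

Section Lyndon.
Variable n : nat.
Implicit Types (a b : 'I_n) (u v w s t x y z p : seq 'I_n).

Lemma lex_cons a u v : (a :: u <=l a :: v) = (u <=l v).
Proof. by rewrite lexi_cons lexx. Qed.

Lemma ltx_cons a u v : (a :: u <l a :: v) = (u <l v).
Proof. by rewrite ltxi_cons lexx. Qed.

Lemma lex_cat s u v : (s ++ u <=l s ++ v) = (u <=l v).
Proof. by elim: s => //= a s <-; rewrite lex_cons. Qed.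

Lemma ltx_cat s u v : (s ++ u <l s ++ v) = (u <l v).
Proof. by elim: s => //= a s <-; rewrite ltx_cons. Qed.

Lemma lex_catr u s : u <=l u ++ s.
Proof. by rewrite -[X in X <=l _]cats0 lex_cat lexi0s. Qed.

Lemma ltx_catr u s : s != [::] -> u <l u ++ s.
Proof. by rewrite -[X in X <l _]cats0 ltx_cat ltxi0s. Qed.

(** The comparison is decided at a letter, before the tails are reached. *)
Lemma ltx_nprefix u v s t : u <l v -> ~~ prefix u v -> u ++ s <l v ++ t.
Proof.
elim: u v => [|a u IH] [|b v]//=; rewrite ?ltxis0//.
rewrite !ltxi_cons => /andP[ab]; have [->|nab _ _] := eqVneq a b.
  by rewrite lexx /=; exact: IH.
by rewrite ab leNgt lt_neqAle nab ab.
Qed.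

Lemma ltx_size u v s t : size u = size v -> u <l v -> u ++ s <l v ++ t.
Proof.
move=> uv lt; apply: ltx_nprefix => //; apply/negP => /prefixP[r vE].
move: uv lt; rewrite vE size_cat -[LHS]addn0 => /addnI/esym/eqP.
by rewrite size_eq0 => /eqP ->; rewrite cats0 ltxx.
Qed.

Lemma lex_anti u v : u <=l v -> v <=l u -> u = v.
Proof. by move=> uv vu; apply: (@le_anti _ (seqlexi 'I_n)); rewrite uv vu. Qed.

Fixpoint min_suffix w :=
  if w is a :: w' then
    if w' is [::] then w else
    if w <l min_suffix w' then w else min_suffix w'
  else [::].

Lemma min_suffix_cons a b w : min_suffix [:: a, b & w] =
  if [:: a, b & w] <l min_suffix (b :: w) then [:: a, b & w]
  else min_suffix (b :: w).
Proof. by []. Qed.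

Lemma min_suffixP w : w != [::] ->
  [/\ min_suffix w != [::], exists u, w = u ++ min_suffix w &
      forall u v, w = u ++ v -> v != [::] -> min_suffix w <=l v].
Proof.
elim: w => // a [|b w] IH _.
  split => //; first by exists [::].
  by move=> [|c [|e u]] v //= => [<- _|[_ <-]//]; exact: lexx.
have [m0 [r rE] mmin] := IH isT; rewrite min_suffix_cons.
case: ifPn => [lt|]; last rewrite -leNgt => le.
- split => //; first by exists [::].
  by move=> [|c u] v /= => [<- _//|[ac /mmin h] /h]; exact: le_trans (ltW lt).
- split => //; first by exists (a :: r); rewrite /= -rE.
  by move=> [|c u] v /= => [<- _//|[ac /mmin]].
Qed.

(* The standard factorization of a word. *)
Definition rfactor w := min_suffix (behead w).
Definition lfactor w := take (size w - size (rfactor w)) w.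

Lemma lfactorE w u : w = u ++ rfactor w -> lfactor w = u.
Proof.
rewrite /lfactor; move: (rfactor w) => r ->.
by rewrite size_cat addnK take_size_cat.
Qed.

Lemma factorP w : (1 < size w)%N ->
  [/\ w = lfactor w ++ rfactor w, lfactor w != [::], rfactor w != [::] &
      forall u v, w = u ++ v -> u != [::] -> v != [::] -> rfactor w <=l v].
Proof.
case: w => [|a [|b w]]// _; have [m0 [r rE] mmin] := @min_suffixP (b :: w) isT.
have wE : [:: a, b & w] = (a :: r) ++ rfactor [:: a, b & w].
  by rewrite /= -rE.
have lE := lfactorE wE.
split => //; first by rewrite lE.
  by rewrite lE.
by case=> // c u v [_ /mmin].
Qed.

Lemma rfactor_uniq u v : u != [::] -> v != [::] ->
  (forall u' v', u ++ v = u' ++ v' -> u' != [::] -> v' != [::] -> v <=l v') ->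
  rfactor (u ++ v) = v /\ lfactor (u ++ v) = u.
Proof.
move=> u0 v0 vmin.
have s1 : (1 < size (u ++ v))%N.
  by rewrite size_cat; case: u u0 {vmin} => // ? ? _; case: v v0 => //= *;
     rewrite addSn addnS.
have [wE l0 r0 rmin] := factorP s1.
have rv : rfactor (u ++ v) = v.
  by apply: lex_anti; [exact: (rmin u v)|exact: (vmin _ _ wE l0 r0)].
by split => //; apply: lfactorE; rewrite rv.
Qed.

Definition lyndon w : Prop := w != [::] /\
  forall u v, w = u ++ v -> u != [::] -> v != [::] -> w <l v.

Lemma lyndon1 a : lyndon [:: a].
Proof. by split=> // -[|? [|? ?]] [|? ?]. Qed.

Lemma lyndon_factor w : lyndon w -> (1 < size w)%N ->
  [/\ lyndon (lfactor w), lyndon (rfactor w) & lfactor w <l rfactor w].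
Proof.
move=> [w0 wl] s1; have [wE l0 r0 rmin] := factorP s1.
set u := lfactor w in wE l0 *; set v := rfactor w in wE r0 rmin *.
have lv : lyndon v.
  split=> // s t vE s0 t0; have vt : v <=l t.
    apply: (rmin (u ++ s)) => //; first by rewrite -catA -vE.
    by case: (u) l0.
  rewrite lt_neqAle vt andbT; apply: contra_neq s0 => vt'.
  move: (congr1 size vE); rewrite size_cat -vt' -[LHS]add0n => /addIn/esym/eqP.
  by rewrite size_eq0 => /eqP.
have uv : u <l v.
  apply: lt_trans (wl u v wE l0 r0).
  by rewrite [X in _ <l X]wE; exact: ltx_catr.
split => //; split => // s t uE s0 t0.
have wt : w <l t ++ v.
  by apply: (wl s) => //; [rewrite catA -uE|case: (t) t0].
rewrite ltNge; apply/negP => tu.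
have {}tu : t <l u.
  rewrite lt_neqAle tu andbT; apply: contra_neq s0 => tu'.
  move: (congr1 size uE); rewrite size_cat -tu' -[LHS]add0n => /addIn/esym/eqP.
  by rewrite size_eq0 => /eqP.
(* If [u = t r], cancelling [t] in [w < t v] gives [r v < v], against the minimality of [v] among
   proper suffixes; otherwise [t v < u v = w] contradicts [wt]. *)
have [/prefixP[r ur]|np] := boolP (prefix t u).
  move: wt; rewrite wE ur -catA ltx_cat; apply/negP; rewrite -leNgt.
  apply: (rmin t); first by rewrite catA -ur.
    by [].
  by case: (r) {ur} => // ? ?; case: (v) r0.
by have := lt_trans wt (ltx_nprefix v v tu np); rewrite -wE ltxx.
Qed.

Lemma cat_split u v s t : u ++ v = s ++ t -> (size s <= size u)%N ->
  exists2 r, u = s ++ r & t = r ++ v.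
Proof.
elim: s u => [|a s IH] [|b u]//= E; first by exists [::].
  by exists (b :: u).
by case: E => -> /IH h /h[r -> ->]; exists r.
Qed.

Lemma lyndon_cat u v : lyndon u -> lyndon v -> u <l v -> lyndon (u ++ v).
Proof.
move=> [u0 ul] [v0 vl] uv.
have uvv : u ++ v <l v.
  have [/prefixP[r vE]|np] := boolP (prefix u v); last first.
    by rewrite -[X in _ <l X]cats0; exact: ltx_nprefix.
  rewrite [X in _ <l X]vE ltx_cat; apply: (vl u) => //.
  apply: contraTneq uv => r0; by rewrite vE r0 cats0 ltxx.
split; first by case: (u) u0.
move=> s t stE s0 t0.
have [su|us] := leqP (size s) (size u).
  have [r uE tE] := cat_split stE su.
  have [r0|r0] := eqVneq r [::]; first by rewrite tE r0.
  have ur := ul s r uE s0 r0.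
  rewrite tE; apply: ltx_nprefix => //; apply/negP => /prefixP[q rE].
  have := congr1 size uE; rewrite rE !size_cat.
  by case: (s) s0 => //= a' s' _; lia.
have [r sE vE] := cat_split (esym stE) (ltnW us).
have r0 : r != [::].
  by apply: contraTneq us => r0; rewrite sE r0 cats0 ltnn.
exact: lt_trans uvv (vl r t vE r0 t0).
Qed.

(** A proper suffix longer than [v] has the form [r v] with [r] a proper suffix of [u], and then
    [v <= rfactor u <= r <= r v]. *)
Lemma factor_cat u v : lyndon u -> lyndon v -> u <l v ->
  ((1 < size u)%N -> v <=l rfactor u) ->
  rfactor (u ++ v) = v /\ lfactor (u ++ v) = u.
Proof.
move=> [u0 ul] [v0 vl] uv vu; apply: rfactor_uniq => // s t stE s0 t0.
have [us|su] := leqP (size u) (size s).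
  have [r sE vE] := cat_split (esym stE) us.
  have [r0|r0] := eqVneq r [::]; first by rewrite vE r0 lexx.
  exact: ltW (vl _ _ vE r0 t0).
have [r uE tE] := cat_split stE (ltnW su).
have r0 : r != [::].
  by apply: contraTneq su => r0; rewrite uE r0 cats0 ltnn.
have s1 : (1 < size u)%N.
  by rewrite (leq_trans _ su)// ltnS lt0n size_eq0.
have [_ _ _ rmin] := factorP s1.
rewrite tE; apply: le_trans (lex_catr _ _).
exact: le_trans (vu s1) (rmin _ _ uE s0 r0).
Qed.

Local Notation "u 'sh' v" := (mix false u v) (at level 60).

Lemma mix_catl u v : u ++ v \in u sh v.
Proof.
elim: u => [|a u IH]; first by rewrite mix_nill inE.
case: v IH => [|b v] IH; first by rewrite cats0 inE.
by rewrite cat_cons mix_cons mem_cat map_f.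
Qed.

Lemma mix_consl a u v w : w \in u sh v -> a :: w \in (a :: u) sh v.
Proof.
case: v => [|b v] wuv; last by rewrite mix_cons mem_cat map_f.
by move: wuv; rewrite !mix_nilr !inE => /eqP ->.
Qed.

Lemma mix_consr b u v w : w \in u sh v -> b :: w \in u sh (b :: v).
Proof.
case: u => [|a u] wuv; last by rewrite mix_cons !mem_cat map_f ?orbT.
by move: wuv; rewrite !mix_nill !inE => /eqP ->.
Qed.

Lemma mix_catr u v : v ++ u \in u sh v.
Proof.
elim: v => [|b v IH]; first by rewrite mix_nilr inE.
exact: mix_consr.
Qed.

(** Letters of [p] are copied. When the next letter comes from [y], the new shuffle takes the first
    letter of [x] instead, which is at least as large; if the two are equal, that letter joins
    [p]. *)
Lemma shuffle_swap x y p z : y <=l x -> z \in (p ++ x) sh y ->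
  exists2 z', z' \in x sh (p ++ y) & z <=l z'.
Proof.
have [m] := ubnP (size z); elim: m z x y p => // m IH z x y p zm yx zin.
case: p zin => [|c p] zin; first by exists z.
case: y yx zin => [|b y] yx.
  rewrite mix_nilr inE => /eqP ->; exists ((c :: p) ++ x) => //.
  by rewrite cats0; exact: mix_catr.
rewrite cat_cons mix_cons !mem_cat in_nil orbF.
case/orP => /mapP[z1 z1in zE]; rewrite zE /= ltnS in zm *.
  have [z1' z1'in le] := IH z1 x (b :: y) p zm yx z1in.
  exists (c :: z1'); last by rewrite lex_cons.
  exact: mix_consr.
case: x yx z1in => [|b0 x] yx z1in; first by rewrite lexis0 in yx.
move: yx; rewrite lexi_cons => /andP[bb0 yx].
have [lt|ge] := ltP b b0.
  exists (b0 :: (x ++ ((c :: p) ++ b :: y))).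
    exact/mix_consl/mix_catl.
  by rewrite lexi_cons (ltW lt) leNgt lt.
have {ge bb0} E : b0 = b by apply: le_anti; rewrite ge bb0.
subst b0; rewrite lexx /= in yx.
have [|z1' z1'in le] := IH z1 x y ((c :: p) ++ [:: b]) zm yx.
  by rewrite -catA.
exists (b :: z1'); last by rewrite lex_cons.
by apply: mix_consl; rewrite -catA in z1'in.
Qed.

(** A shuffle that begins with the first letter of [v] either begins with a letter smaller than that
    of [u], or with the same one; then [shuffle_swap] bounds it by a shuffle that takes this letter
    from [u]. *)
Lemma shuffle_le_cat u v t :
  (forall r s, u = r ++ s -> s != [::] -> v <=l s) ->
  t \in u sh v -> t <=l u ++ v.
Proof.
elim: u t => [|a u IH] t vu; first by rewrite mix_nill inE => /eqP ->.
have {}IH t' : t' \in u sh v -> t' <=l u ++ v.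
  by apply: IH => r s uE; apply: (vu (a :: r)); rewrite uE.
case: v vu IH => [|b v] vu IH; first by rewrite mix_nilr inE cats0 => /eqP ->.
rewrite mix_cons !mem_cat in_nil orbF => /orP[] /mapP[t' t'in ->].
  by rewrite cat_cons lex_cons; exact: IH.
have := vu [::] (a :: u) erefl isT; rewrite lexi_cons => /andP[ba vu'].
have [lt|ge] := ltP b a; first by rewrite lexi_cons (ltW lt) leNgt lt.
have {ge ba} E : a = b by apply: le_anti; rewrite ge ba.
subst b; rewrite lexx /= in vu'.
have [t'' t''in le] := shuffle_swap (p := [:: a]) vu' t'in.
by rewrite cat_cons lex_cons; exact: le_trans le (IH _ t''in).
Qed.

(** The minimal nonempty suffix [v] is proper because [w] is not Lyndon, and it satisfies the
    hypothesis of [shuffle_le_cat]. *)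
Lemma not_lyndon_shuffle w : w != [::] -> ~ lyndon w ->
  exists u v, [/\ w = u ++ v, u != [::], v != [::] &
    forall t, t \in u sh v -> t <=l w].
Proof.
move=> w0 nl.
have [m0 [u wE] mmin] := min_suffixP w0; set v := min_suffix w in m0 wE mmin.
have u0 : u != [::].
  apply/negP => /eqP u0; apply: nl; split => // s t stE s0 t0.
  have vw : v = w by rewrite [RHS]wE u0.
  rewrite lt_neqAle -{2}vw (mmin s)// andbT; apply: contra_neq s0 => wt.
  move: (congr1 size stE); rewrite size_cat -wt -[LHS]add0n => /addIn/esym/eqP.
  by rewrite size_eq0 => /eqP.
exists u, v; split => // t tin; rewrite wE; apply: shuffle_le_cat tin.
move=> r s uE s0; rewrite leNgt; apply/negP => sv.
have vs : v <=l s ++ v.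
  by apply: (mmin r); [rewrite catA -uE|case: (s) s0].
(* If [v = s q], cancelling [s] in [v <= s v] gives [q <= v], and minimality gives [v <= q]; then
   [q = v] and [s] is empty. *)
have [/prefixP[q vE]|np] := boolP (prefix s v); last first.
  have := ltx_nprefix v [::] sv np; rewrite cats0 ltNge => /negP; exact.
have q0 : q != [::].
  by apply: contraTneq sv => q0; rewrite vE q0 cats0 ltxx.
move: vs; rewrite {1}vE lex_cat => qv.
have vq : v <=l q by apply: (mmin (u ++ s)); rewrite // -catA -vE.
have E : q = v by apply: lex_anti.
move: (congr1 size vE); rewrite size_cat E -[LHS]add0n => /addIn/esym/eqP.
by rewrite size_eq0 (negbTE s0).
Qed.

End Lyndon.

(** * Commutator calculus *)

Section GroupLemmas.
Variable G : groupType.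
Implicit Types (A B H K X Y : set G) (x y z : G) (i j k : nat).
Local Open Scope group_scope.

Lemma generated_subgroup A : is_subgroup (generated A).
Proof.
split=> [S [[]]//|x y xA yA S SA|x xA S SA].
  by have [[_ SM _] _] := SA; apply: SM; [exact: xA|exact: yA].
by have [[_ _ SV] _] := SA; apply: SV; exact: xA.
Qed.

Lemma generated_sub A : A `<=` generated A.
Proof. exact: sub_gen_smallest. Qed.

Lemma generated_min A X : is_subgroup X -> A `<=` X -> generated A `<=` X.
Proof. exact: smallest_sub. Qed.

Lemma generatedS A B : A `<=` B -> generated A `<=` generated B.
Proof.
move=> AB; apply: generated_min; first exact: generated_subgroup.
exact: subset_trans AB (@generated_sub B).
Qed.

Lemma subgroup_conj X x y : is_subgroup X -> X x -> X y -> X (x ^ y).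
Proof. by case=> _ XM XV Xx Xy; exact: XM (XV _ Xy) (XM _ _ Xx Xy). Qed.

Lemma subgroup_comm X x y : is_subgroup X -> X x -> X y -> X [~ x, y].
Proof.
move=> XG Xx Xy; have [_ XM XV] := XG.
exact: XM (XV _ Xx) (subgroup_conj XG Xx Xy).
Qed.

Lemma Hall_Witt x y z :
  [~ x, y^-1, z] ^ y * [~ y, z^-1, x] ^ z * [~ z, x^-1, y] ^ x = 1.
Proof.
pose a x y z : G := x * z * y ^ x.
suffices{x y z} aux x y z : [~ x, y^-1, z] ^ y = (a x y z)^-1 * (a y z x).
  by rewrite !aux; move: a {aux} => a; rewrite 2!mulgA !mulgK mulVg.
by rewrite /a !commgEl !conjgE !invgM !invgK !mulgA !(mulgK, mulgVK, mulVg, mul1g).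
Qed.

Lemma commMgJ x y z : [~ x * y, z] = [~ x, z] ^ y * [~ y, z].
Proof.
by rewrite !commgEl !conjgE !invgM !mulgA !(mulgK, mulgVK, mulVg, mul1g).
Qed.

Lemma commVgJ x y : [~ x^-1, y] = ([~ x, y]^-1) ^ x^-1.
Proof.
apply: (@mulgI _ ([~ x, y] ^ x^-1)).
by rewrite -commMgJ mulgV comm1g -conjMg mulgV conj1g.
Qed.

Section LowerCentral.
Variable H : set G.
Hypothesis HG : is_subgroup H.

(* The usual indexing, gam 1 = H; also gam 0 = H. *)
Definition gam k := lower_central H k.-1.

Lemma gamS k : gam k.+2 = commutator_subgroup H (gam k.+1). Proof. by []. Qed.

Lemma gam_subgroup k : is_subgroup (gam k).
Proof.
case: k => [|[|k]]//; rewrite gamS.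
exact: generated_subgroup.
Qed.

Lemma gam1 k : gam k 1. Proof. by case: (gam_subgroup k). Qed.
Lemma gamM k x y : gam k x -> gam k y -> gam k (x * y).
Proof. by case: (gam_subgroup k) => _ + _; apply. Qed.
Lemma gamV k x : gam k x -> gam k x^-1.
Proof. by case: (gam_subgroup k) => _ _; apply. Qed.

Lemma gam_comm k x y : H x -> gam k.+1 y -> gam k.+2 [~ x, y].
Proof. by move=> Hx ky; apply: generated_sub; exists x => //; exists y. Qed.

Lemma gam_subH k : gam k `<=` H.
Proof.
elim: k => [//|[//|k] IH]; rewrite gamS.
by apply: generated_min => // _ [x Hx [y /IH Hy <-]]; exact: subgroup_comm.
Qed.

Lemma gam_conj k x h : gam k x -> H h -> gam k (x ^ h).
Proof.
have H0 y z : H y -> H z -> H (y ^ z) by exact: subgroup_conj.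
elim: k x => [|[|k] IH] x; [exact: H0|exact: H0|rewrite gamS => xk hh].
suff : [set x | gam k.+2 (x ^ h)] x by [].
apply: generated_min xk.
  split=> [|y z|y] /=; first by rewrite conj1g; exact: gam1.
    by rewrite conjMg; exact: gamM.
  by rewrite conjVg; exact: gamV.
move=> _ [y Hy [z zk <-]] /=; rewrite conjRg.
by apply: gam_comm; [exact: H0|exact: IH].
Qed.

Lemma gam_dec k : gam k.+1 `<=` gam k.
Proof.
case: k => [//|k]; rewrite gamS; apply: generated_min.
  exact: gam_subgroup.
move=> _ [x Hx [y yk <-]]; rewrite commgEr.
by apply: gamM => //; apply: gam_conj => //; exact: gamV.
Qed.

Lemma gam_le k m : (k <= m)%N -> gam m `<=` gam k.
Proof.
move=> /subnK <-; elim: (m - k)%N => [|d IH]; first by rewrite add0n.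
by rewrite addSn; exact: subset_trans (@gam_dec _) IH.
Qed.

(** The three subgroups argument: for [x = [h, c]], Hall-Witt expresses [[[h, c], y]] through
    commutators to which induction on [i] applies. *)
Lemma gam_comm_add i j x y : (0 < i)%N -> (0 < j)%N ->
  gam i x -> gam j y -> gam (i + j) [~ x, y].
Proof.
case: i j => [|i] [|j]// _ _; elim: i j x y => [|i IH] j x y xi yj.
  exact: gam_comm.
have Hy := gam_subH yj.
suff : [set x | H x /\ gam (i.+2 + j.+1) [~ x, y]] x by case.
move: xi; rewrite gamS; apply: generated_min.
  case: (HG) => H1 HM HV; split=> [|a b [Ha ak] [Hb bk]|a [Ha ak]] /=.
  - by rewrite comm1g; split => //; exact: gam1.
  - split; first exact: HM.
    by rewrite commMgJ; apply: gamM => //; exact: gam_conj.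
  - split; first exact: HV.
    by rewrite commVgJ; apply: gam_conj; [exact: gamV|exact: HV].
move=> _ [h Hh [c ci <-]]; have Hc := gam_subH ci.
case: (HG) => H1 HM HV; split; first exact: subgroup_comm.
have := Hall_Witt h c^-1 y; rewrite invgK => HW.
have k2 : gam (i.+2 + j.+1) ([~ c^-1, y^-1, h] ^ y).
  apply: gam_conj => //; rewrite -invgR; apply: gamV.
  by rewrite addSn; apply: gam_comm => //; apply: IH; exact: gamV.
have k3 : gam (i.+2 + j.+1) ([~ y, h^-1, c^-1] ^ h).
  apply: gam_conj => //; rewrite -invgR; apply: gamV.
  rewrite addSnnS; apply: IH; first exact: gamV.
  by rewrite -invgR; apply: gamV; apply: gam_comm => //; exact: HV.
rewrite -[[~ h, c, y]](conjgKV c); apply: gam_conj => //.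
have -> : [~ h, c, y] ^ c^-1 =
    ([~ c^-1, y^-1, h] ^ y * [~ y, h^-1, c^-1] ^ h)^-1.
  by apply/eqP; rewrite -mulg_eq1 mulgA HW.
by apply: gamV; exact: gamM.
Qed.

(* A subgroup containing gam (i + j + 1) is stable under the operations of the
   graded Lie ring in degree i + j. *)
Section Graded.
Variables (i j : nat) (X : set G).
Hypotheses (i0 : (0 < i)%N) (j0 : (0 < j)%N).
Hypotheses (XG : is_subgroup X) (XK : gam (i + j).+1 `<=` X).

Let XM x y : X x -> X y -> X (x * y). Proof. by case: XG => _ + _; apply. Qed.
Let XV x : X x -> X x^-1. Proof. by case: XG => _ _; apply. Qed.

Lemma graded_conj x h : gam (i + j) x -> H h -> X x -> X (x ^ h).
Proof.
move=> xij Hh Xx; rewrite -[x ^ h](mulVKg x).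
apply: XM => //; apply: XK; rewrite -[x^-1 * _]/[~ x, h] -invgR; apply: gamV.
by case: i i0 xij => // i' _; rewrite !addSn; exact: gam_comm.
Qed.

Lemma graded_conjV x h : gam (i + j) x -> H h -> X (x ^ h) -> X x.
Proof.
move=> xij Hh Xxh; rewrite -(conjgK h x); apply: graded_conj => //.
  exact: gam_conj.
by case: HG => _ _; apply.
Qed.

Lemma graded_left y : gam j y -> is_subgroup [set x | gam i x /\ X [~ x, y]].
Proof.
move=> yj; split=> [|a b [ai aX] [bi bX]|a [ai aX]] /=.
- by rewrite comm1g; split; [exact: gam1|case: XG].
- split; first exact: gamM.
  rewrite commMgJ; apply: XM => //; apply: graded_conj => //.
    exact: gam_comm_add.
  exact: gam_subH bi.
- split; first exact: gamV.
  rewrite commVgJ; apply: graded_conj; last exact: XV.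
    by apply: gamV; exact: gam_comm_add.
  by apply: (gam_subH (k := i)); exact: gamV.
Qed.

End Graded.

Lemma graded_right i j X x : (0 < i)%N -> (0 < j)%N -> is_subgroup X ->
  gam (i + j).+1 `<=` X -> gam i x ->
  is_subgroup [set y | gam j y /\ X [~ x, y]].
Proof.
move=> i0 j0 XG XK xi.
have -> : [set y | gam j y /\ X [~ x, y]] = [set y | gam j y /\ X [~ y, x]].
  case: (XG) => _ _ XV; apply/seteqP; split=> y [yj /XV];
  by rewrite invgR.
by apply: (@graded_left j i X) => //; rewrite addnC.
Qed.

(** The Jacobi identity of the graded Lie ring, from Hall-Witt: the inverses are removed by
    bilinearity and the conjugations by [graded_conj]. *)
Lemma graded_jacobi i j k X x y z : (0 < i)%N -> (0 < j)%N -> (0 < k)%N ->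
  is_subgroup X -> gam (i + j + k).+1 `<=` X ->
  gam i x -> gam j y -> gam k z ->
  X [~ [~ y, z], x] -> X [~ [~ z, x], y] -> X [~ [~ x, y], z].
Proof.
move=> i0 j0 k0 XG XK xi yj zk X1 X2.
have Hx := gam_subH xi; have Hy := gam_subH yj; have Hz := gam_subH zk.
have [H1 HM HV] := HG; have [_ XM XV] := XG.
have jk0 : (0 < j + k)%N by rewrite addn_gt0 j0.
have ki0 : (0 < k + i)%N by rewrite addn_gt0 k0.
have ij0 : (0 < i + j)%N by rewrite addn_gt0 i0.
have XK1 : gam (j + k + i).+1 `<=` X by rewrite addnC addnA.
have XK2 : gam (k + i + j).+1 `<=` X by rewrite -addnA addnC.
(* The preimages of [X] under [[_, x]] and [[_, y^-1]] are again subgroups containing the next term,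
   so bilinearity also applies to the inner commutators. *)
have Y1G := graded_left jk0 i0 XG XK1 xi.
have Y1K : gam (j + k).+1 `<=` [set u | gam (j + k) u /\ X [~ u, x]].
  move=> u uk; split; first exact: gam_dec.
  by apply: XK1; rewrite -addSn; exact: gam_comm_add.
have Y2G := graded_left ki0 j0 XG XK2 (gamV yj).
have Y2K : gam (k + i).+1 `<=` [set u | gam (k + i) u /\ X [~ u, y^-1]].
  move=> u uk; split; first exact: gam_dec.
  by apply: XK2; rewrite -addSn; apply: gam_comm_add => //; exact: gamV.
have gyz : gam (j + k) [~ y^-1, z^-1].
  by apply: gam_comm_add => //; exact: gamV.
have gzx : gam (k + i) [~ z, x^-1] by apply: gam_comm_add => //; exact: gamV.
have T1 : X [~ [~ y^-1, z^-1], x].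
  have Yyz : [set u | gam (j + k) u /\ X [~ u, x]] [~ y, z].
    by split => //; exact: gam_comm_add.
  have [_ _ LV] := graded_left j0 k0 Y1G Y1K zk.
  have [_ Yy] := LV y (conj yj Yyz).
  have [_ _ RV] := graded_right j0 k0 Y1G Y1K (gamV yj).
  by have [_ [_]] := RV z (conj zk Yy).
have T2 : X [~ [~ z, x^-1], y^-1].
  have gzx' : gam (k + i) [~ z, x] by exact: gam_comm_add.
  have [_ _ RV] := graded_right ki0 j0 XG XK2 gzx'.
  have [_ Xzx] := RV y (conj yj X2).
  have [_ _ RV'] := graded_right k0 i0 Y2G Y2K zk.
  by have [_ [_]] := RV' x (conj xi (conj gzx' Xzx)).
have HW := Hall_Witt x y^-1 z; rewrite invgK in HW.
have C1 : X ([~ y^-1, z^-1, x] ^ z).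
  apply: (@graded_conj (j + k) i X) => //.
  exact: gam_comm_add.
have C2 : X ([~ z, x^-1, y^-1] ^ x).
  apply: (@graded_conj (k + i) j X) => //.
  by apply: gam_comm_add => //; exact: gamV.
apply: (graded_conjV ij0 XG XK (h := y^-1)).
- by apply: gam_comm_add => //; exact: gam_comm_add.
- exact: HV.
have -> : [~ x, y, z] ^ y^-1 =
    ([~ y^-1, z^-1, x] ^ z * [~ z, x^-1, y^-1] ^ x)^-1.
  by apply/eqP; rewrite -mulg_eq1 mulgA HW.
by apply: XV; exact: XM.
Qed.

End LowerCentral.

End GroupLemmas.

(** * Lyndon commutators generate the lower central quotients *)

Section LyndonCommutators.
Variables (G : groupType) (n : nat) (x : 'I_n -> G).
Implicit Types (u v w B : seq 'I_n) (N m : nat).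
Local Open Scope group_scope.

Fixpoint lyndon_comm_fuel m w : G :=
  match w, m with
  | [::], _ => 1
  | [:: j], _ => x j
  | _, m'.+1 =>
      [~ lyndon_comm_fuel m' (lfactor w), lyndon_comm_fuel m' (rfactor w)]
  | _, 0 => 1
  end.

Definition lyndon_comm w := lyndon_comm_fuel (size w) w.

Lemma size_factors w : (1 < size w)%N ->
  [/\ (size (lfactor w) + size (rfactor w) = size w)%N,
      (0 < size (lfactor w))%N & (0 < size (rfactor w))%N].
Proof.
move=> /factorP[wE l0 r0 _]; rewrite !lt0n !size_eq0; split => //.
by rewrite [in RHS]wE size_cat.
Qed.

Lemma ltn_lfactor w : (1 < size w)%N -> (size (lfactor w) < size w)%N.
Proof. by move=> /size_factors[<- _ r0]; rewrite -addn1 leq_add2l. Qed.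

Lemma ltn_rfactor w : (1 < size w)%N -> (size (rfactor w) < size w)%N.
Proof. by move=> /size_factors[<- l0 _]; rewrite -add1n leq_add2r. Qed.

Lemma lyndon_commE w : (1 < size w)%N ->
  lyndon_comm w = [~ lyndon_comm (lfactor w), lyndon_comm (rfactor w)].
Proof.
have fuel m w' : (size w' <= m)%N -> lyndon_comm_fuel m w' = lyndon_comm w'.
  rewrite /lyndon_comm.
  have [k] := ubnP (size w'); elim: k w' m => // k IH w' m wk wm.
  case: w' wk wm => [|i [|j w']]; [by case: m|by case: m|].
  case: m => // m wk wm.
  have lW := ltn_lfactor (isT : (1 < size [:: i, j & w'])%N).
  have rW := ltn_rfactor (isT : (1 < size [:: i, j & w'])%N).
  rewrite ltnS in wk.
  have l1 := leq_trans lW wk; have r1 := leq_trans rW wk.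
  have l2 : (size (lfactor [:: i, j & w']) <= m)%N by exact: leq_trans lW wm.
  have r2 : (size (rfactor [:: i, j & w']) <= m)%N by exact: leq_trans rW wm.
  have l3 : (size (lfactor [:: i, j & w']) <= (size w').+1)%N by [].
  have r3 : (size (rfactor [:: i, j & w']) <= (size w').+1)%N by [].
  have step m' : lyndon_comm_fuel m'.+1 [:: i, j & w'] =
      [~ lyndon_comm_fuel m' (lfactor [:: i, j & w']),
         lyndon_comm_fuel m' (rfactor [:: i, j & w'])] by [].
  rewrite -[size [:: i, j & w']]/((size w').+2) !step.
  by rewrite (IH _ _ l1 l2) (IH _ _ r1 r2) (IH _ _ l1 l3) (IH _ _ r1 r3).
move=> s1; have lw := ltn_lfactor s1; have rw := ltn_rfactor s1.
rewrite -(fuel _ _ (leqnn _)); case: w s1 lw rw => [|i [|j w]]// _ lw rw.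
by rewrite -(fuel (size w).+1 (lfactor _))// -(fuel (size w).+1 (rfactor _)).
Qed.

Lemma lyndon_comm1 j : lyndon_comm [:: j] = x j. Proof. by []. Qed.

Let H : set G := generated (range x).

Let HG : is_subgroup H. Proof. exact: generated_subgroup. Qed.

Let Hx j : H (x j). Proof. by apply: generated_sub; exists j. Qed.

Local Notation gam := (gam H).

Lemma lyndon_comm_gam w : w != [::] -> gam (size w) (lyndon_comm w).
Proof.
have [k] := ubnP (size w); elim: k w => // k IH w wk w0.
case: (leqP (size w) 1) => s1.
  by case: w s1 w0 wk => [|j []]// _ _ _; exact: Hx.
have [sE l0 r0] := size_factors s1.
rewrite lyndon_commE// -sE; apply: gam_comm_add => //.
  by apply: IH; [lia|rewrite -size_eq0 -lt0n].
by apply: IH; [lia|rewrite -size_eq0 -lt0n].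
Qed.

(** The bound [B] on the words is the parameter of the inner induction in [lyndon_comm_rewrite]. *)
Definition lyndon_span N B := generated (
  [set lyndon_comm w | w in [set w | [/\ lyndon w, size w = N & w <l B]]] `|`
  gam N.+1).

Lemma lyndon_span_subgroup N B : is_subgroup (lyndon_span N B).
Proof. exact: generated_subgroup. Qed.

Lemma lyndon_span_gam N B : gam N.+1 `<=` lyndon_span N B.
Proof. by move=> y yN; apply: generated_sub; right. Qed.

Lemma lyndon_span_comm N B w :
  lyndon w -> size w = N -> w <l B -> lyndon_span N B (lyndon_comm w).
Proof. by move=> wl wN wB; apply: generated_sub; left; exists w. Qed.

Lemma lyndon_spanS N B B' :
  B <=l B' -> lyndon_span N B `<=` lyndon_span N B'.
Proof.
move=> BB; apply: generatedS => y [[w [wl wN wB] <-]|yN]; last by right.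
by left; exists w => //; split => //; exact: lt_le_trans wB BB.
Qed.

(** Turns the lexicographic order, restricted to words of length at most [N], into an induction on
    natural numbers. *)
Definition rank N B := count (fun w => w <l B) (words n N).

Lemma ltn_rank N B B' : (size B <= N)%N -> B <l B' -> (rank N B < rank N B')%N.
Proof.
move=> BN BB.
have Bin : B \in words n N by rewrite mem_words.
rewrite /rank; elim: (words n N) Bin => // w s IH; rewrite inE /=.
have le : (count (fun w => w <l B) s <= count (fun w => w <l B') s)%N.
  by apply: sub_count => v /lt_trans; apply.
have [<- _|_ /= Bs] := eqVneq B w; first by rewrite ltxx BB.
have h : (w <l B) ==> (w <l B') by apply/implyP => /lt_trans; apply.
by have := IH Bs; move: h; case: (w <l B); case: (w <l B') => //= _; lia.
Qed.

(* The rewriting of brackets in the Lyndon basis, carried out in the group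
   modulo the next term of the lower central series: if the factorization u.v
   is not standard, then apply the Jacobi identity to u = u'u''. *)
Lemma lyndon_comm_rewrite N B u v : lyndon u -> lyndon v ->
  (size u + size v = N)%N -> (size B <= N)%N -> u <=l B -> v <=l B ->
  lyndon_span N B [~ lyndon_comm u, lyndon_comm v].
Proof.
(* Outer induction on the degree, inner induction on the bound: [inner] settles two arguments below
   [B], so that [main] only meets brackets whose larger argument is [B]. *)
have [M] := ubnP N; elim: M N B u v => // M IHN N B u v NM.
have [r] := ubnP (rank N B); elim: r B u v => // r IHB B u v Br ul vl uvN BN uB vB.
rewrite ltnS in Br.
have S1 : lyndon_span N B 1 by case: (lyndon_span_subgroup N B).
have SV y : lyndon_span N B y -> lyndon_span N B y^-1.
  by case: (lyndon_span_subgroup N B) => _ _; apply.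
have pos w : lyndon w -> (0 < size w)%N by case=> w0 _; rewrite lt0n size_eq0.
have inner w w' : lyndon w -> lyndon w' -> (size w + size w' = N)%N ->
    w <l B -> w' <l B -> lyndon_span N B [~ lyndon_comm w, lyndon_comm w'].
  move=> wl w'l ww'N wB w'B.
  have wN : (size w <= N)%N by rewrite -ww'N leq_addr.
  have w'N : (size w' <= N)%N by rewrite -ww'N leq_addl.
  have [ww'|w'w] := leP (w : seqlexi 'I_n) w'.
    apply: (lyndon_spanS (ltW w'B)); apply: IHB => //.
    exact: leq_trans (ltn_rank w'N w'B) Br.
  apply: (lyndon_spanS (ltW wB)); apply: IHB => //; [|exact: ltW].
  exact: leq_trans (ltn_rank wN wB) Br.
have main w w' : lyndon w -> lyndon w' -> (size w + size w' = N)%N ->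
    w <l w' -> w' = B -> lyndon_span N B [~ lyndon_comm w, lyndon_comm w'].
  move=> {u v ul vl uvN uB vB}; move: w w' => u v ul vl uvN uv vB.
  have [std|] := pselect ((1 < size u)%N -> v <=l rfactor u).
    have [rE lE] := factor_cat ul vl uv std.
    have s1 : (1 < size (u ++ v))%N.
      by rewrite size_cat; have := pos _ ul; have := pos _ vl; lia.
    rewrite -{1}lE -{2}rE -lyndon_commE//; apply: lyndon_span_comm.
    - exact: lyndon_cat.
    - by rewrite size_cat.
    - have [_ h] := lyndon_cat ul vl uv; rewrite -vB; apply: (h u v) => //.
        by case: ul.
      by case: vl.
  move=> /not_implyP[s1 /negP]; rewrite -ltNge => ru.
  have [l1 r1 lr] := lyndon_factor ul s1.
  have [sE _ _] := size_factors s1.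
  rewrite (lyndon_commE s1); set u1 := lfactor u in l1 lr sE *.
  set u2 := rfactor u in r1 lr ru sE *.
  have p1 := pos _ l1; have p2 := pos _ r1; have pv := pos _ vl.
  have g w : lyndon w -> gam (size w) (lyndon_comm w).
    by case=> w0 _; exact: lyndon_comm_gam.
  have u1B : u1 <l B by rewrite -vB; exact: lt_trans lr ru.
  have u2B : u2 <l B by rewrite -vB.
  have NE : (size u1 + size u2 + size v = N)%N by rewrite sE.
  have XG := lyndon_span_subgroup N B.
  have XK := @lyndon_span_gam N B.
  (* By the outer induction [[a, v]] is a product of Lyndon commutators on words below [B], up to
     the next term; by linearity [inner] treats the bracket of each with [b]. *)
  have step a b : lyndon a -> lyndon b -> a <l B -> b <l B ->
      (size a + size v + size b = N)%N ->
      lyndon_span N B [~ [~ lyndon_comm a, lyndon_comm v], lyndon_comm b].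
    move=> al bl aB bB abN; have [pa pb] := (pos _ al, pos _ bl).
    have lo : lyndon_span (size a + size v) B [~ lyndon_comm a, lyndon_comm v].
      apply: IHN => //; [lia|by rewrite -vB leq_addl|exact: ltW|].
      by rewrite vB lexx.
    have av0 : (0 < size a + size v)%N by lia.
    have XK' : gam (size a + size v + size b).+1 `<=` lyndon_span N B.
      by rewrite abN.
    have LG := graded_left HG av0 pb XG XK' (g _ bl).
    refine (proj2 (generated_min LG _ lo)) => y [[w [wl wN wB] <-]|yN].
      split; first by rewrite -wN; exact: g.
      by apply: inner => //; rewrite wN.
    split; first exact: gam_dec.
    by apply: XK'; rewrite -addSn; apply: gam_comm_add => //; exact: g.
  apply: (graded_jacobi HG p1 p2 pv XG); rewrite ?NE//; [exact: g|exact: g|exact: g| |].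
    by apply: step => //; lia.
  rewrite -[[~ lyndon_comm v, lyndon_comm u1]]invgR.
  have XK' : gam (size u1 + size v + size u2).+1 `<=` lyndon_span N B.
    by rewrite -addnA [(size v + _)%N]addnC addnA NE.
  have uv0 : (0 < size u1 + size v)%N by lia.
  have [_ _ LV] := graded_left HG uv0 p2 XG XK' (g _ r1).
  refine (proj2 (LV _ (conj _ _))).
    by apply: gam_comm_add => //; exact: g.
  by apply: step => //; lia.
have [uB'|uB'] := eqVneq u B.
  have [vB'|vB'] := eqVneq v B; first by rewrite uB' vB' commgg.
  rewrite -invgR; apply: SV; apply: main => //; first by rewrite addnC.
  by rewrite uB' lt_neqAle vB' vB.
have [vB'|vB'] := eqVneq v B.
  by apply: main => //; rewrite vB' lt_neqAle uB' uB.
by apply: inner => //; rewrite lt_neqAle ?uB' ?vB'.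
Qed.

(** By bilinearity a commutator in degree [N.+1] reduces to one of a letter with a Lyndon
    commutator, which [lyndon_comm_rewrite] handles since letters are Lyndon words. *)
Lemma gam_lyndon N : (0 < N)%N -> gam N `<=` generated (
  [set lyndon_comm w | w in [set w | lyndon w /\ size w = N]] `|` gam N.+1).
Proof.
case: N => // N _; elim: N => [|N IH].
  apply: generated_min; first exact: generated_subgroup.
  move=> _ [j _ <-]; apply: generated_sub; left; exists [:: j] => //.
  by split => //; exact: lyndon1.
set X := generated _.
have XG : is_subgroup X by exact: generated_subgroup.
have XK : gam N.+3 `<=` X by move=> y yN; apply: generated_sub; right.
rewrite gamS; apply: generated_min => // _ [h Hh [y yN <-]].
have RG := graded_right HG (ltn0Sn 0) (ltn0Sn N) XG XK Hh.
refine (proj2 (generated_min RG _ (IH y yN))) => {y yN} y [[w [wl wN] <-]|yN].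
  have gw : gam N.+1 (lyndon_comm w).
    by rewrite -wN; apply: lyndon_comm_gam; case: wl.
  split => //.
  have LG := graded_left HG (ltn0Sn 0) (ltn0Sn N) XG XK gw.
  refine (proj2 (generated_min LG _ Hh)) => _ [j _ <-]; split; first exact: Hx.
  have sub B : lyndon_span N.+2 B `<=` X.
    apply: generatedS => z [[v [vl vN _] <-]|zN]; last by right.
    by left; exists v.
  rewrite -lyndon_comm1; have [le|lt] := leP ([:: j] : seqlexi 'I_n) w.
    apply: (sub w); apply: lyndon_comm_rewrite => //; rewrite ?wN//.
    exact: lyndon1.
  apply: (sub [:: j]); apply: lyndon_comm_rewrite => //; rewrite ?wN//.
  - exact: lyndon1.
  - exact: ltW.
split; first exact: gam_dec.
by apply: XK; exact: gam_comm.
Qed.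

End LyndonCommutators.

(** * Magnus expansions *)

Section LeadingTerms.
Variables (R : realType) (n : nat).
Local Notation afr := (ncseries R n).
Implicit Types (a b : afr) (g h c : series1 R n) (u v w : seq 'I_n).
Implicit Types (i j k N : nat).

Lemma ncM_eqlt0 i j a b : eqlt i a 0 -> eqlt j b 0 -> eqlt (i + j) (a * b) 0.
Proof.
move=> ai bj w wij; rewrite ncME big1// => t _.
have [ti|it] := ltnP t i.
  by rewrite ai ?mul0r// size_take_min (leq_ltn_trans _ ti)// geq_minl.
by rewrite bj ?mulr0// size_drop; have := ltn_ord t; lia.
Qed.

Lemma ncM_lead i j a b w : eqlt i a 0 -> eqlt j b 0 -> size w = (i + j)%N ->
  (a * b) w = a (take i w) * b (drop i w).
Proof.
move=> ai bj wij; have iw : (i < (size w).+1)%N by rewrite wij ltnS leq_addr.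
rewrite ncME (bigD1 (Ordinal iw))//= big1 ?addr0// => t.
rewrite -val_eqE /= neq_ltn => /orP[ti|it].
  by rewrite ai ?mul0r// size_take_min (leq_ltn_trans _ ti)// geq_minl.
by rewrite bj ?mulr0// size_drop; have := ltn_ord t; lia.
Qed.

Definition order_ge k : set (series1 R n) := [set g | eqlt k (val g) 1].

Lemma order_ge_sub k g : order_ge k g <-> eqlt k (val g - 1) 0.
Proof.
split=> gk w wk; first by rewrite ncBE gk// subrr.
by apply/eqP; rewrite -subr_eq0 -ncBE gk.
Qed.

Lemma order_ge_subgroup k : is_subgroup (order_ge k).
Proof.
by split=> [//|g h gk hk|g gk]; [exact: eqlt_mul1|exact: eqlt_inv1].
Qed.

Lemma order_geW k m : (k <= m)%N -> order_ge m `<=` order_ge k.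
Proof. by move=> km g; exact: eqltW. Qed.

Lemma order_ge1 g : order_ge 1 g.
Proof. by case=> // _; rewrite series1_nil. Qed.

Lemma sub1_coef g w : w != [::] -> (val g - 1) w = val g w.
Proof. by case: w => // j w _; rewrite ncBE nc1E subr0. Qed.

Lemma order_geS k g : order_ge k g -> (0 < k)%N ->
  (forall w, size w = k -> val g w = 0) -> order_ge k.+1 g.
Proof.
move=> gk k0 g0 w; rewrite ltnS leq_eqVlt => /orP[/eqP wk|]; last exact: gk.
by rewrite g0// nc1E; case: w wk k0 => // <-.
Qed.

Lemma coefM_lead N g h w : order_ge N g -> order_ge N h -> (0 < N)%N ->
  size w = N -> val (g * h)%g w = val g w + val h w.
Proof.
move=> /order_ge_sub gN /order_ge_sub hN N0 wN.
have w0 : w != [::] by rewrite -size_eq0 wN -lt0n.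
have E (x : series1 R n) : val x = 1 + (val x - 1) :> afr by rewrite addrC subrK.
rewrite val_mul1 -(sub1_coef g w0) -(sub1_coef h w0) {1}(E g) {1}(E h).
move: (val g - 1) (val h - 1) gN hN => a b aN bN.
rewrite mulrDl mul1r mulrDr mulr1 !ncaddE (ncM_eqlt0 aN bN) ?nc0E; last first.
  by rewrite wN; lia.
by rewrite nc1E (negbTE w0) add0r addr0 addrC.
Qed.

Lemma coefV_lead N g w : order_ge N g -> (0 < N)%N -> size w = N ->
  val g^-1%g w = - val g w.
Proof.
move=> gN N0 wN; apply/eqP; rewrite -addr_eq0 -(@coefM_lead N)//.
  by rewrite mulVg val_one1 nc1E -size_eq0 wN eqn0Ngt N0.
by case: (order_ge_subgroup N) => _ _; apply.
Qed.

Lemma coefX_lead N g k w : order_ge N g -> (0 < N)%N -> size w = N ->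
  val (g ^+ k)%g w = k%:R * val g w.
Proof.
move=> gN N0 wN; have [g1 gM _] := order_ge_subgroup N.
elim: k => [|k IH].
  by rewrite expg0 val_one1 nc1E -size_eq0 wN eqn0Ngt N0 mul0r.
have gk : order_ge N (g ^+ k)%g.
  by elim: (k) => [|m IHm]; rewrite ?expg0// expgS; exact: gM.
by rewrite expgS (@coefM_lead N)// IH -natr1 mulrDl mul1r addrC.
Qed.

(** One has [[g, h] - 1 = (h g)^-1 (g h - h g)], and [(h g)^-1] has constant term 1. *)
Lemma comm_lead i j g h : order_ge i g -> order_ge j h -> eqlt (i + j).+1
  (val [~ g, h]%g - 1)
  ((val g - 1) * (val h - 1) - (val h - 1) * (val g - 1)).
Proof.
move=> /order_ge_sub gi /order_ge_sub hj.
set d := _ - _ * (_ - 1).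
have d0 : eqlt (i + j) d 0.
  rewrite -(subrr 0); apply: eqltD; first exact: ncM_eqlt0.
  by apply: eqltN; rewrite addnC; exact: ncM_eqlt0.
pose k := (h * g)^-1%g.
have E : val [~ g, h]%g - 1 = d + (val k - 1) * d.
  rewrite mulrBl mul1r [RHS]addrC subrK /d -comm_series1 -!val_mul1 mulrBr.
  by rewrite -!val_mul1 /k mulVg; congr (val _ - _); rewrite (commgC g h) mulKg.
rewrite E -[X in eqlt _ _ X]addr0; apply: eqltD => //.
rewrite -add1n; apply: ncM_eqlt0 => //.
by apply/order_ge_sub; exact: order_ge1.
Qed.

Lemma comm_order_ge i j g h :
  order_ge i g -> order_ge j h -> order_ge (i + j) [~ g, h]%g.
Proof.
move=> gi hj; apply/order_ge_sub; apply: eqlt_trans.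
  exact: eqltW (comm_lead gi hj).
move/order_ge_sub in gi; move/order_ge_sub in hj.
rewrite -(subrr 0); apply: eqltD; first exact: ncM_eqlt0.
by apply: eqltN; rewrite addnC; exact: ncM_eqlt0.
Qed.

Lemma coef_comm_lead i j g h w : order_ge i g -> order_ge j h ->
  (0 < i)%N -> (0 < j)%N -> size w = (i + j)%N ->
  val [~ g, h]%g w = val g (take i w) * val h (drop i w) -
                     val h (take j w) * val g (drop j w).
Proof.
move=> gi hj i0 j0 wij.
have ne (s : seq 'I_n) : (0 < size s)%N -> s != [::] by rewrite -size_eq0 -lt0n.
rewrite -sub1_coef; last by apply: ne; rewrite wij addn_gt0 i0.
rewrite (comm_lead gi hj) ?wij// ncBE.
move/order_ge_sub in gi; move/order_ge_sub in hj.
rewrite (ncM_lead gi hj)// (ncM_lead hj gi) 1?addnC// !sub1_coef//;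
  by apply: ne; rewrite ?size_drop ?size_take_min wij; lia.
Qed.

End LeadingTerms.

Section FreeSubgroup.
Variables (R : realType) (n : nat).
Implicit Types (g h c y z : series1 R n) (u v w t : seq 'I_n) (i j k N : nat).

Local Notation F := (free_subgroup R n).
Local Notation gam := (gam F).
Local Notation circ := (Fr_circ (@mixcop R n true)).
Local Notation integral := (integral_series R n).
Local Notation lc := (lyndon_comm (@magnus_gen R n)).

Lemma free_subgroupG : is_subgroup F. Proof. exact: generated_subgroup. Qed.

Lemma free_subgroup_circ : F `<=` circ.
Proof.
apply: generated_min; first exact: Fr_circ_subgroup.
move=> _ [j _ <-]; rewrite /Fr_circ /= rmorphD rmorph1 /= mixcop_var.
by rewrite mixcop_gen_trueE addrC subrK.
Qed.

Lemma integral_subgroup : is_subgroup integral.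
Proof.
have IM (a b : ncseries R n) : (forall w, a w \is a Num.int) ->
    (forall w, b w \is a Num.int) -> forall w, (a * b) w \is a Num.int.
  by move=> ai bi w; rewrite ncME; apply: rpred_sum => i _; exact: rpredM.
have I1 w : (1 : ncseries R n) w \is a Num.int by rewrite nc1E rpred_nat.
split=> [w|g h gi hi w|g gi w].
- exact: I1.
- exact: IM.
have X m v : ((1 - val g) ^+ m) v \is a Num.int.
  elim: m v => [|m IH] v; first exact: I1.
  rewrite exprS; apply: IM => // t.
  by rewrite ncBE; apply: rpredB; [exact: I1|exact: gi].
by rewrite val_inv1 /ncinv ncsumA; apply: rpred_sum.
Qed.

Lemma free_subgroup_integral : F `<=` integral.
Proof.
apply: generated_min; first exact: integral_subgroup.
move=> _ [j _ <-] w; rewrite /= ncaddE nc1E /ncvar.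
by apply: rpredD; exact: rpred_nat.
Qed.

Lemma gam_order_ge N : gam N `<=` order_ge N.
Proof.
elim: N => [//|[_ g _|N IH]]; first exact: order_ge1.
rewrite gamS; apply: generated_min; first exact: order_ge_subgroup.
move=> _ [g _ [h /IH hN <-]]; rewrite -[N.+2]add1n.
exact: comm_order_ge (@order_ge1 _ _ g) hN.
Qed.

Lemma lyndon_comm_order_ge w : lyndon w -> order_ge (size w) (lc w).
Proof. by case=> w0 _; apply/gam_order_ge/lyndon_comm_gam. Qed.

Lemma lyndon_comm_lead w : lyndon w -> val (lc w) w = 1 /\
  forall t, size t = size w -> t <l w -> val (lc w) t = 0.
Proof.
have [k] := ubnP (size w); elim: k w => // k IH w wk wl.
have [s1|s1] := leqP (size w) 1.
  case: w s1 wl {wk} => [|j []]//; first by move=> _ [].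
  move=> _ _; rewrite lyndon_comm1; split.
    by rewrite /= ncaddE nc1E add0r /ncvar eqxx.
  move=> t t1 lt; rewrite /= ncaddE nc1E /ncvar.
  have -> : (t == [::]) = false by case: t t1 {lt}.
  by rewrite (lt_eqF lt) addr0.
have [ul vl uv] := lyndon_factor wl s1.
have [wE u0 v0 _] := factorP s1; have [sE pu pv] := size_factors s1.
have lcE := lyndon_commE (@magnus_gen R n) s1.
move: (lfactor w) (rfactor w) ul vl uv wE u0 v0 sE pu pv lcE.
move=> u v ul vl uv wE u0 v0 sE pu pv lcE.
have [] := IH u _ ul; first by move: wk; rewrite -sE; lia.
move=> uu ult; have [] := IH v _ vl; first by move: wk; rewrite -sE; lia.
move=> vv vlt.
(* The second product in the commutator leads with [v ++ u], which exceeds [w]; so up to [w] only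
   the first product contributes. *)
have wvu : w <l v ++ u.
  rewrite -[X in X <l _]cats0; apply: ltx_nprefix.
    exact: (proj2 wl u v wE u0 v0).
  apply/negP => /prefixP[r vE].
  have : (size w <= size v)%N by rewrite vE size_cat leq_addr.
  by rewrite -sE leqNgt -{1}(add0n (size v)) ltn_add2r pu.
have lead t : size t = size w -> t <=l w -> val (lc w) t =
    val (lc u) (take (size u) t) * val (lc v) (drop (size u) t).
  move=> tw le; rewrite lcE.
  rewrite (coef_comm_lead (lyndon_comm_order_ge ul) (lyndon_comm_order_ge vl))//;
    last by rewrite tw sE.
  suff -> : val (lc v) (take (size v) t) * val (lc u) (drop (size v) t) = 0.
    by rewrite subr0.
  have tvu : t <l v ++ u := le_lt_trans le wvu.
  have st : size (take (size v) t) = size v by rewrite size_takel// tw -sE; lia.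
  have sd : size (drop (size v) t) = size u by rewrite size_drop tw -sE; lia.
  have [lt|] := boolP (take (size v) t <l v); first by rewrite vlt// mul0r.
  rewrite -leNgt => ge; have E : take (size v) t = v.
    apply: lex_anti => //; rewrite leNgt; apply/negP => lt.
    have := ltx_size u (drop (size v) t) (esym st) lt.
    by rewrite cat_take_drop ltNge (ltW tvu).
  rewrite ult ?mulr0//.
  by move: tvu; rewrite -{1}(cat_take_drop (size v) t) E ltx_cat.
split=> [|t tw lt].
  rewrite lead// wE take_size_cat// drop_size_cat//.
  by rewrite uu vv mulr1.
rewrite lead//; last exact: ltW.
have st : size (take (size u) t) = size u by rewrite size_takel// tw -sE; lia.
have sd : size (drop (size u) t) = size v by rewrite size_drop tw -sE; lia.
have [lt'|] := boolP (take (size u) t <l u); first by rewrite ult// mul0r.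
rewrite -leNgt => ge; have E : take (size u) t = u.
  apply: lex_anti => //; rewrite leNgt; apply/negP => lt'.
  have := ltx_size v (drop (size u) t) (esym st) lt'.
  by rewrite cat_take_drop -wE ltNge (ltW lt).
rewrite vlt ?mulr0//.
by move: lt; rewrite -{1}(cat_take_drop (size u) t) E wE ltx_cat.
Qed.

Lemma size_mix e u v t : t \in mix e u v -> (size t <= size u + size v)%N.
Proof.
elim: u v t => [|i u IHu] v t; first by rewrite mix_nill inE => /eqP ->.
elim: v t => [|j v IHv] t; first by rewrite mix_nilr inE => /eqP ->; rewrite addn0.
rewrite mix_cons !mem_cat => /or3P[/mapP[s sin ->]|/mapP[s sin ->]|] /=.
- exact: IHu sin.
- by rewrite addnS ltnS; exact: IHv.
- by case: ifP => // _ /mapP[s sin ->] /=; have := IHu _ _ sin; lia.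
Qed.

(** Infiltrations that are not shuffles identify letters, so they are nonempty and shorter than
    [size u + size v]. *)
Lemma mixcop_shuffle (f : ncseries R n) u v :
  (forall w, (0 < size w < size u + size v)%N -> f w = 0) ->
  mixcop true f u v = mixcop false f u v.
Proof.
elim: u v f => [|i u IHu] v f; first by rewrite !mixcop_nill.
elim: v f => [|j v IHv] f f0; first by rewrite !mixcop_nilr.
have E3 : mixcop true (ncshift i f) u v = 0.
  by rewrite /mixcop big_seq big1// => t /size_mix ts; rewrite /ncshift f0//=; lia.
rewrite mixcop_cons E3 mulr0 addr0 mixcop_cons.
rewrite [(false && _)%:R * _]mul0r addr0; congr (_ + _).
  by apply: IHu => w wl; apply: f0 => /=; move: wl => /=; lia.
by apply: IHv => w wl; apply: f0 => /=; move: wl => /=; lia.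
Qed.

(** On the grouplike side the product of coefficients vanishes, because [u] is nonempty and shorter
    than [N]. *)
Lemma shuffle_relation N g u v : circ g -> order_ge N g -> u != [::] ->
  v != [::] -> (size u + size v = N)%N -> \sum_(t <- mix false u v) val g t = 0.
Proof.
move=> gc gN u0 v0 uv.
have pos (s : seq 'I_n) : s != [::] -> (0 < size s)%N by rewrite -size_eq0 -lt0n.
have low w : (0 < size w < N)%N -> val g w = 0.
  by case/andP=> w0 wN; rewrite gN// nc1E -size_eq0 eqn0Ngt w0.
rewrite -[LHS]/(mixcop false (val g) u v) -mixcop_shuffle; last first.
  by move=> w; rewrite uv; exact: low.
rewrite (congr1 (fun H : afr2 R n => H u v) gc) /tens (low u) ?mul0r//.
by rewrite pos//= -uv; have := pos v v0; lia.
Qed.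

Lemma integral_expr (r : R) : r \is a Num.int -> exists i j, r = i%:R - j%:R.
Proof.
move=> /intrP[m ->]; case: m => k; first by exists k, 0; rewrite subr0.
by exists 0, k.+1; rewrite NegzE mulrNz sub0r.
Qed.

Lemma rank_inj N v w : size v = N -> size w = N -> rank N v = rank N w -> v = w.
Proof.
move=> vN wN vw; apply: lex_anti; rewrite leNgt; apply/negP => lt.
  by have := ltn_rank (_ : (size w <= N)%N) lt; rewrite wN vw ltnn => /(_ (leqnn _)).
by have := ltn_rank (_ : (size v <= N)%N) lt; rewrite vN vw ltnn => /(_ (leqnn _)).
Qed.

(* The words of length N are eliminated in increasing order: the coefficients
   of non-Lyndon words vanish by a shuffle relation. *)
Lemma lead_approx N g : (0 < N)%N -> circ g -> integral g -> order_ge N g ->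
  exists2 y, gam N y & order_ge N.+1 (y^-1 * g)%g.
Proof.
move=> N0 gc gi gN.
have [c1 cM cV] := @Fr_circ_subgroup R n; have [i1 iM iV] := integral_subgroup.
have [e1 oM oV] := @order_ge_subgroup R n N.
have FG := free_subgroupG.
suff step r : exists2 y, gam N y & forall w, size w = N -> (rank N w < r)%N ->
    val (y^-1 * g)%g w = 0.
  have [y yN y0] := step (size (words n N)).+1; exists y => //.
  apply: order_geS => //; first by apply: oM => //; apply: oV; exact: gam_order_ge.
  by move=> w wN; apply: y0 => //; rewrite ltnS; exact: count_size.
elim: r => [|r [y yN y0]]; first by exists 1%g => //; exact: gam1.
have yF := gam_subH FG yN.
set g' := (y^-1 * g)%g in y0.
have g'c : circ g' by apply: cM => //; apply: cV; exact: free_subgroup_circ.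
have g'i : integral g' by apply: iM => //; apply: iV; exact: free_subgroup_integral.
have g'N : order_ge N g' by apply: oM => //; apply: oV; exact: gam_order_ge.
have [[w [wN wr]]|nw] := pselect (exists w, size w = N /\ rank N w = r); last first.
  exists y => // w wN; rewrite ltnS leq_eqVlt => /orP[/eqP wr|]; last exact: y0.
  by case: nw; exists w.
have below t : size t = N -> t <l w -> val g' t = 0.
  by move=> tN tw; apply: y0 => //; rewrite -wr; apply: ltn_rank => //; rewrite tN.
have uniqw t : size t = N -> (rank N t < r.+1)%N -> t = w \/ t <l w.
  move=> tN; rewrite ltnS leq_eqVlt => /orP[/eqP tr|tr].
    by left; apply: (@rank_inj N) => //; rewrite tr.
  right; rewrite ltNge; apply/negP => wt; move: tr; rewrite -wr ltnNge.
  apply/negP/negPn; move: wt; rewrite le_eqVlt => /orP[/eqP ->//|lt].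
  by apply: ltnW; apply: ltn_rank => //; rewrite wN.
have [wl|wnl] := pselect (lyndon w); last first.
  exists y => // t tN tr; rewrite -/g'; have [->|] := uniqw t tN tr; last exact: below.
  have w0 : w != [::] by rewrite -size_eq0 wN -lt0n.
  have [u [v [wE u0 v0 mixle]]] := not_lyndon_shuffle w0 wnl.
  have uvN : (size u + size v = N)%N by rewrite -wN wE size_cat.
  have := shuffle_relation g'c g'N u0 v0 uvN.
  (* Shuffles other than [w] are smaller and already have coefficient 0; what remains is a positive
     multiple of the coefficient of [w], since [w = u ++ v] is a shuffle. *)
  have -> : \sum_(t <- mix false u v) val g' t =
      \sum_(t <- mix false u v) (t == w)%:R * val g' w.
    apply: eq_big_seq => s sin; have [->|sw] := eqVneq s w; first by rewrite mul1r.
    rewrite mul0r below//; first by rewrite (size_mix_shuffle sin).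
    by rewrite lt_neqAle sw mixle.
  rewrite -mulr_suml => /eqP; rewrite mulf_eq0 => /orP[|/eqP//].
  rewrite -natr_sum pnatr_eq0 sum_nat_seq_eq0 => /allP/(_ w).
  by rewrite {1}wE mix_catl eqxx => /(_ isT).
(* The coefficient of [w] becomes the exponent [i - j] of the Lyndon commutator, which changes no
   smaller word. *)
have [i [j ij]] := integral_expr (g'i w).
pose c := (lc w ^+ i * (lc w ^+ j)^-1)%g.
have lN : order_ge N (lc w) by rewrite -wN; exact: lyndon_comm_order_ge.
have gl : gam N (lc w) by rewrite -wN; apply: lyndon_comm_gam; case: wl.
have gX k : gam N (lc w ^+ k)%g.
  by elim: k => [|k IH]; rewrite ?expg0 ?expgS; [exact: gam1|exact: gamM].
have gc' : gam N c by apply: gamM => //; exact: gamV.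
have cN : order_ge N c by exact: gam_order_ge.
have cE t : size t = N -> val c t = (i%:R - j%:R) * val (lc w) t.
  move=> tN; rewrite (@coefM_lead _ _ N)//; [|exact: gam_order_ge|].
    rewrite (@coefV_lead _ _ N)//; last exact: gam_order_ge.
    by rewrite !(@coefX_lead _ _ N)// mulrBl.
  by apply: oV; exact: gam_order_ge.
exists (y * c)%g; first exact: gamM.
move=> t tN tr; rewrite invgM -mulgA -/g' (@coefM_lead _ _ N)//; last exact: oV.
rewrite (@coefV_lead _ _ N)// cE// -ij.
have [w1 wlt] := lyndon_comm_lead wl.
have [->|lt] := uniqw t tN tr; first by rewrite w1 mulr1 addNr.
by rewrite wlt ?wN// mulr0 oppr0 add0r below.
Qed.

End FreeSubgroup.

(** * Density of the free group and the order of its elements *)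

Section Magnus.
Variables (R : realType) (n : nat).
Implicit Types (g h c y z : series1 R n) (u v w t : seq 'I_n) (i j k N r : nat).

Local Notation F := (free_subgroup R n).
Local Notation gam := (gam F).
Local Notation circ := (Fr_circ (@mixcop R n true)).
Local Notation integral := (integral_series R n).
Local Notation lc := (lyndon_comm (@magnus_gen R n)).

Lemma order_ge_quot k g h : order_ge k (g^-1 * h)%g <-> eqlt k (val g) (val h).
Proof.
split=> [gh|gh].
  rewrite -[h](mulVKg g) val_mul1 -[X in eqlt _ X _]mulr1.
  by apply: eqltM => //; exact: eqlt_sym.
apply: (@eqlt_mulVI _ _ k g); rewrite -val_mul1 mulVKg mulr1.
exact: eqlt_sym.
Qed.

Lemma free_subgroup_dense k g : circ g -> integral g ->
  exists2 y, F y & eqlt k (val y) (val g).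
Proof.
move=> gc gi; have FG := free_subgroupG R n; have [F1 FM FV] := FG.
elim: k => [|[|k] [y Fy yg]]; first by exists 1%g.
  by exists 1%g => // -[|//] _; rewrite !series1_nil.
have [c1 cM cV] := @Fr_circ_subgroup R n; have [i1 iM iV] := @integral_subgroup R n.
move/order_ge_quot in yg.
have [|||z zN zg] := @lead_approx R n k.+1 (y^-1 * g)%g _ _ _ yg => //.
- by apply: cM => //; apply: cV; exact: free_subgroup_circ.
- by apply: iM => //; apply: iV; exact: free_subgroup_integral.
exists (y * z)%g; first by apply: FM => //; exact: gam_subH zN.
by apply/order_ge_quot; rewrite invgM -mulgA.
Qed.

Lemma quot_powers_subgroup (G : groupType) (x : G) :
  is_subgroup [set d | exists i j, d = (x ^+ i)^-1 * x ^+ j]%g.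
Proof.
split=> [|_ _ [i [j ->]] [i' [j' ->]]|_ [i [j ->]]].
- by exists 0, 0; rewrite expg0 mulg1 invg1.
- have xx : commute (x ^+ j)%g (x ^+ i')^-1%g.
    by apply/commuteV/commuteX2; exact: commute_refl.
  exists (i' + i)%N, (j + j')%N; rewrite !expgnDr invgM -!mulgA; congr (_ * _)%g.
  by rewrite !mulgA; congr (_ * _)%g; rewrite xx.
by exists j, i; rewrite invgM invgK.
Qed.

Definition lyndon_above N r := generated (
  [set lc w | w in [set w | [/\ lyndon w, size w = N & (r <= rank N w)%N]]] `|`
  gam N.+1).

Lemma lyndon_above_subgroup N r : is_subgroup (lyndon_above N r).
Proof. exact: generated_subgroup. Qed.

(* Modulo lyndon_above N r.+1, the element y is a power of the Lyndon commutator
   of the word w of rank r, and the exponent is the coefficient of w. *)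
Lemma lyndon_above_step N r y : (0 < N)%N -> order_ge N.+1 y ->
  lyndon_above N r y -> lyndon_above N r.+1 y.
Proof.
move=> N0 y0 yr; have FG := free_subgroupG R n; have [F1 FM FV] := FG.
have YG := lyndon_above_subgroup N r.+1; set Y := lyndon_above N r.+1 in YG *.
have [Y1 YM YV] := YG; have YK : gam N.+1 `<=` Y.
  by move=> z zN; apply: generated_sub; right.
have [[w [wl wN wr]]|nw] :=
    pselect (exists w, [/\ lyndon w, size w = N & rank N w = r]); last first.
  apply: (generatedS _ yr) => z [[w [wl wN]]|]; last by right.
  rewrite leq_eqVlt => /orP[/eqP wr|wr] <-; first by case: nw; exists w.
  by left; exists w.
pose D := [set d | exists i j, d = (lc w ^+ i)^-1 * lc w ^+ j]%g.
have DG : is_subgroup D by exact: quot_powers_subgroup.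
have lN : gam N (lc w) by rewrite -wN; apply: lyndon_comm_gam; case: wl.
have lX i : gam N (lc w ^+ i)%g.
  by elim: i => [|i IH]; rewrite ?expg0 ?expgS; [exact: gam1|exact: gamM].
have DN : D `<=` gam N by move=> _ [i [j ->]]; apply: gamM => //; exact: gamV.
have [D1 DM DV] := DG.
(* Commutators of elements of [gam N] lie in [gam (N + N)], hence in [gam N.+1] as [N > 0]; so
   conjugation by [D] does not matter modulo [Y]. *)
have YJ z d : gam N z -> D d -> Y z -> Y (z ^ d)%g.
  move=> zN Dd Yz; rewrite -[(z ^ d)%g](mulVKg z); apply: YM => //; apply: YK.
  apply: (gam_le FG (m := (N + N)%N)); first by lia.
  by rewrite -[X in gam _ X]/[~ z, d]%g; apply: gam_comm_add => //; exact: DN.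
have [d Dd dy] : exists2 d, D d & Y (d * y)%g.
  suff : [set z | gam N z /\ exists2 d, D d & Y (d * z)%g] y by case.
  apply: (generated_min _ _ yr).
    split=> [|z z' [zN [d Dd dz]] [z'N [d' Dd' dz']]|z [zN [d Dd dz]]].
    - split; first exact: gam1.
      by exists 1%g => //; rewrite mulg1.
    - split; first exact: gamM.
      exists (d' * d)%g; first exact: DM.
      have -> : (d' * d * (z * z') = (d * z) ^ d'^-1 * (d' * z'))%g.
        by rewrite conjgE invgK !mulgA mulgVK.
      by apply: YM => //; apply: YJ => //; [apply: gamM => //; exact: DN|exact: DV].
    - split; first exact: gamV.
      exists d^-1%g; first exact: DV.
      have -> : (d^-1 * z^-1 = ((d * z)^-1) ^ d)%g.
        by rewrite conjgE invgM mulgVK.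
      by apply: YJ => //; [apply: gamV => //; apply: gamM => //; exact: DN|exact: YV].
  move=> z [[v [vl vN]]|zN]; last first.
    by split; [exact: gam_dec|exists 1%g => //; rewrite mul1g; exact: YK].
  have gv : gam N (lc v) by rewrite -vN; apply: lyndon_comm_gam; case: vl.
  rewrite leq_eqVlt => /orP[/eqP vr|vr] <-; split => //.
    exists (lc w ^+ 1)^-1%g; first by exists 1%N, 0%N; rewrite expg0 mulg1.
    by rewrite (@rank_inj _ N v w) ?wr// expg1 mulVg.
  by exists 1%g => //; rewrite mul1g; apply: generated_sub; left; exists v.
have [e1 eM eV] := @order_ge_subgroup R n N.
(* By triangularity, words of larger rank contribute nothing at [w]. As [y] contributes nothing
   either, the exponent of [d] must be 0, and then [y] itself lies in [Y]. *)
have Y0 : forall z, Y z -> order_ge N z /\ val z w = 0.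
  suff : Y `<=` [set z | order_ge N z /\ val z w = 0] by apply.
  apply: generated_min.
    split=> [|a b [aN a0] [bN b0]|a [aN a0]].
    - by split; [exact: e1|rewrite val_one1 nc1E -size_eq0 wN eqn0Ngt N0].
    - by split; [exact: eM|rewrite (@coefM_lead _ _ N)// a0 b0 addr0].
    - by split; [exact: eV|rewrite (@coefV_lead _ _ N)// a0 oppr0].
  move=> z [[v [vl vN rv] <-]|/gam_order_ge zN].
    split; first by rewrite -vN; exact: lyndon_comm_order_ge.
    apply: (proj2 (lyndon_comm_lead _ vl)); first by rewrite wN.
    rewrite ltNge; apply/negP; rewrite le_eqVlt => /orP[/eqP vw|vw].
      by move: rv; rewrite vw wr ltnn.
    by have := ltn_rank (_ : (size v <= N)%N) vw; rewrite vN wr => /(_ (leqnn _)); lia.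
  split; first exact: order_geW zN.
  by rewrite zN ?wN// nc1E -size_eq0 wN eqn0Ngt N0.
have lO : order_ge N (lc w) by exact: gam_order_ge.
have lXO i : order_ge N (lc w ^+ i)%g by exact: gam_order_ge.
have [i [j dE]] := Dd.
have /eqP : val (d * y)%g w = 0 by case: (Y0 _ dy).
rewrite (@coefM_lead _ _ N)//; [|exact/gam_order_ge/DN|exact: order_geW y0].
rewrite [val y w]y0 ?wN// nc1E -size_eq0 wN eqn0Ngt N0 addr0 dE.
rewrite (@coefM_lead _ _ N)//; last exact: eV.
rewrite (@coefV_lead _ _ N)// !(@coefX_lead _ _ N)//.
have [-> _] := lyndon_comm_lead R wl.
rewrite !mulr1 addrC subr_eq0 eqr_nat => /eqP ji.
by move: dy; rewrite dE ji mulVg mul1g.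
Qed.

Lemma free_subgroup_order_ge k y : F y -> order_ge k.+1 y ->
  lower_central F k y.
Proof.
move=> Fy; rewrite -[lower_central F k]/(gam k.+1).
have FG := free_subgroupG R n.
elim: k => [//|k IH] yk; have {IH} yN := IH (order_geW (leqnSn _) yk).
have yr r : lyndon_above k.+1 r y.
  elim: r => [|r IHr]; last exact: lyndon_above_step.
  apply: (generatedS _ (gam_lyndon (ltn0Sn k) yN)) => z [[w [wl wN] <-]|]; last by right.
  by left; exists w.
(* No rank exceeds the number of words, so at this bound no Lyndon commutator is left and only
   [gam k.+2] remains. *)
apply: (generated_min _ _ (yr (size (words n k.+1)).+1)).
  exact: gam_subgroup.
move=> z [[w [_ _]]|//].
by rewrite leqNgt ltnS count_size.
Qed.

End Magnus.

(** * The pronilpotent completion *)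

Section Completion.
Variables (R : realType) (n : nat).
Implicit Types (g h x y z : series1 R n) (w : seq 'I_n) (k : nat).

Local Notation F := (free_subgroup R n).
Local Notation circ := (Fr_circ (@mixcop R n true)).
Local Notation integral := (integral_series R n).
Local Notation S := {ptws nat -> discrete_topology (set (series1 R n))}.

Lemma int_near_eq (a b : R) : a \is a Num.int -> b \is a Num.int ->
  `|a - b| < 1 -> a = b.
Proof.
move=> ai bi; apply: contraTeq; rewrite -subr_eq0 -leNgt => ab.
by apply: norm_intr_ge1 => //; exact: rpredB.
Qed.

Lemma near_coef g w (e : R) : 0 < e ->
  \forall h \near g, `|val h w - val g w| < e.
Proof.
move=> e0; have /cvgrPdist_lt/(_ e e0) := @continuous_val_coef R n w g.
by apply: filterS => h; rewrite distrC.
Qed.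

Lemma closure_integral : closure F `<=` integral.
Proof.
move=> g gF w.
have approx (e : R) : 0 < e -> exists2 m, m \is a Num.int & `|m - val g w| < e.
  move=> /(near_coef g w)/gF[h [Fh hg]]; exists (val h w) => //.
  exact: free_subgroup_integral.
have [m mi mg] := approx 2^-1 ltac:(by rewrite invr_gt0).
(* If [m] missed the coefficient, an integer approximation closer than [m] would be at distance less
   than 1 from [m], hence equal to it. *)
have [<- //|mg0] := eqVneq m (val g w).
have d0 : 0 < `|m - val g w| by rewrite normr_gt0 subr_eq0.
have [m' m'i m'g] := approx _ d0.
suff mm : m' = m by move: m'g; rewrite mm ltxx.
apply: int_near_eq => //; rewrite -(subrKA (val g w)).
by rewrite (le_lt_trans (ler_normD _ _))// [X in _ + X]distrC; lra.
Qed.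

Lemma closure_free_subgroup : closure F `&` circ = circ `&` integral.
Proof.
apply/seteqP; split=> g [ga gb]; first by split => //; exact: closure_integral.
split=> //.
have /choice[y yP] k : exists y, F y /\ eqlt k (val y) (val g).
  by have [y] := free_subgroup_dense k ga gb; exists y.
have yg : y @ \oo --> g.
  apply: cvg_series1 => w; apply: cvg_near_cst; exists (size w).+1 => //= k wk.
  by apply: (proj2 (yP k)).
move=> B /yg[k _ kB]; exists (y k); split; first by case: (yP k).
exact/kB/leqnn.
Qed.

(** By Magnus's theorem the elements of [F] of order at least [k.+1] form its [k]-th lower central
    term, so cosets are balls for the coefficient topology. *)
Lemma left_coset_lower_central k x : F x ->
  left_coset x (lower_central F k) =
  [set y | F y /\ eqlt k.+1 (val y) (val x)].
Proof.
have FG := free_subgroupG R n; have [F1 FM FV] := FG.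
move=> Fx; apply/seteqP; split=> [_ [y yk <-]|y [Fy yx]].
  split; first by apply: FM => //; exact: (gam_subH FG (k := k.+1)).
  have y1 : order_ge k.+1 y by exact: (@gam_order_ge R n k.+1).
  by rewrite -[X in eqlt _ _ X]mulr1; exact: eqltM.
exists (x^-1 * y)%g; last by rewrite mulVKg.
apply: free_subgroup_order_ge; first by apply: FM => //; exact: FV.
by apply/order_ge_quot; exact: eqlt_sym.
Qed.

(** Balls in [F] also make sense around a center outside [F]; around a point of the closure they are
    cosets by density. *)
Definition series_cosets x : S :=
  fun k => [set y | F y /\ eqlt k.+1 (val y) (val x)].

Lemma series_cosets_eqlt k x y : eqlt k.+1 (val x) (val y) ->
  series_cosets x k = series_cosets y k.
Proof.
move=> xy; apply/seteqP; split=> z [Fz zx]; split => //.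
  exact: eqlt_trans zx xy.
exact: eqlt_trans zx (eqlt_sym xy).
Qed.

Lemma series_cosets_free x : F x -> series_cosets x = to_completion F x.
Proof.
by move=> Fx; apply/funext => k; rewrite /to_completion left_coset_lower_central.
Qed.

(* The coefficient of a word of length k is read off any element of the k-th
   coset. *)
Definition cosets_series_fun (c : S) : afr R n :=
  fun w => val (xget 1%g (c (size w))) w.

Fact cosets_series_subproof c : cosets_series_fun c [::] == 1.
Proof. exact/eqP/series1_nil. Qed.

Definition cosets_series c := Series1 (cosets_series_subproof c).

Lemma cosets_series_eqlt (c : S) k z : pronilpotent_completion F c -> c k z ->
  eqlt k.+1 (val (cosets_series c)) (val z).
Proof.
move=> [cF cS] czk w; rewrite ltnS => wk.
have cz : c (size w) z.
  move: czk; rewrite -(subnK wk); elim: (k - size w)%N => // m IH.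
  by rewrite addSn => /cS.
have [x Fx cx] := cF (size w); rewrite /= /cosets_series_fun.
have := xgetI 1%g cz; move: cz; rewrite cx left_coset_lower_central//.
by move=> [_ zx] [_ yx]; rewrite zx ?yx.
Qed.

Lemma pronilpotent_nonempty (c : S) k : pronilpotent_completion F c ->
  exists2 z, F z & c k z /\ c k = series_cosets z k.
Proof.
move=> [/(_ k)[x Fx ->] _]; exists x => //.
by rewrite left_coset_lower_central.
Qed.

Lemma cosets_seriesK c : pronilpotent_completion F c ->
  series_cosets (cosets_series c) = c.
Proof.
move=> cP; apply/funext => k; have [z Fz [cz ->]] := pronilpotent_nonempty k cP.
exact/series_cosets_eqlt/cosets_series_eqlt.
Qed.

Lemma cosets_series_mem c : pronilpotent_completion F c ->
  circ (cosets_series c) /\ integral (cosets_series c).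
Proof.
move=> cP; split=> [|w]; last first.
  have [z Fz [cz _]] := pronilpotent_nonempty (size w) cP.
  by rewrite (cosets_series_eqlt cP cz)//; exact: free_subgroup_integral.
apply/funext => u; apply/funext => v.
have [z Fz [cz _]] := pronilpotent_nonempty (size u + size v) cP.
have zc w : (size w <= size u + size v)%N -> val (cosets_series c) w = val z w.
  by move=> wuv; apply: (cosets_series_eqlt cP cz).
rewrite -[RHS]/(val (cosets_series c) u * val (cosets_series c) v).
rewrite (zc u) ?(zc v) ?leq_addl ?leq_addr//.
rewrite -[RHS](congr1 (fun H : afr2 R n => H u v) (free_subgroup_circ Fz)).
by apply: eq_big_seq => t /size_mix /zc.
Qed.

Lemma series_cosets_completion x : circ x -> integral x ->
  pronilpotent_completion F (series_cosets x).
Proof.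
move=> xc xi; split=> [k|k y [Fy yx]]; last first.
  by split => //; exact: eqltW yx.
have [y Fy yx] := free_subgroup_dense k.+1 xc xi; exists y => //.
by rewrite left_coset_lower_central//; exact/series_cosets_eqlt/eqlt_sym.
Qed.

Lemma series_cosetsK x : circ x -> integral x ->
  cosets_series (series_cosets x) = x.
Proof.
move=> xc xi; apply/val_inj/funext => w.
have [y Fy yx] := free_subgroup_dense (size w).+1 xc xi.
rewrite (@cosets_series_eqlt _ (size w) y)//; first exact: yx.
exact: series_cosets_completion.
Qed.

Lemma series_cosetsM x y : circ x -> integral x ->
  series_cosets (x * y)%g = completion_mul (series_cosets x) (series_cosets y).
Proof.
have [F1 FM FV] := free_subgroupG R n.
move=> xc xi; apply/funext => k; apply/seteqP; split=> [z [Fz zxy]|].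
  have [a Fa ax] := free_subgroup_dense k.+1 xc xi.
  exists a; first by split.
  exists (a^-1 * z)%g; last by rewrite mulVKg.
  split; first by apply: FM => //; exact: FV.
  rewrite -(mulKg x y); have /eqlt_inv ax' := ax.
  exact: eqltM.
move=> _ [a [Fa ax] [b [Fb bx] <-]]; split; first exact: FM.
exact: eqltM.
Qed.

(** Integral series that differ by less than 1 on the finitely many words of length at most [k]
    agree there, so each coset is locally constant. *)
Lemma series_cosets_continuous :
  {within circ `&` integral, continuous series_cosets}.
Proof.
apply/subspace_continuousP => x [xc xi].
apply: (@cvg_prod _ nat
  (fun=> discrete_topology (set (series1 R n)) : topologicalType)) => k.
move=> B /nbhs_singleton Bx; rewrite /within /= /nbhs /=.
have near_words : \forall y \near x, forall i : 'I_(size (words n k)),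
    `|val y (nth [::] (words n k) i) - val x (nth [::] (words n k) i)| < 1.
  pose C (i : 'I_(size (words n k))) (y : series1 R n) :=
    `|val y (nth [::] (words n k) i) - val x (nth [::] (words n k) i)| < 1.
  by apply: (@filter_forall _ _ C (nbhs x) (nbhs_filter x)) => i; exact: near_coef.
apply: filterS near_words => y yx [yc yi] /=.
suff E : series_cosets y k = series_cosets x k by exact: (eq_ind_r B Bx E).
apply: series_cosets_eqlt => w wk.
have win : w \in words n k by rewrite mem_words.
apply: int_near_eq => //.
have iw : (index w (words n k) < size (words n k))%N by rewrite index_mem.
by have := yx (Ordinal iw); rewrite /= nth_index.
Qed.

Lemma cosets_series_continuous : continuous cosets_series.
Proof.
apply: continuous_series1 => w c.
have proj := @proj_continuous nat
  (fun=> discrete_topology (set (series1 R n)) : topologicalType) (size w) c.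
apply: (@continuous_comp _ _ _ (fun c : S => c (size w))
  (fun X : discrete_topology (set (series1 R n)) => val (xget 1%g X) w)).
  exact: proj.
move=> B /nbhs_singleton Bc.
by apply: filterS (discrete_set1 _) => _ ->.
Qed.

Lemma completion_iso : topgroup_iso (fun x y : series1 R n => (x * y)%g)
  (@completion_mul (series1 R n)) (circ `&` integral)
  (pronilpotent_completion F) series_cosets.
Proof.
split.
- split=> [x [xc xi]|x y|c cP].
  + exact: series_cosets_completion.
  + move=> /set_mem[xc xi] /set_mem[yc yi] xy.
    by rewrite -(series_cosetsK xc xi) xy series_cosetsK.
  + by exists (cosets_series c); [exact: cosets_series_mem|exact: cosets_seriesK].
- by move=> x y [xc xi] _; exact: series_cosetsM.
- exact: series_cosets_continuous.
exists cosets_series; split; first by move=> x [xc xi]; exact: series_cosetsK.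
exact/continuous_subspaceT/cosets_series_continuous.
Qed.

End Completion.

Theorem theorem1p1 (R : realType) (n : nat) (n_ge1 : (1 <= n)%N) :
  (exists! delta : afr R n -> afr2 R n, is_coproduct delta) /\
  forall delta : afr R n -> afr2 R n, is_coproduct delta ->
    (is_subgroup (Fr_circ delta) /\
     exists (Fr : forall k : nat, nilpotent_lie_group (fr R n k))
            (p : forall k : nat, Fr k.+1 -> Fr k),
       (forall k : nat, lie_group_hom (@fr_proj R n k) (p k)) /\
       exists f : series1 R n -> prod_topology (fun k : nat => Fr k),
         topgroup_iso (fun x y : series1 R n => (x * y)%g) (@pointwise_mul (fun k : nat => Fr k))
           (Fr_circ delta) (inverse_limit p) f) /\
    (free_subgroup R n `<=` Fr_circ delta /\
     let calF := closure (free_subgroup R n) `&` Fr_circ delta in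
     [/\ is_subgroup calF,
         calF = Fr_circ delta `&` integral_series R n &
         exists f : series1 R n -> {ptws nat -> discrete_topology (set (series1 R n))},
           (forall x, free_subgroup R n x ->
              f x = to_completion (free_subgroup R n) x) /\
           topgroup_iso (fun x y : series1 R n => (x * y)%g) (@completion_mul (series1 R n))
             calF (pronilpotent_completion (free_subgroup R n)) f]).
Proof.
split; first exact: exists_unique_coproduct.
move=> delta /is_coproduct_mixcop -> {delta}.
have circG := @Fr_circ_subgroup R n; split.
  split => //.
  exists (fr_lie_group R n), (@fr_group_proj R n); split.
    by move=> k; exact: fr_group_proj_hom.
  by exists (@fr_tower R n); exact: fr_tower_iso.
split; first exact: free_subgroup_circ.
rewrite closure_free_subgroup; split => //.
  have [c1 cM cV] := circG; have [i1 iM iV] := @integral_subgroup R n.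
  by split=> [//|x y [xc xi] [yc yi]|x [xc xi]]; split;
    [exact: cM|exact: iM|exact: cV|exact: iV].
exists (@series_cosets R n); split; first exact: series_cosets_free.
exact: completion_iso.
Qed.
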